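(* Let $(n_k)_{k\ge1}$ be a sequence of positive integers satisfying the Hadamard gap condition: there is $q>1$ with $n_{k+1}/n_k\ge q$ for all $k\ge1$. Let $\sigma:\mathbb N\to\mathbb N$ be any permutation of the positive integers. Then, on the probability space $([0,1],\mathcal B,\lambda)$ ($\lambda$ = Lebesgue measure), $$N^{-1/2}\sum_{k=1}^N \cos 2\pi n_{\sigma(k)}x \xrightarrow{\ \mathcal D\ } \mathcal N(0,1/2)\qquad (N\to\infty),$$ and $$\limsup_{N\to\infty}\frac{\sum_{k=1}^N\cos 2\pi n_{\sigma(k)}x}{\sqrt{N\log\log N}}=1\quad\text{for }\lambda\text{-almost every }x\in[0,1].$$
   Context: $\xrightarrow{\mathcal D}$ denotes convergence in distribution of functions of $x$ viewed as random variables on $([0,1],\mathcal B,\lambda)$; $\mathcal N(0,1/2)$ is the centered normal law with variance $1/2$. *)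

(* Defs.v *)
From Stdlib Require Import Reals Lra.
Open Scope R_scope.

(* Hadamard gap condition for a sequence of positive integers indexed from 0
   (index k here corresponds to index k+1 in the paper). *)
Definition hadamard_gap (n : nat -> nat) : Prop :=
  (forall k, (0 < n k)%nat) /\
  exists q : R, 1 < q /\ forall k, INR (n (S k)) >= q * INR (n k).

(* A permutation of the index set (nat, shifted by one from the paper). *)
Definition is_permutation (s : nat -> nat) : Prop :=
  (forall i j, s i = s j -> i = j) /\ (forall m, exists k, s k = m).

Fixpoint psum (n s : nat -> nat) (N : nat) (x : R) : R :=
  match N with
  | O => 0
  | S N' => psum n s N' x + cos (2 * PI * INR (n (s N')) * x)
  end.

Definition gauss_half_density (u : R) : R := exp (- (u * u)) / sqrt PI.

Definition ind_le (n s : nat -> nat) (N : nat) (t : R) (x : R) : R :=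
  if Rle_dec (psum n s N x / sqrt (INR N)) t then 1 else 0.

Definition lebesgue_null (P : R -> Prop) : Prop :=
  forall eps, eps > 0 ->
    exists a b : nat -> R,
      (forall i, a i <= b i) /\
      (forall x, P x -> exists i, a i < x < b i) /\
      (forall m, sum_f_R0 (fun i => b i - a i) m <= eps).

Definition limsup_eq (u : nat -> R) (l : R) : Prop :=
  (forall eps, eps > 0 -> exists N0, forall N, (N >= N0)%nat -> u N < l + eps) /\
  (forall eps, eps > 0 -> forall N0, exists N, (N >= N0)%nat /\ u N > l - eps).

(* Main.v *)
(** The order of summation only enters through finite sets of frequencies: a weighted sum over
    [s 0, ..., s (N-1)] is a weighted lacunary sum in the natural order.  So everything rests on
    estimates for [S = sum_k a_k cos (2 pi n_k x)], with [V = sum_k a_k^2], that depend only on [V]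
    and [max |a_k|].

    The indices are cut into long blocks separated by gaps of bounded length, whose position is
    chosen by pigeonhole so that they carry a small part of [V].  If [Y] is the sum over one block,
    all nonzero frequencies of [1 + z Y + z^2 Y^2 / 2] exceed those of the product over the previous
    blocks, so the mean of the product of these factors is exactly the product of their means
    [1 + z^2 v / 4], where [v] is the sum of the [a_k^2] over the block.  For [z = 1] this gives
    [E exp S = exp ((1 + o(1)) V / 4)], for [z = i] the characteristic function [exp (- V / 4)] with
    a power saving; a Riesz product bound [E exp S <= exp (C V)] takes care of the gaps.

    The central limit theorem follows by testing against trigonometric polynomials.  In the law of
    the iterated logarithm the upper half is Borel-Cantelli with dyadic chaining.  For the lower half
    the block sums [X_j] over [theta^j <= k < theta^(j+1)] are tested with [cos^(2M) ((X_j - b) / 2b)]: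
    these are pairwise almost uncorrelated by the characteristic function estimate, and their means
    are bounded below by exponential tilting, so that a second moment argument applies. *)

Require Import Defs.
From Stdlib Require Import Reals Lra Lia Psatz ClassicalEpsilon Cantor ZArith Ranalysis5.
From Coquelicot Require Import Coquelicot.
From Stdlib Require Import List.
Import ListNotations.
Open Scope R_scope.

(** A permutation may interleave the frequencies of different increments completely, so neither
    martingale structure nor independence is available along the order of summation. What survives
    is that a linear combination of increments is again a weighted lacunary sum. Hence chaining in
    place of a maximal inequality, and joint characteristic functions of two increments in place of
    conditioning.

    Blocks of indices have bounded length because comparing [exp Y] with its quadratic polynomial
    costs [|Y|^3]; summed over blocks this is a constant times [V max |a_k|]. The gaps are
    negligible only through their share of [V], so a cheap way to drop them is needed: convexity of
    [exp] for real exponents, a second moment for oscillating ones.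

    In the lower half, the normalized coefficients of the blocks [I <= j < 2 I] are exponentially
    small in [I], while the tests have frequencies polynomial in [I]; a power saving in the
    characteristic function therefore beats the [I^2] pairs of blocks. *)

Fixpoint rsum (f : nat -> R) (n : nat) : R :=
  match n with O => 0 | S m => rsum f m + f m end.

Fixpoint rprod (f : nat -> R) (n : nat) : R :=
  match n with O => 1 | S m => rprod f m * f m end.

Lemma rsum_ext f g n : (forall i, (i < n)%nat -> f i = g i) -> rsum f n = rsum g n.
Proof.
  induction n as [|n IH]; simpl; intros H; [reflexivity|].
  rewrite IH by (intros; apply H; lia). rewrite H by lia. reflexivity.
Qed.

Lemma rsum_le f g n : (forall i, (i < n)%nat -> f i <= g i) -> rsum f n <= rsum g n.
Proof.
  induction n as [|n IH]; simpl; intros H; [lra|].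
  assert (rsum f n <= rsum g n) by (apply IH; intros; apply H; lia).
  assert (f n <= g n) by (apply H; lia). lra.
Qed.

Lemma rsum_plus f g n : rsum (fun i => f i + g i) n = rsum f n + rsum g n.
Proof. induction n as [|n IH]; simpl; [lra|rewrite IH; lra]. Qed.

Lemma rsum_scal c f n : rsum (fun i => c * f i) n = c * rsum f n.
Proof. induction n as [|n IH]; simpl; [lra|rewrite IH; lra]. Qed.

Lemma rsum_const c n : rsum (fun _ => c) n = INR n * c.
Proof. induction n as [|n IH]; [simpl; lra|]. rewrite S_INR. simpl. rewrite IH. lra. Qed.

Lemma rsum_zero f n : (forall i, (i < n)%nat -> f i = 0) -> rsum f n = 0.
Proof. intros H. rewrite (rsum_ext _ (fun _ => 0)) by exact H. rewrite rsum_const. lra. Qed.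

Lemma rsum_nonneg f n : (forall i, (i < n)%nat -> 0 <= f i) -> 0 <= rsum f n.
Proof.
  intros H. rewrite <- (rsum_zero (fun _ => 0) n) by reflexivity. now apply rsum_le.
Qed.

Lemma rsum_add f p q : rsum f (p + q) = rsum f p + rsum (fun i => f (p + i)%nat) q.
Proof.
  induction q as [|q IH]; simpl.
  - rewrite Nat.add_0_r. lra.
  - rewrite Nat.add_succ_r. simpl. rewrite IH. lra.
Qed.

Lemma rsum_exchange (f : nat -> nat -> R) m n :
  rsum (fun i => rsum (f i) n) m = rsum (fun j => rsum (fun i => f i j) m) n.
Proof.
  induction m as [|m IH]; simpl.
  - symmetry. now apply rsum_zero.
  - rewrite IH, <- rsum_plus. reflexivity.
Qed.

Lemma rsum_Rabs f n : Rabs (rsum f n) <= rsum (fun i => Rabs (f i)) n.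
Proof.
  induction n as [|n IH]; simpl; [rewrite Rabs_R0; lra|].
  eapply Rle_trans; [apply Rabs_triang|lra].
Qed.

Lemma rsum_mono f p q : (p <= q)%nat -> (forall i, 0 <= f i) -> rsum f p <= rsum f q.
Proof.
  intros Hpq H. replace q with (p + (q - p))%nat by lia. rewrite rsum_add.
  assert (0 <= rsum (fun i => f (p + i)%nat) (q - p)) by (apply rsum_nonneg; auto). lra.
Qed.

Lemma rsum_term f n j : (forall i, 0 <= f i) -> (j < n)%nat -> f j <= rsum f n.
Proof.
  intros H Hj. apply Rle_trans with (rsum f (S j)).
  - simpl. assert (0 <= rsum f j) by (apply rsum_nonneg; auto). lra.
  - now apply rsum_mono.
Qed.

Lemma rsum_sqr f n : (rsum f n)^2 <= INR n * rsum (fun i => (f i)^2) n.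
Proof.
  induction n as [|n IH]; [simpl; lra|].
  cbn [rsum].
  set (A := rsum f n) in *. set (B := rsum (fun i => f i ^ 2) n) in *. set (y := f n).
  assert (H : 2 * A * y <= B + INR n * y^2).
  { destruct n as [|n].
    - unfold A, B. simpl. lra.
    - assert (Hn : 0 < INR (S n)) by (apply lt_0_INR; lia).
      set (N := INR (S n)) in *.
      assert (A^2 / N <= B).
      { apply Rmult_le_reg_r with N; [exact Hn|]. unfold Rdiv. rewrite Rmult_assoc, Rinv_l by lra. lra. }
      assert (0 <= (A / N - y)^2 * N) by (apply Rmult_le_pos; [apply pow2_ge_0|lra]).
      assert ((A / N - y)^2 * N = A^2/N - 2*A*y + N*y^2) by (field; lra).
      lra. }
  rewrite S_INR. replace ((INR n + 1) * (B + y ^ 2)) with (INR n * B + B + INR n * y^2 + y^2) by ring. lra.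
Qed.

Lemma rprod_ext f g n : (forall i, (i < n)%nat -> f i = g i) -> rprod f n = rprod g n.
Proof.
  induction n as [|n IH]; simpl; intros H; [reflexivity|].
  rewrite IH by (intros; apply H; lia). rewrite H by lia. reflexivity.
Qed.

Lemma rprod_nonneg f n : (forall i, (i < n)%nat -> 0 <= f i) -> 0 <= rprod f n.
Proof.
  induction n as [|n IH]; simpl; intros H; [lra|].
  apply Rmult_le_pos; [apply IH; intros; apply H; lia|apply H; lia].
Qed.

Lemma rprod_le f g n : (forall i, (i < n)%nat -> 0 <= f i <= g i) -> rprod f n <= rprod g n.
Proof.
  induction n as [|n IH]; simpl; intros H; [lra|].
  apply Rmult_le_compat.
  - apply rprod_nonneg; intros; apply H; lia.
  - apply H; lia.
  - apply IH; intros; apply H; lia.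
  - apply H; lia.
Qed.

Lemma rprod_mult f g n : rprod (fun i => f i * g i) n = rprod f n * rprod g n.
Proof. induction n as [|n IH]; simpl; [lra|rewrite IH; lra]. Qed.

Lemma rprod_exp f n : rprod (fun i => exp (f i)) n = exp (rsum f n).
Proof. induction n as [|n IH]; simpl; [now rewrite exp_0|now rewrite IH, exp_plus]. Qed.

Lemma exp_le x y : x <= y -> exp x <= exp y.
Proof. intros [H|H]; [left; now apply exp_increasing|right; now rewrite H]. Qed.

(** * Means over the unit interval *)

Definition cont (f : R -> R) : Prop := forall x, continuous f x.
(** The functions averaged this way are continuous, so the Riemann integral serves as expectation;
    [markov] later turns small means into coverings. *)
Definition E (f : R -> R) : R := RInt f 0 1.

Lemma cont_const c : cont (fun _ => c).
Proof. intros x. apply continuous_const. Qed.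
Lemma cont_id : cont (fun x => x).
Proof. intros x. apply continuous_id. Qed.
Lemma cont_plus f g : cont f -> cont g -> cont (fun x => f x + g x).
Proof. intros Hf Hg x. now apply (continuous_plus f g). Qed.
Lemma cont_minus f g : cont f -> cont g -> cont (fun x => f x - g x).
Proof. intros Hf Hg x. now apply (continuous_minus f g). Qed.
Lemma cont_opp f : cont f -> cont (fun x => - f x).
Proof. intros Hf x. now apply (continuous_opp f). Qed.
Lemma cont_mult f g : cont f -> cont g -> cont (fun x => f x * g x).
Proof. intros Hf Hg x. now apply (continuous_mult f g). Qed.
Lemma cont_comp f g : cont g -> cont f -> cont (fun x => g (f x)).
Proof. intros Hg Hf x. apply (continuous_comp f g); auto. Qed.
Lemma cont_exp : cont exp.
Proof. intros x. apply continuity_pt_filterlim, derivable_continuous_pt, derivable_pt_exp. Qed.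
Lemma cont_cos : cont cos.
Proof. intros x. apply continuity_pt_filterlim, derivable_continuous_pt, derivable_pt_cos. Qed.
Lemma cont_sin : cont sin.
Proof. intros x. apply continuity_pt_filterlim, derivable_continuous_pt, derivable_pt_sin. Qed.
Lemma cont_expf f : cont f -> cont (fun x => exp (f x)).
Proof. intros; apply cont_comp; [apply cont_exp|assumption]. Qed.
Lemma cont_cosf f : cont f -> cont (fun x => cos (f x)).
Proof. intros; apply cont_comp; [apply cont_cos|assumption]. Qed.
Lemma cont_sinf f : cont f -> cont (fun x => sin (f x)).
Proof. intros; apply cont_comp; [apply cont_sin|assumption]. Qed.
Lemma cont_Rabs f : cont f -> cont (fun x => Rabs (f x)).
Proof. intros H. apply (cont_comp f Rabs); [intro; apply continuous_Rabs|assumption]. Qed.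
Lemma cont_pow f k : cont f -> cont (fun x => f x ^ k).
Proof. intros H. induction k; simpl; [apply cont_const|now apply cont_mult]. Qed.
Lemma cont_div f c : cont f -> cont (fun x => f x / c).
Proof. intros H. apply cont_mult; [assumption|apply cont_const]. Qed.
Lemma cont_rsum (f : nat -> R -> R) n : (forall i, cont (f i)) -> cont (fun x => rsum (fun i => f i x) n).
Proof. intros H. induction n; simpl; [apply cont_const|now apply cont_plus]. Qed.
Lemma cont_rprod (f : nat -> R -> R) n : (forall i, cont (f i)) -> cont (fun x => rprod (fun i => f i x) n).
Proof. intros H. induction n; simpl; [apply cont_const|now apply cont_mult]. Qed.

Lemma cont_Rmult c : cont (Rmult c).
Proof. exact (cont_mult _ _ (cont_const c) cont_id). Qed.
Lemma cont_Rplus c : cont (Rplus c).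
Proof. exact (cont_plus _ _ (cont_const c) cont_id). Qed.
Lemma cont_Rminus c : cont (Rminus c).
Proof. exact (cont_minus _ _ (cont_const c) cont_id). Qed.
Lemma cont_Ropp : cont Ropp.
Proof. exact (cont_opp _ cont_id). Qed.

Ltac conti :=
  repeat match goal with
  | |- cont Ropp => apply cont_Ropp
  | |- cont (Rmult _) => apply cont_Rmult
  | |- cont (Rplus _) => apply cont_Rplus
  | |- cont (Rminus _) => apply cont_Rminus
  | |- forall _ : nat, cont _ => intros ?
  | H : cont ?f |- cont ?f => exact H
  | H : cont ?f |- cont (fun x => ?f x) => exact H
  | H : forall i, cont (?f i) |- cont (?f _) => apply H
  | H : forall i, cont (?f i) |- cont (fun x => ?f _ x) => apply H
  | H : forall i, cont (fun x => _) |- cont _ => apply H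
  | H : cont (fun x => _) |- cont _ => exact H
  | |- cont (fun x => x) => exact cont_id
  | |- cont (fun _ => ?c) => exact (cont_const c)
  | |- cont exp => exact cont_exp
  | |- cont cos => exact cont_cos
  | |- cont sin => exact cont_sin
  | |- cont (fun x => rsum _ _) => apply cont_rsum; intro
  | |- cont (fun x => rprod _ _) => apply cont_rprod; intro
  | |- cont (fun x => _ ^ _) => apply cont_pow
  | |- cont (fun x => exp _) => apply cont_expf
  | |- cont (fun x => cos _) => apply cont_cosf
  | |- cont (fun x => sin _) => apply cont_sinf
  | |- cont (fun x => Rabs _) => apply cont_Rabs
  | |- cont (fun x => _ / _) => apply cont_div
  | |- cont (fun x => _ * _) => apply cont_mult
  | |- cont (fun x => _ + _) => apply cont_plus
  | |- cont (fun x => _ - _) => apply cont_minus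
  | |- cont (fun x => - _) => apply cont_opp
  end.

Lemma cont_ext f g : (forall x, f x = g x) -> cont f -> cont g.
Proof. intros H Hf x. apply (continuous_ext f g); auto. Qed.

Lemma cont_ex_RInt f a b : cont f -> ex_RInt f a b.
Proof. intros H. apply (ex_RInt_continuous (V := R_CompleteNormedModule)); intros; apply H. Qed.

Lemma E_ext f g : (forall x, f x = g x) -> E f = E g.
Proof. intros H. apply RInt_ext; intros; apply H. Qed.
Lemma E_plus f g : cont f -> cont g -> E (fun x => f x + g x) = E f + E g.
Proof. intros Hf Hg. apply (RInt_plus f g); now apply cont_ex_RInt. Qed.
Lemma E_scal c f : cont f -> E (fun x => c * f x) = c * E f.
Proof. intros Hf. apply (RInt_scal f); now apply cont_ex_RInt. Qed.
Lemma E_const c : E (fun _ => c) = c.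
Proof. unfold E. rewrite RInt_const. unfold scal; simpl; unfold mult; simpl. lra. Qed.
Lemma E_opp f : cont f -> E (fun x => - f x) = - E f.
Proof.
  intros Hf. rewrite (E_ext _ (fun x => (-1) * f x)) by (intros; lra).
  rewrite E_scal by assumption. lra.
Qed.
Lemma E_minus f g : cont f -> cont g -> E (fun x => f x - g x) = E f - E g.
Proof.
  intros Hf Hg. unfold Rminus. rewrite E_plus by conti. rewrite E_opp by conti. reflexivity.
Qed.
Lemma E_le f g : cont f -> cont g -> (forall x, f x <= g x) -> E f <= E g.
Proof. intros Hf Hg H. apply RInt_le; try (now apply cont_ex_RInt); [lra|auto]. Qed.
Lemma E_nonneg f : cont f -> (forall x, 0 <= f x) -> 0 <= E f.
Proof. intros Hf H. rewrite <- (E_const 0). apply E_le; conti; auto. Qed.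
Lemma E_between f lo hi : cont f -> (forall x, lo <= f x <= hi) -> lo <= E f <= hi.
Proof.
  intros cf H. split; [rewrite <- (E_const lo)|rewrite <- (E_const hi)]; apply E_le; conti; apply H.
Qed.
Lemma E_abs f : cont f -> Rabs (E f) <= E (fun x => Rabs (f x)).
Proof.
  intros Hf. apply Rabs_le. split.
  - rewrite <- E_opp by conti. apply E_le; conti. intros x.
    generalize (Rle_abs (- f x)); rewrite Rabs_Ropp; lra.
  - apply E_le; conti. intros; apply Rle_abs.
Qed.
Lemma E_rsum (f : nat -> R -> R) n : (forall i, cont (f i)) ->
  E (fun x => rsum (fun i => f i x) n) = rsum (fun i => E (f i)) n.
Proof.
  intros H. induction n as [|n IH]; simpl; [apply E_const|].
  rewrite E_plus; [now rewrite IH|conti|apply H].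
Qed.

Lemma E_cos_nat j : (0 < j)%nat -> E (fun x => cos (2 * PI * INR j * x)) = 0.
Proof.
  intros Hj. assert (HP := PI_RGT_0). assert (Hj' : 0 < INR j) by now apply lt_0_INR.
  assert (Hw : 2 * PI * INR j <> 0) by (apply Rgt_not_eq, Rmult_lt_0_compat; lra).
  set (w := 2 * PI * INR j) in *.
  unfold E. transitivity (sin (w * 1) / w - sin (w * 0) / w).
  - apply is_RInt_unique.
    apply (is_RInt_derive (fun x => sin (w * x) / w) (fun x => cos (w * x))).
    + intros x _. auto_derive; [trivial|field; exact Hw].
    + intros x _. apply (cont_cosf (fun x => w * x)). conti.
  - rewrite Rmult_0_r, sin_0, Rmult_1_r. unfold w.
    replace (2 * PI * INR j) with (0 + 2 * INR j * PI) by ring. rewrite sin_period, sin_0. lra.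
Qed.

(** * Even trigonometric polynomials with frequencies in [(lo, hi]] *)

Inductive spec (lo hi : R) : (R -> R) -> Prop :=
| spec_nil f : (forall x, f x = 0) -> spec lo hi f
| spec_cons c j f g : lo < INR j <= hi -> spec lo hi f ->
    (forall x, g x = c * cos (2 * PI * INR j * x) + f x) -> spec lo hi g.

Lemma spec_cont lo hi f : spec lo hi f -> cont f.
Proof.
  induction 1 as [f H|c j f g Hj Hf IH H].
  - apply (cont_ext (fun _ => 0)); [auto|conti].
  - eapply cont_ext; [intros; symmetry; apply H|]. conti.
Qed.

Lemma spec_ext lo hi f g : (forall x, f x = g x) -> spec lo hi f -> spec lo hi g.
Proof.
  intros He Hf. destruct Hf as [f H|c j f g' Hj Hf H].
  - apply spec_nil. intros; rewrite <- He; auto.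
  - eapply spec_cons; [exact Hj|exact Hf|]. intros; rewrite <- He; auto.
Qed.

Lemma spec_single lo hi c j : lo < INR j <= hi -> spec lo hi (fun x => c * cos (2 * PI * INR j * x)).
Proof.
  intros H. apply spec_cons with c j (fun _ => 0); [assumption|now apply spec_nil|intros; lra].
Qed.

Lemma spec_plus lo hi f g : spec lo hi f -> spec lo hi g -> spec lo hi (fun x => f x + g x).
Proof.
  induction 1 as [f H|c j f f' Hj Hf IH H]; intros Hg.
  - eapply spec_ext; [|exact Hg]. intros; simpl; rewrite H; lra.
  - apply (spec_cons _ _ c j (fun x => f x + g x)); [exact Hj|apply IH, Hg|]. intros; simpl; rewrite H; ring.
Qed.

Lemma spec_scal lo hi c f : spec lo hi f -> spec lo hi (fun x => c * f x).
Proof.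
  induction 1 as [f H|c' j f f' Hj Hf IH H].
  - apply spec_nil. intros; rewrite H; lra.
  - eapply (spec_cons _ _ (c * c')); [exact Hj|exact IH|]. intros; simpl; rewrite H; ring.
Qed.

Lemma spec_mono lo hi lo' hi' f : lo' <= lo -> hi <= hi' -> spec lo hi f -> spec lo' hi' f.
Proof.
  intros H1 H2. induction 1 as [f H|c' j f f' Hj Hf IH H].
  - now apply spec_nil.
  - eapply spec_cons; [|exact IH|exact H]. lra.
Qed.

(** A lower end [-1] admits frequency 0, hence constants; a lower end [0 <= lo] forbids it, which is
    what [spec_E0] exploits. *)
Lemma spec_const hi c : 0 <= hi -> spec (-1) hi (fun _ => c).
Proof.
  intros H. eapply spec_ext; [|apply (spec_single (-1) hi c 0)].
  - intros x. simpl. rewrite Rmult_0_r, Rmult_0_l, cos_0. lra.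
  - simpl. lra.
Qed.

Lemma cos_cos_diff j k x : (j <= k)%nat ->
  cos (2 * PI * INR j * x) * cos (2 * PI * INR k * x) =
  / 2 * cos (2 * PI * INR (k + j) * x) + / 2 * cos (2 * PI * INR (k - j) * x).
Proof.
  intros H. rewrite plus_INR, minus_INR by exact H.
  replace (2 * PI * (INR k + INR j) * x) with (2*PI*INR k*x + 2*PI*INR j*x) by ring.
  replace (2 * PI * (INR k - INR j) * x) with (2*PI*INR k*x - 2*PI*INR j*x) by ring.
  rewrite cos_plus, cos_minus. field.
Qed.

(** Product-to-sum turns frequencies [j], [k] into [k + j] and [|k - j|]. The difference is the
    smaller one, so only the difference needs a lower bound and only the sum an upper one. The two
    cases express [|k - j|] by subtraction in [nat]. *)
Lemma spec_mul_gen lo1 hi1 lo2 hi2 lo hi f g :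
  (forall j k, lo1 < INR j <= hi1 -> lo2 < INR k <= hi2 ->
     (j <= k)%nat /\ lo < INR (k - j) /\ INR (k + j) <= hi \/
     (k <= j)%nat /\ lo < INR (j - k) /\ INR (k + j) <= hi) ->
  spec lo1 hi1 f -> spec lo2 hi2 g -> spec lo hi (fun x => f x * g x).
Proof.
  intros Hjk Hf Hg. induction Hf as [f H|c j f f' Hj Hf IH H].
  - apply spec_nil. intros; rewrite H; lra.
  - apply spec_ext with (fun x => c * cos (2 * PI * INR j * x) * g x + f x * g x);
      [intros; rewrite H; ring|].
    apply spec_plus; [|exact IH]. clear IH.
    induction Hg as [g Hg0|d k g g' Hk Hg IH Hg0].
    + apply spec_nil. intros; rewrite Hg0; lra.
    + apply spec_ext with (fun x => (c * d) * (cos (2 * PI * INR j * x) * cos (2 * PI * INR k * x))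
        + c * cos (2 * PI * INR j * x) * g x); [intros; rewrite Hg0; ring|].
      apply spec_plus; [|exact IH]. apply spec_scal.
      destruct (Hjk j k Hj Hk) as [(Hle & H1 & H2)|(Hle & H1 & H2)].
      * eapply spec_ext; [intros; symmetry; apply (cos_cos_diff j k x Hle)|].
        assert (INR (k - j) <= INR (k + j)) by (apply le_INR; lia).
        apply spec_plus; apply spec_single; lra.
      * eapply spec_ext; [intros x; symmetry; rewrite Rmult_comm; apply (cos_cos_diff k j x Hle)|].
        rewrite (Nat.add_comm k j) in H2.
        assert (INR (j - k) <= INR (j + k)) by (apply le_INR; lia).
        apply spec_plus; apply spec_single; lra.
Qed.

Lemma spec_mul_low h1 h2 f g :
  spec (-1) h1 f -> spec (-1) h2 g -> spec (-1) (h1 + h2) (fun x => f x * g x).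
Proof.
  apply spec_mul_gen. intros j k Hj Hk. rewrite plus_INR.
  destruct (Nat.le_ge_cases j k) as [H|H]; [left|right]; (split; [exact H|]).
  - split; [|lra]. generalize (pos_INR (k - j)); lra.
  - split; [|lra]. generalize (pos_INR (j - k)); lra.
Qed.

Lemma spec_E0 lo hi f : 0 <= lo -> spec lo hi f -> E f = 0.
Proof.
  intros Hlo. induction 1 as [f H|c j f f' Hj Hf IH H].
  - rewrite (E_ext _ (fun _ => 0)) by exact H. apply E_const.
  - rewrite (E_ext _ _ H). rewrite E_plus; [|conti|now apply spec_cont with lo hi].
    rewrite E_scal by conti. rewrite IH, E_cos_nat; [lra|].
    apply INR_lt. simpl. lra.
Qed.

(** Every frequency of [g] exceeds every frequency of [f], so no difference vanishes and the product
    has no constant term. This orthogonality takes the place of independence. *)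
Lemma spec_E_mul h lo hi f g :
  0 <= h -> h <= lo -> spec (-1) h f -> spec lo hi g -> E (fun x => f x * g x) = 0.
Proof.
  intros Hh Hlo Hf Hg. apply (spec_E0 0 (h + hi)); [lra|].
  revert Hf Hg. apply spec_mul_gen. intros j k Hj Hk. left.
  assert (j < k)%nat by (apply INR_lt; lra).
  split; [lia|]. rewrite plus_INR. split; [|lra].
  apply lt_0_INR. lia.
Qed.

(* Real and imaginary part of the product of the [A k + i B k] for [k < n]. *)
Fixpoint cprod (A B : nat -> R) (n : nat) : R * R :=
  match n with
  | O => (1, 0)
  | S m => let '(u, v) := cprod A B m in (u * A m - v * B m, u * B m + v * A m)
  end.

Lemma cprod_real A n : cprod A (fun _ => 0) n = (rprod A n, 0).
Proof. induction n as [|n IH]; simpl; [reflexivity|]. rewrite IH. f_equal; ring. Qed.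

(* The frequencies of the [b]-th factor exceed all those of the product of the previous ones,
   so only its constant term contributes to the mean. *)
Lemma cprod_mean (tau : nat -> R) (A B : nat -> R -> R) (D H : nat -> R) :
  (forall b, 0 <= D b) -> (forall b, 0 <= H b) -> (forall b, D b + H b <= D (S b)) ->
  (forall b, spec (D b) (H b) (fun x => A b x - tau b)) ->
  (forall b, spec (D b) (H b) (B b)) ->
  forall n,
    (spec (-1) (D n) (fun x => fst (cprod (fun b => A b x) (fun b => B b x) n)) /\
     spec (-1) (D n) (fun x => snd (cprod (fun b => A b x) (fun b => B b x) n))) /\
    E (fun x => fst (cprod (fun b => A b x) (fun b => B b x) n)) = rprod tau n /\
    E (fun x => snd (cprod (fun b => A b x) (fun b => B b x) n)) = 0.
Proof.
  intros HD HH HDH HA HB n. induction n as [|n [[IH1 IH2] [IH3 IH4]]].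
  - simpl. repeat split; try apply spec_const; try apply HD; apply E_const.
  - set (u := fun x => fst (cprod (fun b => A b x) (fun b => B b x) n)) in *.
    set (v := fun x => snd (cprod (fun b => A b x) (fun b => B b x) n)) in *.
    assert (Hfst : forall x, u x * A n x + (-1) * (v x * B n x) =
       fst (cprod (fun b => A b x) (fun b => B b x) (S n))).
    { intros x. unfold u, v. simpl. destruct (cprod _ _ n). simpl. ring. }
    assert (Hsnd : forall x, u x * B n x + v x * A n x =
       snd (cprod (fun b => A b x) (fun b => B b x) (S n))).
    { intros x. unfold u, v. simpl. destruct (cprod _ _ n). simpl. ring. }
    assert (HA' : spec (-1) (H n) (A n)).
    { apply spec_ext with (fun x => tau n + (A n x - tau n)); [intros; ring|].
      apply spec_plus; [apply spec_const, HH|].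
      apply spec_mono with (D n) (H n); [generalize (HD n); lra|lra|apply HA]. }
    assert (HB' : spec (-1) (H n) (B n)).
    { apply spec_mono with (D n) (H n); [generalize (HD n); lra|lra|apply HB]. }
    assert (Hlow : forall f g, spec (-1) (D n) f -> spec (-1) (H n) g ->
      spec (-1) (D (S n)) (fun x => f x * g x)).
    { intros f g Hf Hg. apply spec_mono with (-1) (D n + H n); [lra|apply HDH|].
      now apply spec_mul_low. }
    assert (cu := spec_cont _ _ _ IH1). assert (cv := spec_cont _ _ _ IH2).
    assert (cA := spec_cont _ _ _ HA'). assert (cB := spec_cont _ _ _ HB').
    (* Split [A n] into its constant term [tau n] and a remainder orthogonal to everything built
       from earlier factors. *)
    assert (HEA : forall f, spec (-1) (D n) f -> cont f -> E (fun x => f x * A n x) = E f * tau n).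
    { intros f Hf cf. rewrite (E_ext _ (fun x => tau n * f x + f x * (A n x - tau n))) by (intros; ring).
      rewrite E_plus by conti. rewrite E_scal by conti.
      rewrite (spec_E_mul (D n) (D n) (H n) f (fun x => A n x - tau n)); auto; try lra. }
    assert (HEB : forall f, spec (-1) (D n) f -> E (fun x => f x * B n x) = 0).
    { intros f Hf. apply (spec_E_mul (D n) (D n) (H n)); auto. lra. }
    repeat split.
    + apply (spec_ext _ _ _ _ Hfst). apply spec_plus; [auto|]. apply spec_scal. auto.
    + apply (spec_ext _ _ _ _ Hsnd). apply spec_plus; auto.
    + rewrite <- (E_ext _ _ Hfst). rewrite E_plus by conti. rewrite E_scal by conti.
      rewrite HEA, HEB by assumption. rewrite IH3. simpl. ring.
    + rewrite <- (E_ext _ _ Hsnd). rewrite E_plus by conti.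
      rewrite HEA, HEB by assumption. rewrite IH4. ring.
Qed.

(** * Elementary inequalities *)

(** The Taylor inequalities below come from differentiating the difference of both sides until a
    known sign appears. *)
Lemma nonneg_of_derive (g dg : R -> R) (y : R) :
  0 <= y -> (forall t, 0 <= t <= y -> is_derive g t (dg t)) ->
  (forall t, 0 <= t <= y -> 0 <= dg t) -> 0 <= g 0 -> 0 <= g y.
Proof.
  intros Hy Hd Hp H0.
  destruct (MVT_gen g 0 y dg) as (c & Hc & H).
  - intros x Hx. rewrite Rmin_left, Rmax_right in Hx by lra. apply Hd; lra.
  - intros x Hx. rewrite Rmin_left, Rmax_right in Hx by lra.
    apply continuity_pt_filterlim. apply (ex_derive_continuous g). exists (dg x). apply Hd; lra.
  - rewrite Rmin_left, Rmax_right in Hc by lra.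
    assert (0 <= dg c * (y - 0)) by (apply Rmult_le_pos; [apply Hp; lra|lra]). lra.
Qed.

Ltac by_derive g dg :=
  apply (nonneg_of_derive g dg);
  [ lra | intros ? ?; auto_derive; [trivial|try field; try lra] | intros ? ? | ].

Lemma exp_ge_1_plus_sqr y : 0 <= y -> 1 + y + y^2/2 <= exp y.
Proof.
  intros Hy. cut (0 <= exp y - (1 + y + y^2/2)); [lra|].
  by_derive (fun y => exp y - (1 + y + y^2/2)) (fun y => exp y - (1 + y)).
  - generalize (exp_ineq1_le t); lra.
  - rewrite exp_0. lra.
Qed.

Lemma exp_le_cubic y : 0 <= y <= 1 -> exp y <= 1 + y + y^2/2 + y^3/2.
Proof.
  intros Hy. cut (0 <= 1 + y + y^2/2 + y^3/2 - exp y); [lra|].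
  by_derive (fun y => 1 + y + y^2/2 + y^3/2 - exp y) (fun y => 1 + y + 3/2*y^2 - exp y); [|rewrite exp_0; lra].
  by_derive (fun y => 1 + y + 3/2*y^2 - exp y) (fun y => 1 + 3*y - exp y); [|rewrite exp_0; lra].
  by_derive (fun y => 1 + 3*y - exp y) (fun y => 3 - exp y); [|rewrite exp_0; lra].
  assert (exp t1 <= exp 1) by (apply exp_le; lra). generalize exp_le_3; lra.
Qed.

Lemma exp_opp_bounds y : 0 <= y -> 0 <= 1 - y + y^2/2 - exp (- y) <= y^3/6.
Proof.
  intros Hy. split.
  - by_derive (fun y => 1 - y + y^2/2 - exp (-y)) (fun y => -1 + y + exp (-y)).
    + generalize (exp_ineq1_le (-t)); lra.
    + rewrite Ropp_0, exp_0. lra.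
  - cut (0 <= y^3/6 - (1 - y + y^2/2 - exp (-y))); [lra|].
    by_derive (fun y => y^3/6 - (1 - y + y^2/2 - exp (-y))) (fun y => y^2/2 + 1 - y - exp (-y)).
    2: rewrite Ropp_0, exp_0; lra.
    by_derive (fun y => y^2/2 + 1 - y - exp (-y)) (fun y => y - 1 + exp (-y)).
    + generalize (exp_ineq1_le (-t0)); lra.
    + rewrite Ropp_0, exp_0. lra.
Qed.

Lemma exp_taylor2 y : Rabs y <= 1 -> Rabs (exp y - (1 + y + y^2/2)) <= Rabs y ^ 3 / 2.
Proof.
  intros Hy. destruct (Rle_dec 0 y) as [H|H].
  - rewrite (Rabs_pos_eq y) in * by lra.
    generalize (exp_ge_1_plus_sqr y H) (exp_le_cubic y (conj H Hy)). intros.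
    rewrite Rabs_pos_eq by lra. lra.
  - rewrite (Rabs_left y) in * by lra.
    generalize (exp_opp_bounds (-y) ltac:(lra)). rewrite Ropp_involutive. intros [H1 H2].
    rewrite Rabs_minus_sym, Rabs_pos_eq; nra.
Qed.

Lemma sin_taylor y : 0 <= y -> y - y^3/6 <= sin y <= y.
Proof.
  assert (H1 : forall y, 0 <= y -> sin y <= y).
  { intros z Hz. cut (0 <= z - sin z); [lra|].
    by_derive (fun z => z - sin z) (fun z => 1 - cos z).
    - generalize (COS_bound t); lra.
    - rewrite sin_0; lra. }
  intros Hy. split; [|auto].
  cut (0 <= sin y - (y - y^3/6)); [lra|].
  by_derive (fun y => sin y - (y - y^3/6)) (fun y => cos y - (1 - y^2/2)); [|rewrite sin_0; lra].
  by_derive (fun y => cos y - (1 - y^2/2)) (fun y => y - sin y); [|rewrite cos_0; lra].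
  generalize (H1 t0 ltac:(lra)); lra.
Qed.

Lemma cos_taylor y : 0 <= y -> 1 - y^2/2 <= cos y <= 1 - y^2/2 + y^3/6.
Proof.
  intros Hy. split.
  - cut (0 <= cos y - (1 - y^2/2)); [lra|].
    by_derive (fun y => cos y - (1 - y^2/2)) (fun y => y - sin y); [|rewrite cos_0; lra].
    generalize (sin_taylor t ltac:(lra)); lra.
  - cut (0 <= 1 - y^2/2 + y^3/6 - cos y); [lra|].
    by_derive (fun y => 1 - y^2/2 + y^3/6 - cos y) (fun y => - y + y^2/2 + sin y); [|rewrite cos_0; lra].
    by_derive (fun y => - y + y^2/2 + sin y) (fun y => -1 + y + cos y); [|rewrite sin_0; lra].
    by_derive (fun y => -1 + y + cos y) (fun y => 1 - sin y); [|rewrite cos_0; lra].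
    generalize (SIN_bound t1); lra.
Qed.

Lemma cos_taylor_abs y : Rabs (cos y - (1 - y^2/2)) <= Rabs y ^ 3 / 6.
Proof.
  assert (H : forall z, 0 <= z -> Rabs (cos z - (1 - z^2/2)) <= z^3/6).
  { intros z Hz. generalize (cos_taylor z Hz). intros. rewrite Rabs_pos_eq; lra. }
  unfold Rabs at 2. destruct (Rcase_abs y).
  - rewrite <- cos_neg. replace (y^2) with ((-y)^2) by ring. apply H. lra.
  - apply H. lra.
Qed.

Lemma sin_taylor_abs y : Rabs (sin y - y) <= Rabs y ^ 3 / 6.
Proof.
  assert (H : forall z, 0 <= z -> Rabs (sin z - z) <= z^3/6).
  { intros z Hz. generalize (sin_taylor z Hz). intros. rewrite Rabs_left1; lra. }
  unfold Rabs at 2. destruct (Rcase_abs y).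
  - replace (sin y - y) with (- (sin (-y) - (-y))) by (rewrite sin_neg; ring).
    rewrite Rabs_Ropp. apply H. lra.
  - apply H. lra.
Qed.

(** Since [1 + y + y^2/2 = (1 + (1 + y)^2) / 2 >= 1/2], the additive Taylor error becomes a
    multiplicative one. An exponential of a sum can then be compared factor by factor with a product
    of trigonometric polynomials. *)
Lemma exp_sandwich y : Rabs y <= 1/2 ->
  (1 + y + y^2/2) * exp (-2 * Rabs y ^ 3) <= exp y <= (1 + y + y^2/2) * exp (Rabs y ^ 3) /\
  1/2 <= 1 + y + y^2/2.
Proof.
  intros Hy. assert (H := exp_taylor2 y ltac:(lra)).
  assert (HT : 1/2 <= 1 + y + y^2/2) by (generalize (pow2_ge_0 (1+y)); nra).
  set (T := 1 + y + y^2/2) in *.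
  assert (Ha := Rabs_pos y). set (a := Rabs y) in *.
  assert (0 <= a^3 <= 1/8).
  { split; [apply pow_le; lra|]. apply Rle_trans with ((1/2)^3); [apply pow_incr; lra|lra]. }
  apply Rabs_le_between in H.
  split; [|exact HT]. split.
  - assert (H2 : exp (-2 * a^3) <= 1 - a^3).
    { generalize (exp_opp_bounds (2 * a^3) ltac:(lra)).
      replace (- (2*a^3)) with (-2*a^3) by ring. intros [H3 _].
      set (b := a^3) in *. nra. }
    nra.
  - generalize (exp_ineq1_le (a^3)). nra.
Qed.

(** Tangent line at the intermediate point. After taking means it does the work of Hölder's
    inequality when a small part of a sum is split off. *)
Lemma exp_convex t x y : 0 <= t <= 1 -> exp (t * x + (1 - t) * y) <= t * exp x + (1 - t) * exp y.
Proof.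
  intros Ht. set (z := t * x + (1 - t) * y).
  assert (H : forall u, exp z * (1 + (u - z)) <= exp u).
  { intros u. replace u with (z + (u - z)) at 2 by ring. rewrite exp_plus.
    apply Rmult_le_compat_l; [left; apply exp_pos|apply exp_ineq1_le]. }
  generalize (H x) (H y). intros Hx Hy.
  assert (t * (exp z * (1 + (x - z))) + (1 - t) * (exp z * (1 + (y - z))) = exp z) by (unfold z; ring).
  nra.
Qed.

(** The sharp exponent is [y^2 / 2]; the lost factor only enlarges the subgaussian constant. *)
Lemma cosh_le y : (exp y + exp (- y)) / 2 <= exp (y^2).
Proof.
  assert (H : forall y, 0 <= y -> (exp y + exp (- y)) / 2 <= exp (y^2)).
  { clear y. intros y Hy. destruct (Rle_dec y 1) as [H|H].
    - generalize (exp_le_cubic y (conj Hy H)) (exp_opp_bounds y Hy) (exp_ineq1_le (y^2)). nra.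
    - assert (exp (-y) <= exp y) by (apply exp_le; lra).
      assert (exp y <= exp (y^2)) by (apply exp_le; nra). lra. }
  destruct (Rle_dec 0 y) as [Hy|Hy]; [auto|].
  replace (y^2) with ((-y)^2) by ring. rewrite <- (Ropp_involutive y) at 1.
  rewrite (Rplus_comm (exp (- - y))). apply H. lra.
Qed.

Lemma exp_1plus u : 0 <= u -> exp (u - u^2) <= 1 + u.
Proof.
  intros Hu. assert (H := exp_ineq1_le (- (u / (1 + u)))).
  assert (H1 : 1 + - (u / (1 + u)) = / (1 + u)) by (field; lra).
  rewrite H1, exp_Ropp in H. apply Rle_trans with (exp (u / (1 + u))).
  - apply exp_le. assert (0 <= u^3 / (1 + u)).
    { apply Rdiv_le_0_compat; [apply pow_le; lra|lra]. }
    replace (u - u^2) with (u / (1+u) - u^3/(1+u)) by (field; lra). lra.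
  - apply Rinv_le_contravar in H; [|apply Rinv_0_lt_compat; lra].
    now rewrite !Rinv_inv in H.
Qed.

Lemma exp_1minus u : 0 <= u <= 1/2 -> exp (- u - u^2) <= 1 - u <= exp (- u).
Proof.
  intros Hu. split.
  - assert (H := exp_ge_1_plus_sqr (u + u^2) ltac:(nra)). replace (- u - u^2) with (- (u + u^2)) by ring.
    rewrite exp_Ropp. apply Rmult_le_reg_l with (exp (u + u^2)); [apply exp_pos|].
    rewrite Rinv_r by (apply Rgt_not_eq, exp_pos).
    apply Rle_trans with ((1 + (u + u^2) + (u + u^2)^2/2) * (1 - u)); [|apply Rmult_le_compat_r; lra].
    assert (0 <= u^2 * (1 - u - u^2 - u^3)); [|lra].
    apply Rmult_le_pos; [apply pow2_ge_0|]. nra.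
  - generalize (exp_ineq1_le (-u)); lra.
Qed.

Lemma exp_opp_lip x y : 0 <= x -> 0 <= y -> Rabs (exp (- x) - exp (- y)) <= Rabs (x - y).
Proof.
  assert (H : forall x y, 0 <= x <= y -> 0 <= exp (-x) - exp (-y) <= y - x).
  { clear. intros x y Hxy. assert (exp (-y) <= exp (-x)) by (apply exp_le; lra).
    split; [lra|].
    assert (exp (-x) <= 1) by (rewrite <- exp_0; apply exp_le; lra).
    assert (0 < exp (-x)) by apply exp_pos.
    replace (-y) with (-x + (x - y)) by ring. rewrite exp_plus.
    generalize (exp_ineq1_le (x - y)). nra. }
  intros Hx Hy. destruct (Rle_dec x y).
  - generalize (H x y ltac:(lra)). intros. rewrite Rabs_pos_eq by lra.
    rewrite Rabs_minus_sym, Rabs_pos_eq; lra.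
  - generalize (H y x ltac:(lra)). intros. rewrite Rabs_minus_sym, Rabs_pos_eq by lra.
    rewrite Rabs_pos_eq; lra.
Qed.

Lemma cos_lip x y : Rabs (cos x - cos y) <= Rabs (x - y).
Proof.
  rewrite form2. rewrite !Rabs_mult. rewrite (Rabs_left (-2)) by lra.
  assert (H : forall z, Rabs (sin z) <= Rabs z).
  { assert (H0 : forall z, 0 <= z -> Rabs (sin z) <= z).
    { intros z Hz. destruct (Rle_dec z 1).
      - generalize (sin_taylor z Hz). intros. rewrite Rabs_pos_eq; nra.
      - apply Rle_trans with 1; [|lra]. apply Rabs_le, SIN_bound. }
    intros z. unfold Rabs at 2. destruct (Rcase_abs z).
    - rewrite <- (Rabs_Ropp (sin z)), <- sin_neg. apply H0. lra.
    - apply H0. lra. }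
  assert (H1 := H ((x - y) / 2)).
  assert (H2 : Rabs (sin ((x + y) / 2)) <= 1) by (apply Rabs_le, SIN_bound).
  replace (Rabs ((x - y)/2)) with (Rabs (x - y) / 2) in H1
    by (unfold Rdiv; rewrite Rabs_mult, (Rabs_pos_eq (/2)); lra).
  generalize (Rabs_pos (sin ((x - y) / 2))) (Rabs_pos (sin ((x + y) / 2))). nra.
Qed.

Lemma sin_lip x y : Rabs (sin x - sin y) <= Rabs (x - y).
Proof.
  rewrite !sin_cos. replace (- cos (PI/2 + x) - - cos (PI/2+y)) with (- (cos (PI/2+x) - cos (PI/2+y))) by ring.
  rewrite Rabs_Ropp. eapply Rle_trans; [apply cos_lip|]. right. f_equal. ring.
Qed.

(** * Rearranging finite sums: residue classes, averages, selection *)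

Lemma spec_rsum lo hi (f : nat -> R -> R) n :
  (forall i, (i < n)%nat -> spec lo hi (f i)) -> spec lo hi (fun x => rsum (fun i => f i x) n).
Proof.
  induction n as [|n IH]; intros H; simpl.
  - now apply spec_nil.
  - apply spec_plus; [apply IH; intros; apply H; lia|apply H; lia].
Qed.

Lemma rsum_supp f K K' : (K <= K')%nat -> (forall k, (K <= k)%nat -> f k = 0) -> rsum f K' = rsum f K.
Proof.
  intros HK H. replace K' with (K + (K' - K))%nat by lia. rewrite rsum_add.
  rewrite (rsum_zero (fun i => f (K + i)%nat)); [lra|]. intros; apply H; lia.
Qed.

Lemma rsum_residues f J r :
  rsum f (J * r) = rsum (fun t => rsum (fun j => f (t + j * r)%nat) J) r.
Proof.
  induction J as [|J IH]; simpl.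
  - symmetry. now apply rsum_zero.
  - rewrite Nat.add_comm, rsum_add, IH, <- rsum_plus. apply rsum_ext. intros.
    do 2 f_equal. lia.
Qed.

(** Jensen's inequality, from the tangent of the exponential at the average [z] of the
    [INR r * f t]. It reduces a sum over [r] residue classes to the separate classes. *)
Lemma exp_rsum_mean f r : (0 < r)%nat ->
  exp (rsum f r) <= / INR r * rsum (fun t => exp (INR r * f t)) r.
Proof.
  intros Hr. assert (Hr' : 0 < INR r) by now apply lt_0_INR.
  set (z := rsum f r).
  assert (H : rsum (fun t => exp z * (1 - z) + exp z * INR r * f t) r <= rsum (fun t => exp (INR r * f t)) r).
  { apply rsum_le. intros t _.
    assert (exp (INR r * f t) = exp z * exp (INR r * f t - z)) by (rewrite <- exp_plus; f_equal; ring).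
    generalize (exp_ineq1_le (INR r * f t - z)) (exp_pos z). nra. }
  rewrite rsum_plus, rsum_const, rsum_scal in H. fold z in H.
  apply Rmult_le_reg_l with (INR r); [exact Hr'|].
  rewrite <- Rmult_assoc, Rinv_r by lra. lra.
Qed.

Lemma pow_unbounded q A : 1 < q -> exists r : nat, (0 < r)%nat /\ A <= q ^ r.
Proof.
  intros Hq. destruct (Pow_x_infinity q) with (b := Rabs A + 1) as (N & HN).
  - rewrite Rabs_pos_eq; lra.
  - exists (S N). split; [lia|]. specialize (HN (S N) ltac:(lia)).
    rewrite Rabs_pos_eq in HN by (apply pow_le; lra). generalize (Rle_abs A). lra.
Qed.

Lemma cprod_ext A B A' B' k : (forall i, A i = A' i) -> (forall i, B i = B' i) ->
  cprod A B k = cprod A' B' k.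
Proof.
  intros HA HB. induction k as [|k IH]; simpl; [reflexivity|]. rewrite IH, HA, HB. reflexivity.
Qed.

Lemma rsum_min f m : (0 < m)%nat -> exists o, (o < m)%nat /\ INR m * f o <= rsum f m.
Proof.
  induction m as [|m IH]; [lia|]. intros _. destruct m as [|m].
  - exists 0%nat. split; [lia|]. simpl. lra.
  - destruct IH as (o & Ho & H); [lia|]. rewrite S_INR. change (rsum f (S (S m))) with (rsum f (S m) + f (S m)).
    assert (H1 : 0 < INR (S m)) by (apply lt_0_INR; lia). set (N := INR (S m)) in *.
    destruct (Rle_dec (f o) (f (S m))) as [Hle|Hle].
    + exists o. split; [lia|]. lra.
    + exists (S m). split; [lia|]. nra.
Qed.

Lemma rsum_select c m y : (c < m)%nat -> rsum (fun o => if Nat.eqb c o then y else 0) m = y.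
Proof.
  induction m as [|m IH]; intros H; [lia|]. simpl. destruct (Nat.eq_dec c m) as [->|Hne].
  - rewrite Nat.eqb_refl. rewrite rsum_zero; [lra|]. intros i Hi.
    replace (Nat.eqb m i) with false by (symmetry; apply Nat.eqb_neq; lia). reflexivity.
  - replace (Nat.eqb c m) with false by (symmetry; apply Nat.eqb_neq; lia). rewrite IH by lia. lra.
Qed.

(** * Weighted lacunary sums in the natural order of frequencies *)

Section Lacunary.

Context (n : nat -> nat) (q : R) (Hpos : forall k, (0 < n k)%nat) (Hq : 1 < q)
        (Hgap : forall k, INR (n (S k)) >= q * INR (n k)).

Definition wave (k : nat) (x : R) : R := cos (2 * PI * INR (n k) * x).
Definition block (a : nat -> R) (l len : nat) (x : R) : R :=
  rsum (fun i => a (l + i)%nat * wave (l + i) x) len.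

Lemma freq_pos k : 0 < INR (n k).
Proof. apply lt_0_INR, Hpos. Qed.

Lemma freq_pow k d : q ^ d * INR (n k) <= INR (n (k + d)).
Proof.
  induction d as [|d IH].
  - rewrite Nat.add_0_r. simpl. lra.
  - rewrite Nat.add_succ_r. simpl. generalize (Hgap (k + d)). nra.
Qed.

Lemma freq_mono j k : (j <= k)%nat -> INR (n j) <= INR (n k).
Proof.
  intros H. replace k with (j + (k - j))%nat by lia.
  eapply Rle_trans; [|apply freq_pow].
  assert (1 <= q ^ (k - j)) by (apply pow_R1_Rle; lra). generalize (freq_pos j). nra.
Qed.

(** The gap ratio keeps a difference of frequencies comparable to the larger one; the factor
    [1 - / q] is what the lower cutoff loses when a block is squared. *)
Lemma freq_diff j k : (j < k)%nat -> (n j <= n k)%nat /\ (1 - / q) * INR (n k) <= INR (n k - n j).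
Proof.
  intros H. assert (Hjk : q * INR (n j) <= INR (n k)).
  { eapply Rle_trans; [|apply (freq_mono (S j)); lia]. generalize (Hgap j). lra. }
  assert (Hle : (n j <= n k)%nat) by (apply INR_le; generalize (freq_pos j); nra).
  split; [exact Hle|]. rewrite minus_INR by exact Hle.
  assert (INR (n j) <= / q * INR (n k)); [|lra].
  apply Rmult_le_reg_l with q; [lra|]. rewrite <- Rmult_assoc, Rinv_r by lra. lra.
Qed.

Lemma cont_wave k : cont (wave k).
Proof. unfold wave. conti. Qed.

Lemma cont_block a l len : cont (block a l len).
Proof. unfold block. apply cont_rsum. intros. apply cont_mult; [apply cont_const|apply cont_wave]. Qed.

Lemma wave_bound k x : Rabs (wave k x) <= 1.
Proof. apply Rabs_le, COS_bound. Qed.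

Lemma block_spec a l len lo hi :
  (forall i, (i < len)%nat -> a (l + i)%nat = 0 \/ lo < INR (n (l + i)) <= hi) ->
  spec lo hi (block a l len).
Proof.
  intros H. apply spec_rsum. intros i Hi. destruct (H i Hi) as [H0|H0].
  - apply spec_nil. intros. rewrite H0. ring.
  - now apply spec_single.
Qed.

Lemma wave_sqr_spec lo hi k : 0 <= lo < INR (n k) -> INR (n k) <= hi ->
  spec lo (2 * hi) (fun x => wave k x ^ 2 - / 2).
Proof.
  intros Hlo Hhi. apply spec_ext with (fun x => / 2 * cos (2 * PI * INR (n k + n k) * x)).
  - intros x. unfold wave.
    replace (cos (2 * PI * INR (n k) * x) ^ 2) with
      (cos (2 * PI * INR (n k) * x) * cos (2 * PI * INR (n k) * x)) by ring.
    rewrite (cos_cos_diff (n k) (n k) x) by lia. rewrite Nat.sub_diag. simpl (INR 0).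
    rewrite Rmult_0_r, Rmult_0_l, cos_0. ring.
  - apply spec_single. rewrite plus_INR. lra.
Qed.

Lemma wave_mul_spec lo hi j k : 0 <= lo < INR (n k) -> INR (n k) <= hi -> (j < k)%nat ->
  spec ((1 - / q) * lo) (2 * hi) (fun x => wave j x * wave k x).
Proof.
  intros Hlo Hhi Hjk. destruct (freq_diff j k Hjk) as [Hle Hd].
  assert (Hq1 : 0 < 1 - / q).
  { assert (/ q < 1) by (rewrite <- Rinv_1; apply Rinv_lt_contravar; lra). lra. }
  assert (H1 : (1 - / q) * lo < (1 - / q) * INR (n k)) by (apply Rmult_lt_compat_l; lra).
  assert (H2 := freq_mono j k ltac:(lia)).
  assert (H3 : INR (n k - n j) <= INR (n k + n j)) by (apply le_INR; lia).
  assert (H4 : INR (n k + n j) <= 2 * hi) by (rewrite plus_INR; lra).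
  eapply spec_ext; [intros x; symmetry; apply (cos_cos_diff (n j) (n k) x Hle)|].
  apply spec_plus; apply spec_single; lra.
Qed.

(** Diagonal terms contribute the constants [a^2 / 2] and doubled frequencies; cross terms stay
    above [(1 - / q) * lo] by [freq_diff]. Vanishing coefficients are exempt from the frequency
    condition so that masked blocks are covered. *)
Lemma block_sqr_spec a l len lo hi : 0 <= lo ->
  (forall i, (i < len)%nat -> a (l + i)%nat = 0 \/ lo < INR (n (l + i)) <= hi) ->
  spec ((1 - / q) * lo) (2 * hi)
    (fun x => block a l len x ^ 2 - rsum (fun i => a (l + i)%nat ^ 2) len / 2).
Proof.
  intros Hlo. unfold block. induction len as [|len IH]; intros H.
  - apply spec_nil. intros. simpl. lra.
  - set (k := (l + len)%nat).
    apply spec_ext with (fun x =>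
      (rsum (fun i => a (l + i)%nat * wave (l + i) x) len ^ 2 - rsum (fun i => a (l + i)%nat ^ 2) len / 2)
      + (rsum (fun i => (2 * a (l + i)%nat * a k) * (wave (l + i) x * wave k x)) len
         + a k ^ 2 * (wave k x ^ 2 - / 2))).
    { intros x. cbn [rsum].
      rewrite (rsum_ext (fun i => (2 * a (l + i)%nat * a k) * (wave (l + i) x * wave k x))
        (fun i => (2 * a k * wave k x) * (a (l + i)%nat * wave (l + i) x)))
        by (intros; ring).
      rewrite rsum_scal. fold k. field. }
    apply spec_plus; [apply IH; intros; apply H; lia|].
    destruct (H len ltac:(lia)) as [Hk|Hk]; fold k in Hk.
    + apply spec_nil. intros x. rewrite Hk. rewrite rsum_zero; [ring|]. intros; ring.
    + assert (Hq' : 0 < / q) by (apply Rinv_0_lt_compat; lra).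
      apply spec_plus.
      * apply spec_rsum. intros i Hi. apply spec_scal. apply wave_mul_spec; [lra|lra|]. unfold k; lia.
      * apply spec_scal. apply spec_mono with lo (2 * hi); [nra|lra|]. apply wave_sqr_spec; lra.
Qed.

Lemma block_sqr_mean a K : E (fun x => block a 0 K x ^ 2) = rsum (fun k => a k ^ 2) K / 2.
Proof.
  assert (H : E (fun x => block a 0 K x ^ 2 - rsum (fun i => a (0 + i)%nat ^ 2) K / 2) = 0).
  { apply (spec_E0 ((1 - / q) * 0) (2 * INR (n K))); [lra|]. apply block_sqr_spec; [lra|].
    intros i Hi. right. split; [apply freq_pos|apply freq_mono; lia]. }
  rewrite E_minus in H; [|apply cont_pow, cont_block|conti]. rewrite E_const in H.
  simpl Nat.add in H. lra.
Qed.

(* Along indices spaced so that the frequencies at least triple, the products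
   of [exp] linearized by convexity are Riesz products. *)
Lemma riesz_bound (y : nat -> R) r t J : 3 <= q ^ r ->
  E (fun x => exp (rsum (fun j => y j * wave (t + j * r) x) J)) <= exp (rsum (fun j => y j ^ 2) J).
Proof.
  intros Hr.
  set (C := fun j => (exp (y j) + exp (- y j)) / 2).
  set (A := fun j x => C j + (exp (y j) - exp (- y j)) / 2 * wave (t + j * r) x).
  assert (HA : forall j, cont (A j)).
  { intros j. unfold A. apply cont_plus; [apply cont_const|].
    apply cont_mult; [apply cont_const|apply cont_wave]. }
  apply Rle_trans with (E (fun x => rprod (fun j => A j x) J)).
  - apply E_le.
    + apply cont_expf, cont_rsum. intros. apply cont_mult; [apply cont_const|apply cont_wave].
    + apply cont_rprod, HA.
    + intros x. rewrite <- rprod_exp. apply rprod_le. intros j _. split; [left; apply exp_pos|].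
      assert (Hc : -1 <= wave (t + j * r) x <= 1) by apply COS_bound.
      set (c := wave (t + j * r) x) in *.
      replace (y j * c) with ((1 + c) / 2 * y j + (1 - (1 + c) / 2) * (- y j)) by field.
      eapply Rle_trans; [apply exp_convex; lra|]. unfold A, C. fold c. lra.
  (* Frequencies of the product stay below half of the next one: with tripling, [n/2 + n = 3n/2] is
     at most half of the next frequency. *)
  - destruct (cprod_mean C A (fun _ _ => 0) (fun j => INR (n (t + j * r)) / 2)
      (fun j => INR (n (t + j * r)))) with (n := J) as (_ & H & _).
    + intros b. generalize (freq_pos (t + b * r)). lra.
    + intros b. generalize (freq_pos (t + b * r)). lra.
    + intros b. assert (H := freq_pow (t + b * r) r).
      replace (t + b * r + r)%nat with (t + S b * r)%nat in H by lia.
      generalize (freq_pos (t + b * r)). nra.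
    + intros b. apply spec_ext with (fun x => (exp (y b) - exp (- y b)) / 2 * wave (t + b * r) x).
      * intros x. unfold A. ring.
      * apply spec_single. generalize (freq_pos (t + b * r)). lra.
    + intros b. now apply spec_nil.
    + rewrite (E_ext _ (fun x => fst (cprod (fun b => A b x) (fun _ => 0) J)))
        by (intros; now rewrite cprod_real).
      rewrite H. rewrite <- rprod_exp. apply rprod_le. intros j _. split; [|apply cosh_le].
      unfold C. generalize (exp_pos (y j)) (exp_pos (- y j)). lra.
Qed.

(** Split the indices into [r] residue classes with [3 <= q ^ r]. Jensen multiplies each class by
    [INR r], and [riesz_bound] applies to it, hence the constant [INR r ^ 2]. The range is padded
    with zero coefficients to [K * r] to make the classes equally long. *)
Lemma subgaussian : exists C, 0 < C /\ forall a K, (forall k, (K <= k)%nat -> a k = 0) ->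
  E (fun x => exp (block a 0 K x)) <= exp (C * rsum (fun k => a k ^ 2) K).
Proof.
  destruct (pow_unbounded q 3 Hq) as (r & Hr & Hqr).
  assert (Hr' : 0 < INR r) by now apply lt_0_INR.
  exists (INR r ^ 2). split; [now apply pow_lt|]. intros a K Ha.
  set (V := rsum (fun k => a k ^ 2) K).
  assert (HKr : (K <= K * r)%nat) by (destruct r; [lia|nia]).
  assert (HV : V = rsum (fun t => rsum (fun j => a (t + j * r)%nat ^ 2) K) r).
  { rewrite <- (rsum_residues (fun k => a k ^ 2)). unfold V. symmetry. apply rsum_supp; [exact HKr|].
    intros k Hk. rewrite Ha by exact Hk. simpl. ring. }
  set (W := fun t x => rsum (fun j => a (t + j * r)%nat * wave (t + j * r) x) K).
  assert (HW : forall x, block a 0 K x = rsum (fun t => W t x) r).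
  { intros x. unfold W. rewrite <- (rsum_residues (fun k => a k * wave k x)).
    symmetry. apply rsum_supp; [exact HKr|]. intros k Hk. rewrite Ha by exact Hk. ring. }
  assert (HcW : forall t, cont (W t)).
  { intros t. unfold W. apply cont_rsum. intros. apply cont_mult; [apply cont_const|apply cont_wave]. }
  apply Rle_trans with (E (fun x => / INR r * rsum (fun t => exp (INR r * W t x)) r)).
  - apply E_le; [apply cont_expf, cont_block|conti|]. intros x. rewrite HW. now apply exp_rsum_mean.
  - rewrite E_scal by conti. rewrite E_rsum by (intros; conti).
    apply Rle_trans with (/ INR r * rsum (fun _ => exp (INR r ^ 2 * V)) r).
    + apply Rmult_le_compat_l; [left; now apply Rinv_0_lt_compat|].
      apply rsum_le. intros t Ht.
      rewrite (E_ext _ (fun x => exp (rsum (fun j => (INR r * a (t + j * r)%nat) * wave (t + j * r) x) K))).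
      2:{ intros x. unfold W. rewrite <- rsum_scal. f_equal. apply rsum_ext. intros. ring. }
      eapply Rle_trans; [now apply riesz_bound|]. apply exp_le.
      rewrite (rsum_ext _ (fun j => INR r ^ 2 * a (t + j * r)%nat ^ 2)) by (intros; ring).
      rewrite rsum_scal. apply Rmult_le_compat_l; [apply pow2_ge_0|].
      rewrite HV. apply (rsum_term (fun t => rsum (fun j => a (t + j * r)%nat ^ 2) K)); [|exact Ht].
      intros. apply rsum_nonneg. intros. apply pow2_ge_0.
    + rewrite rsum_const. rewrite <- Rmult_assoc, Rinv_l by lra. lra.
Qed.

(* The coefficients are cut into long blocks [ell b, ell (b+1)) of at most [m * s] indices,
   each (but the first) starting with a gap of [s] indices on which [mask a] vanishes. *)
Section Blocks.

Context (s m o : nat) (Hs : (0 < s)%nat) (Hom : (o < m)%nat) (Hqs : 4 / (1 - / q) < q ^ s).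

Definition in_gap (k : nat) : bool := Nat.eqb ((k / s) mod m) o.
Definition mask (a : nat -> R) (k : nat) : R := if in_gap k then 0 else a k.
Definition unmask (a : nat -> R) (k : nat) : R := if in_gap k then a k else 0.

Definition ell (b : nat) : nat := match b with O => O | S c => (o + c * m) * s end.
Definition len (b : nat) : nat := match b with O => o * s | S _ => m * s end.

Lemma ell_S b : ell (S b) = (ell b + len b)%nat.
Proof. destruct b; simpl; lia. Qed.

Lemma len_le b : (len b <= m * s)%nat.
Proof. destruct b; simpl; nia. Qed.

Lemma ell_ge K : (K <= ell (S K))%nat.
Proof. simpl. assert (K <= K * m)%nat by nia. set (t := (K * m)%nat) in *. nia. Qed.

Lemma rsum_ell f B : rsum f (ell B) = rsum (fun b => rsum (fun i => f (ell b + i)%nat) (len b)) B.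
Proof.
  induction B as [|B IH]; [reflexivity|]. rewrite ell_S, rsum_add, IH. reflexivity.
Qed.

Lemma kappa_bounds : 0 < 1 - / q < 1.
Proof.
  assert (0 < / q) by (apply Rinv_0_lt_compat; lra).
  assert (/ q < 1) by (rewrite <- Rinv_1; apply Rinv_lt_contravar; lra). lra.
Qed.

(** Bounds the frequencies of the product over all earlier blocks. The square of the last of them
    reaches at most twice the frequency at [ell b], and everything before it at most as much again:
    hence the 4. *)
Definition low (b : nat) : R := match b with O => 0 | S _ => 4 * INR (n (ell b)) end.

Lemma low_nonneg b : 0 <= low b.
Proof. destruct b as [|b]; unfold low; [lra|]. generalize (freq_pos (ell (S b))). lra. Qed.

Lemma low_step b : low b + 2 * INR (n (ell (S b))) <= low (S b).
Proof.
  destruct b as [|b]; unfold low; [generalize (freq_pos (ell 1)); lra|].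
  assert (H4 : 2 <= q ^ (m * s)).
  { apply Rle_trans with (q ^ s).
    - assert (H := kappa_bounds). apply Rle_trans with (4 / (1 - / q)); [|lra].
      apply Rmult_le_reg_r with (1 - / q); [lra|]. unfold Rdiv. rewrite Rmult_assoc, Rinv_l by lra. lra.
    - apply Rle_pow; [lra|nia]. }
  assert (H := freq_pow (ell (S b)) (m * s)). rewrite (ell_S (S b)). cbn [len].
  generalize (freq_pos (ell (S b))). nra.
Qed.

(** A later block starts at a unit congruent to [o] modulo [m], so its first [s] indices are masked.
    Surviving frequencies exceed the first one by [q ^ s], and [Hqs] thereby provides the 4 of [low]
    together with the factor [1 - / q] consumed by squaring. *)
Lemma mask_freq a b i : (i < len b)%nat ->
  mask a (ell b + i) = 0 \/ low b / (1 - / q) < INR (n (ell b + i)) <= INR (n (ell (S b))).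
Proof.
  intros Hi. destruct (in_gap (ell b + i)) eqn:Hg.
  - left. unfold mask. now rewrite Hg.
  - right. split; [|apply freq_mono; rewrite ell_S; lia].
    destruct b as [|b]; unfold low.
    + unfold Rdiv. rewrite Rmult_0_l. apply freq_pos.
    + assert (Hsi : (s <= i)%nat).
      { destruct (Nat.le_gt_cases s i) as [H|H]; [exact H|exfalso].
        unfold in_gap in Hg. apply Nat.eqb_neq in Hg. apply Hg. cbn [ell].
        rewrite Nat.add_comm, Nat.div_add, (Nat.div_small i s), Nat.add_0_l, Nat.Div0.mod_add by lia.
        apply Nat.mod_small. exact Hom. }
      assert (H1 := freq_pow (ell (S b)) s). assert (H2 := freq_mono (ell (S b) + s) (ell (S b) + i) ltac:(lia)).
      assert (H3 := freq_pos (ell (S b))).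
      replace (4 * INR (n (ell (S b))) / (1 - / q)) with (4 / (1 - / q) * INR (n (ell (S b))))
        by (field; generalize kappa_bounds; lra).
      apply Rlt_le_trans with (q ^ s * INR (n (ell (S b)))); [|lra].
      now apply Rmult_lt_compat_r.
Qed.

Definition bl (a : nat -> R) (b : nat) : R -> R := block (mask a) (ell b) (len b).
Definition var (a : nat -> R) (b : nat) : R := rsum (fun i => mask a (ell b + i) ^ 2) (len b).

Lemma cont_bl a b : cont (bl a b).
Proof. apply cont_block. Qed.

(** The choice [p = r = 1], [p' = 0] gives the real factors, [p = 0], [r = -1], [p' = 1] the complex
    ones. Linear terms have mean zero, so only [r] appears in the result. *)
Lemma blocks_mean a p r p' B :
  E (fun x => fst (cprod (fun b => 1 + p * bl a b x + r * (bl a b x ^ 2 / 2)) (fun b => p' * bl a b x) B))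
    = rprod (fun b => 1 + r * (var a b / 4)) B /\
  E (fun x => snd (cprod (fun b => 1 + p * bl a b x + r * (bl a b x ^ 2 / 2)) (fun b => p' * bl a b x) B)) = 0.
Proof.
  assert (Hk := kappa_bounds).
  assert (Hlo : forall b, 0 <= low b / (1 - / q)).
  { intros b. apply Rdiv_le_0_compat; [apply low_nonneg|lra]. }
  assert (Hb : forall b, spec (low b) (2 * INR (n (ell (S b)))) (bl a b)).
  { intros b. apply spec_mono with (low b / (1 - / q)) (INR (n (ell (S b)))).
    - apply Rmult_le_reg_r with (1 - / q); [lra|]. unfold Rdiv. rewrite Rmult_assoc, Rinv_l by lra.
      generalize (low_nonneg b). nra.
    - generalize (freq_pos (ell (S b))); lra.
    - apply block_spec. intros; now apply mask_freq. }
  assert (Hb2 : forall b, spec (low b) (2 * INR (n (ell (S b)))) (fun x => bl a b x ^ 2 - var a b / 2)).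
  { intros b. replace (low b) with ((1 - / q) * (low b / (1 - / q))) by (field; lra).
    apply block_sqr_spec; [apply Hlo|]. intros; now apply mask_freq. }
  edestruct (cprod_mean (fun b => 1 + r * (var a b / 4))
    (fun b x => 1 + p * bl a b x + r * (bl a b x ^ 2 / 2)) (fun b x => p' * bl a b x)
    low (fun b => 2 * INR (n (ell (S b))))) as (_ & H); [| | | | |exact H].
  - apply low_nonneg.
  - intros b. generalize (freq_pos (ell (S b))); lra.
  - apply low_step.
  - intros b. apply spec_ext with (fun x => p * bl a b x + (r / 2) * (bl a b x ^ 2 - var a b / 2)).
    + intros x. field.
    + apply spec_plus; apply spec_scal; auto.
  - intros b. apply spec_scal; auto.
Qed.

Lemma block_mask_split a K B x : (forall k, (K <= k)%nat -> a k = 0) -> (K <= ell B)%nat ->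
  block (mask a) 0 K x = rsum (fun b => bl a b x) B /\
  rsum (fun k => mask a k ^ 2) K = rsum (var a) B.
Proof.
  intros Ha HK.
  assert (Hm : forall k, (K <= k)%nat -> mask a k = 0).
  { intros k Hk. unfold mask. rewrite Ha by exact Hk. now destruct in_gap. }
  split.
  - rewrite <- (rsum_ell (fun k => mask a k * wave k x)).
    symmetry. apply rsum_supp; [exact HK|]. intros k Hk. rewrite Hm by exact Hk. ring.
  - rewrite <- (rsum_ell (fun k => mask a k ^ 2)).
    symmetry. apply rsum_supp; [exact HK|]. intros k Hk. rewrite Hm by exact Hk. ring.
Qed.

Lemma mask_le a alpha k : (forall k, Rabs (a k) <= alpha) -> Rabs (mask a k) <= alpha.
Proof.
  intros H. unfold mask. destruct in_gap; [|apply H].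
  rewrite Rabs_R0. eapply Rle_trans; [apply Rabs_pos|apply (H k)].
Qed.

Lemma var_nonneg a b : 0 <= var a b.
Proof. apply rsum_nonneg. intros; apply pow2_ge_0. Qed.

(** In the cube one factor is bounded by the sup norm and two by Cauchy-Schwarz. The error summed
    over blocks is then proportional to the total variance and not to the number of blocks. *)
Lemma block_bounds a alpha b x : (forall k, Rabs (a k) <= alpha) ->
  Rabs (bl a b x) <= INR (m * s) * alpha /\
  Rabs (bl a b x) ^ 3 <= INR (m * s) ^ 2 * alpha * var a b /\
  var a b <= INR (m * s) * alpha ^ 2.
Proof.
  intros Ha. assert (Ha0 : 0 <= alpha) by (eapply Rle_trans; [apply Rabs_pos|apply (Ha 0%nat)]).
  assert (Hlen : INR (len b) <= INR (m * s)) by (apply le_INR, len_le).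
  assert (H1 : Rabs (bl a b x) <= INR (m * s) * alpha).
  { eapply Rle_trans; [apply rsum_Rabs|]. apply Rle_trans with (rsum (fun _ => alpha) (len b)).
    - apply rsum_le. intros i _. rewrite Rabs_mult.
      generalize (wave_bound (ell b + i) x) (mask_le a alpha (ell b + i) Ha)
        (Rabs_pos (wave (ell b + i) x)) (Rabs_pos (mask a (ell b + i))). nra.
    - rewrite rsum_const. now apply Rmult_le_compat_r. }
  assert (H2 : bl a b x ^ 2 <= INR (m * s) * var a b).
  { eapply Rle_trans; [apply rsum_sqr|]. apply Rmult_le_compat; [apply pos_INR| |exact Hlen|].
    - apply rsum_nonneg. intros; apply pow2_ge_0.
    - apply rsum_le. intros i _. rewrite Rpow_mult_distr.
      assert (wave (ell b + i) x ^ 2 <= 1).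
      { rewrite <- (pow2_abs (wave _ _)). generalize (wave_bound (ell b + i) x) (Rabs_pos (wave (ell b + i) x)). nra. }
      generalize (pow2_ge_0 (mask a (ell b + i))). nra. }
  repeat split; [exact H1| |].
  - replace (Rabs (bl a b x) ^ 3) with (Rabs (bl a b x) * bl a b x ^ 2) by (rewrite <- pow2_abs; ring).
    replace (INR (m * s) ^ 2 * alpha * var a b) with ((INR (m * s) * alpha) * (INR (m * s) * var a b)) by ring.
    apply Rmult_le_compat; [apply Rabs_pos|apply pow2_ge_0|exact H1|exact H2].
  - apply Rle_trans with (rsum (fun _ => alpha ^ 2) (len b)).
    + apply rsum_le. intros i _. rewrite <- pow2_abs. apply pow_incr. split; [apply Rabs_pos|now apply mask_le].
    + rewrite rsum_const. apply Rmult_le_compat_r; [apply pow2_ge_0|exact Hlen].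
Qed.

(** With [zeta = (m s)^2 alpha], the factorwise comparison of [exp_sandwich] costs [zeta V] above
    and [2 zeta V] below; passing from [1 + u] to [exp u] is free above and costs one more [zeta V]
    below. *)
Lemma mgf_mask a K alpha :
  (forall k, (K <= k)%nat -> a k = 0) -> (forall k, Rabs (a k) <= alpha) -> INR (m * s) * alpha <= 1/2 ->
  let V := rsum (fun k => mask a k ^ 2) K in
  exp (V / 4 - 3 * INR (m * s) ^ 2 * alpha * V) <= E (fun x => exp (block (mask a) 0 K x))
    <= exp (V / 4 + INR (m * s) ^ 2 * alpha * V).
Proof.
  intros Hsupp Ha HPa V.
  assert (Ha0 : 0 <= alpha) by (eapply Rle_trans; [apply Rabs_pos|apply (Ha 0%nat)]).
  assert (HP1 : 1 <= INR (m * s)) by (apply (le_INR 1); nia).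
  (* [S K] blocks reach at least index [K], from which on all coefficients vanish. *)
  set (P := INR (m * s)) in *. set (B := S K).
  assert (HB : (K <= ell B)%nat) by apply ell_ge.
  set (T := fun b x => 1 + bl a b x + bl a b x ^ 2 / 2).
  set (zeta := P ^ 2 * alpha).
  assert (HTc : forall b, cont (T b)).
  { intros b. unfold T. assert (H := cont_bl a b). conti. }
  assert (HET : E (fun x => rprod (fun b => T b x) B) = rprod (fun b => 1 + var a b / 4) B).
  { destruct (blocks_mean a 1 1 0 B) as [H _].
    rewrite (rprod_ext _ (fun b => 1 + 1 * (var a b / 4))) by (intros; lra). rewrite <- H.
    apply E_ext. intros x. rewrite (cprod_ext _ _ (fun b => T b x) (fun _ => 0)).
    - now rewrite cprod_real.
    - intros b. unfold T. ring.
    - intros b. ring. }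
  assert (HV : forall x, block (mask a) 0 K x = rsum (fun b => bl a b x) B /\ V = rsum (var a) B)
    by (intros x; now apply block_mask_split).
  assert (HVB : V = rsum (var a) B) by apply (HV 0).
  assert (Hpt : forall x b, 0 <= T b x * exp (- 2 * (zeta * var a b)) <= exp (bl a b x) /\
                            exp (bl a b x) <= T b x * exp (zeta * var a b)).
  { intros x b. destruct (block_bounds a alpha b x Ha) as (H1 & H2 & _). fold P in H1, H2. fold zeta in H2.
    destruct (exp_sandwich (bl a b x)) as ((H3 & H4) & H5); [lra|]. fold (T b x) in H3, H4, H5.
    assert (exp (- 2 * (zeta * var a b)) <= exp (-2 * Rabs (bl a b x) ^ 3)) by (apply exp_le; lra).
    assert (exp (Rabs (bl a b x) ^ 3) <= exp (zeta * var a b)) by (apply exp_le; lra).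
    assert (0 < exp (- 2 * (zeta * var a b))) by apply exp_pos.
    repeat split; nra. }
  assert (Hexp : forall x c, rprod (fun b => T b x * exp (c * var a b)) B
      = exp (c * V) * rprod (fun b => T b x) B).
  { intros x c. rewrite rprod_mult, rprod_exp, rsum_scal, <- HVB. ring. }
  assert (HcT : cont (fun x => rprod (fun b => T b x) B)) by conti.
  assert (HcS : cont (fun x => exp (block (mask a) 0 K x))) by apply cont_expf, cont_block.
  split.
  - apply Rle_trans with (exp (- 2 * zeta * V) * rprod (fun b => 1 + var a b / 4) B).
    + apply Rle_trans with (exp (- 2 * zeta * V) * exp (V / 4 - zeta * V)).
      { rewrite <- exp_plus. apply exp_le. unfold zeta. lra. }
      apply Rmult_le_compat_l; [left; apply exp_pos|].
      replace (V / 4 - zeta * V) with (rsum (fun b => (/ 4 - zeta) * var a b) B)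
        by (rewrite rsum_scal, <- HVB; field).
      rewrite <- rprod_exp. apply rprod_le. intros b _. split; [left; apply exp_pos|].
      eapply Rle_trans; [|apply exp_1plus; generalize (var_nonneg a b); lra].
      apply exp_le. destruct (block_bounds a alpha b 0 Ha) as (_ & _ & H). fold P in H.
      assert (P * alpha ^ 2 <= zeta).
      { unfold zeta. replace (P ^ 2 * alpha) with (P * alpha * P) by ring.
        replace (P * alpha ^ 2) with (P * alpha * alpha) by ring.
        apply Rmult_le_compat_l; [nra|nra]. }
      generalize (var_nonneg a b). nra.
    + rewrite <- HET, <- E_scal by exact HcT. apply E_le; [conti|exact HcS|].
      intros x. destruct (HV x) as [-> _]. rewrite <- Hexp, <- rprod_exp.
      apply rprod_le. intros b _.
      replace (- 2 * zeta * var a b) with (- 2 * (zeta * var a b)) by ring. apply Hpt.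
  - apply Rle_trans with (exp (zeta * V) * rprod (fun b => 1 + var a b / 4) B).
    + rewrite <- HET, <- E_scal by exact HcT. apply E_le; [exact HcS|conti|].
      intros x. destruct (HV x) as [-> _]. rewrite <- Hexp, <- rprod_exp.
      apply rprod_le. intros b _. split; [left; apply exp_pos|apply Hpt].
    + apply Rle_trans with (exp (zeta * V) * exp (V / 4));
        [|rewrite <- exp_plus; apply exp_le; unfold zeta; lra]. apply Rmult_le_compat_l; [left; apply exp_pos|].
      replace (V / 4) with (rsum (fun b => / 4 * var a b) B) by (rewrite rsum_scal, <- HVB; field).
      rewrite <- rprod_exp. apply rprod_le. intros b _. generalize (var_nonneg a b). intros Hv.
      split; [lra|]. eapply Rle_trans; [|apply exp_ineq1_le]. lra.
Qed.

(** If [d] is the current error, [g] the new factor and [f] its distance from [exp (i t)], the new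
    error is [exp (i S) f + g d], with [|f| <= |t|^3] and [|g| <= 1 + |t|^3]. So [1 + |d|] is
    multiplied by at most [1 + |t|^3]; the added 1 makes the recursion multiplicative. *)
Lemma cprod_exp_close (y : nat -> R) B :
  1 + Cmod (cos (rsum y B) - fst (cprod (fun b => 1 - y b ^ 2 / 2) y B),
            sin (rsum y B) - snd (cprod (fun b => 1 - y b ^ 2 / 2) y B))
  <= exp (rsum (fun b => Rabs (y b) ^ 3) B).
Proof.
  induction B as [|B IH].
  - simpl. rewrite cos_0, sin_0, exp_0. replace (1 - 1, 0 - 0) with (RtoC 0) by (unfold RtoC; f_equal; ring).
    rewrite Cmod_0. lra.
  - simpl rsum. simpl cprod. set (A := fun b => 1 - y b ^ 2 / 2) in *.
    change (cprod (fun b => 1 - y b * (y b * 1) / 2) y B) with (cprod A y B).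
    destruct (cprod A y B) as [u v] eqn:Huv. cbn [fst snd] in *.
    set (S := rsum y B) in *. set (t := y B) in *.
    set (d := (cos S - u, sin S - v) : C) in *.
    set (e := (cos S, sin S) : C). set (f := (cos t - A B, sin t - t) : C).
    set (g := (A B, t) : C).
    assert (Hd : (cos (S + t) - (u * A B - v * t), sin (S + t) - (u * t + v * A B)) = Cplus (Cmult e f) (Cmult g d)).
    { unfold Cplus, Cmult, e, f, g, d. simpl. rewrite cos_plus, sin_plus. f_equal; ring. }
    match goal with |- 1 + Cmod ?z <= ?r => change (1 + Cmod (cos (S + t) - (u * A B - v * t), sin (S + t) - (u * t + v * A B)) <= r) end.
    rewrite Hd.
    assert (He : forall w, Cmod (cos w, sin w) = 1).
    { intros w. unfold Cmod. simpl fst. simpl snd.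
      replace (cos w ^ 2 + sin w ^ 2) with 1 by (generalize (sin2_cos2 w); unfold Rsqr; lra). apply sqrt_1. }
    assert (Hf : Cmod f <= Rabs t ^ 3).
    { assert (Hf' : f = Cplus (RtoC (cos t - A B)) (Cmult Ci (RtoC (sin t - t)))).
      { unfold Cplus, Cmult, Ci, RtoC, f. simpl. f_equal; ring. }
      rewrite Hf'. eapply Rle_trans; [apply Cmod_triangle|]. rewrite Cmod_mult, !Cmod_R.
      assert (Hi : Cmod Ci = 1).
      { unfold Cmod, Ci. simpl. replace (0 * (0 * 1) + 1 * (1 * 1)) with 1 by ring. apply sqrt_1. }
      rewrite Hi. unfold A. fold t.
      generalize (cos_taylor_abs t) (sin_taylor_abs t) (pow_le (Rabs t) 3 (Rabs_pos t)). lra. }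
    assert (Hg : Cmod g <= 1 + Rabs t ^ 3).
    { replace g with (Cplus (cos t, sin t) (Copp f)).
      - eapply Rle_trans; [apply Cmod_triangle|]. rewrite He, Cmod_opp. lra.
      - unfold Cplus, Copp, f, g. simpl. f_equal; ring. }
    assert (H := Cmod_triangle (Cmult e f) (Cmult g d)). rewrite !Cmod_mult in H. unfold e at 2 in H.
    rewrite He in H. rewrite exp_plus.
    assert (H0 := Cmod_ge_0 d). assert (H1 := exp_ineq1_le (Rabs t ^ 3)).
    assert (H2 := pow_le (Rabs t) 3 (Rabs_pos t)).
    set (X := exp (rsum (fun b => Rabs (y b) ^ 3) B)) in *. set (r := Rabs t ^ 3) in *.
    apply Rle_trans with ((1 + Cmod d) * (1 + r)); [nra|].
    apply Rmult_le_compat; [lra|lra|exact IH|exact H1].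
Qed.

End Blocks.

(** * Choosing the gaps and removing them *)

Lemma gap_choice s m a K : (0 < m)%nat ->
  exists o, (o < m)%nat /\ INR m * rsum (fun k => unmask s m o a k ^ 2) K <= rsum (fun k => a k ^ 2) K.
Proof.
  intros Hm. destruct (rsum_min (fun o => rsum (fun k => unmask s m o a k ^ 2) K) m Hm) as (o & Ho & H).
  exists o. split; [exact Ho|]. eapply Rle_trans; [exact H|].
  rewrite (rsum_exchange (fun o k => unmask s m o a k ^ 2)). right. apply rsum_ext. intros k _.
  rewrite <- (rsum_select ((k / s) mod m) m (a k ^ 2)) by (apply Nat.mod_upper_bound; lia).
  apply rsum_ext. intros i _. unfold unmask, in_gap. destruct Nat.eqb; [reflexivity|ring].
Qed.

Lemma mask_block s m o a K x :
  block a 0 K x = block (mask s m o a) 0 K x + block (unmask s m o a) 0 K x.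
Proof.
  unfold block. rewrite <- rsum_plus. apply rsum_ext. intros. unfold mask, unmask. destruct in_gap; ring.
Qed.

Lemma mask_sqr s m o a K : rsum (fun k => a k ^ 2) K =
  rsum (fun k => mask s m o a k ^ 2) K + rsum (fun k => unmask s m o a k ^ 2) K.
Proof.
  rewrite <- rsum_plus. apply rsum_ext. intros. unfold mask, unmask. destruct in_gap; ring.
Qed.

Lemma block_scal c a a' K x : (forall k, a' k = c * a k) -> block a' 0 K x = c * block a 0 K x.
Proof.
  intros H. unfold block. rewrite <- rsum_scal. apply rsum_ext. intros. rewrite H. ring.
Qed.

Lemma sqr_scal c a a' K : (forall k, a' k = c * a k) ->
  rsum (fun k => a' k ^ 2) K = c ^ 2 * rsum (fun k => a k ^ 2) K.
Proof. intros H. rewrite <- rsum_scal. apply rsum_ext. intros. rewrite H. ring. Qed.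

Lemma mgf_mask_scal s m o a K alpha c :
  (0 < s)%nat -> (o < m)%nat -> 4 / (1 - / q) < q ^ s ->
  (forall k, (K <= k)%nat -> a k = 0) -> (forall k, Rabs (a k) <= alpha) ->
  0 <= c -> INR (m * s) * (c * alpha) <= 1/2 ->
  let V := rsum (fun k => mask s m o a k ^ 2) K in
  exp (c^2 * V / 4 - 3 * INR (m * s) ^ 2 * (c * alpha) * (c^2 * V))
    <= E (fun x => exp (c * block (mask s m o a) 0 K x))
    <= exp (c^2 * V / 4 + INR (m * s) ^ 2 * (c * alpha) * (c^2 * V)).
Proof.
  intros Hs Hom Hqs Hsupp Ha Hc HP V.
  assert (Hm : forall k, mask s m o (fun k => c * a k) k = c * mask s m o a k).
  { intros k. unfold mask. destruct in_gap; ring. }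
  destruct (mgf_mask s m o Hs Hom Hqs (fun k => c * a k) K (c * alpha)) as [H1 H2].
  - intros k Hk. rewrite Hsupp by exact Hk. ring.
  - intros k. rewrite Rabs_mult, (Rabs_pos_eq c) by exact Hc. now apply Rmult_le_compat_l.
  - exact HP.
  - rewrite (sqr_scal c (mask s m o a)) in H1, H2 by exact Hm. fold V in H1, H2.
    rewrite (E_ext _ (fun x => exp (c * block (mask s m o a) 0 K x))) in H1, H2
      by (intros x; f_equal; now apply block_scal).
    split; assumption.
Qed.

Lemma good_gap : exists s, (0 < s)%nat /\ 4 / (1 - / q) < q ^ s.
Proof.
  destruct (pow_unbounded q (4 / (1 - / q) + 1) Hq) as (s & Hs & H). exists s. split; [exact Hs|lra].
Qed.

(** Convexity of [exp] with weights [t] and [1 - t] separates the main part [S0] from the gap part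
    [W]. Taking [t = 1 - eps / 8] changes the main exponent only slightly, while the amplification
    of [W] by up to [/ (1 - t)] is offset by the share [1 / m] of the gaps in [V], where [m] is
    chosen after [t]. *)
Lemma mgf_bounds eps : 0 < eps <= 1/2 -> exists alpha, 0 < alpha /\
  forall a K, (forall k, (K <= k)%nat -> a k = 0) -> (forall k, Rabs (a k) <= alpha) ->
  let V := rsum (fun k => a k ^ 2) K in
  exp ((1 - eps) * V / 4) <= E (fun x => exp (block a 0 K x)) <= exp ((1 + eps) * V / 4).
Proof.
  intros Heps. destruct good_gap as (s & Hs & Hqs). destruct subgaussian as (C & HC & Hsub).
  set (t := 1 - eps / 8). assert (Ht : 15/16 <= t < 1) by (unfold t; lra).
  (* The first entry makes the amplified gap exponent at most [V / 8], the second makes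
     [Vg <= eps / 8 * V]. *)
  destruct (INR_unbounded (Rmax (8 * C / (1 - t) ^ 2) (8 / eps))) as (m & Hm).
  assert (Hm1 : 8 * C / (1 - t) ^ 2 < INR m) by (eapply Rle_lt_trans; [apply Rmax_l|exact Hm]).
  assert (Hm2 : 8 / eps < INR m) by (eapply Rle_lt_trans; [apply Rmax_r|exact Hm]).
  assert (Ht2 : 0 < (1 - t) ^ 2) by (apply pow_lt; lra).
  assert (Hm0 : 0 < INR m).
  { eapply Rlt_trans; [|exact Hm2]. apply Rdiv_lt_0_compat; lra. }
  assert (HmN : (0 < m)%nat) by (apply INR_lt; exact Hm0).
  set (P := INR (m * s)).
  assert (HP : 1 <= P) by (apply (le_INR 1); nia).
  (* The relative error [P ^ 2 * alpha] of the block comparison then equals [eps / 64]. *)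
  exists (eps / (64 * P ^ 2)). split; [apply Rdiv_lt_0_compat; nra|].
  set (alpha := eps / (64 * P ^ 2)).
  assert (HPa : P ^ 2 * alpha = eps / 64) by (unfold alpha; field; nra).
  assert (HPa1 : P * alpha <= eps / 64) by (rewrite <- HPa; nra).
  intros a K Hsupp Ha V.
  destruct (gap_choice s m a K HmN) as (o & Ho & HVg).
  set (Vg := rsum (fun k => unmask s m o a k ^ 2) K) in *.
  set (Vm := rsum (fun k => mask s m o a k ^ 2) K).
  assert (HV : V = Vm + Vg) by apply mask_sqr. fold V in HVg.
  assert (HVg0 : 0 <= Vg) by (apply rsum_nonneg; intros; apply pow2_ge_0).
  assert (HVm0 : 0 <= Vm) by (apply rsum_nonneg; intros; apply pow2_ge_0).
  set (S0 := block (mask s m o a) 0 K). set (W := block (unmask s m o a) 0 K).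
  assert (HS : forall x, block a 0 K x = S0 x + W x) by (intros; apply mask_block).
  assert (cS0 : cont S0) by apply cont_block. assert (cW : cont W) by apply cont_block.
  assert (cS : cont (block a 0 K)) by apply cont_block.
  assert (HW : forall c, E (fun x => exp (c * W x)) <= exp (C * (c ^ 2 * Vg))).
  { intros c. rewrite (E_ext _ (fun x => exp (block (fun k => c * unmask s m o a k) 0 K x)))
      by (intros x; f_equal; symmetry; now apply block_scal).
    eapply Rle_trans; [apply Hsub|].
    - intros k Hk. unfold unmask. rewrite Hsupp by exact Hk. destruct in_gap; ring.
    - rewrite (sqr_scal c (unmask s m o a)) by reflexivity. right. reflexivity. }
  assert (HCV : C * Vg / (1 - t) ^ 2 <= V / 8).
  { apply Rmult_le_reg_l with (INR m); [exact Hm0|].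
    apply Rle_trans with (C * V / (1 - t) ^ 2).
    - replace (INR m * (C * Vg / (1 - t) ^ 2)) with ((C / (1 - t) ^ 2) * (INR m * Vg)) by (field; lra).
      replace (C * V / (1 - t) ^ 2) with ((C / (1 - t) ^ 2) * V) by (field; lra).
      apply Rmult_le_compat_l; [apply Rdiv_le_0_compat; lra|exact HVg].
    - replace (C * V / (1 - t) ^ 2) with (8 * C / (1 - t) ^ 2 * (V / 8)) by (field; lra).
      apply Rmult_le_compat_r; [lra|lra]. }
  assert (HVg2 : Vg <= eps / 8 * V).
  { apply Rmult_le_reg_l with (INR m); [exact Hm0|].
    apply Rle_trans with V; [exact HVg|].
    apply Rle_trans with (8 / eps * (eps / 8 * V)); [right; field; lra|].
    apply Rmult_le_compat_r; nra. }
  split.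
  - destruct (mgf_mask_scal s m o a K alpha t Hs Ho Hqs Hsupp Ha) as [H _]; [lra|fold P; nra|].
    fold P S0 Vm in H.
    set (L := exp ((1 - eps) * V / 4)).
    assert (HL : L <= E (fun x => exp (t * S0 x))).
    { eapply Rle_trans; [|exact H]. apply exp_le.
      replace (3 * P ^ 2 * (t * alpha) * (t ^ 2 * Vm)) with (3 * (P ^ 2 * alpha) * t * (t ^ 2 * Vm)) by ring.
      rewrite HPa. set (u := t ^ 2 * Vm).
      assert (Hu : (1 - eps / 4) * ((1 - eps / 8) * V) <= u).
      { unfold u. apply Rmult_le_compat; [lra|nra|unfold t; nra|lra]. }
      assert (Hu2 : (1 - 3/8 * eps) * V <= u) by nra.
      assert (Hu0 : 0 <= u) by nra.
      assert (3 * (eps / 64) * t * u <= 3 * (eps / 64) * u).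
      { apply Rmult_le_compat_r; [lra|]. nra. }
      assert ((1 - eps) / 4 * V <= (1/4 - 3/64 * eps) * (1 - 3/8 * eps) * V).
      { apply Rmult_le_compat_r; [lra|]. nra. }
      assert ((1/4 - 3/64 * eps) * ((1 - 3/8 * eps) * V) <= (1/4 - 3/64 * eps) * u).
      { apply Rmult_le_compat_l; lra. }
      lra. }
    assert (HW1 : E (fun x => exp (- (t / (1 - t)) * W x)) <= L).
    { eapply Rle_trans; [apply HW|]. apply exp_le.
      replace (C * ((- (t / (1 - t))) ^ 2 * Vg)) with (t ^ 2 * (C * Vg / (1 - t) ^ 2)) by (field; lra).
      assert (t ^ 2 <= 1) by nra. nra. }
    (* Here [t S0 = t S + (1 - t) (- t / (1 - t) W)]. As [L] is below the left mean and above the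
       mean over the gaps, [L <= t E(exp S) + (1 - t) L], and [L] cancels. *)
    assert (Hconv : E (fun x => exp (t * S0 x)) <=
      t * E (fun x => exp (block a 0 K x)) + (1 - t) * E (fun x => exp (- (t / (1 - t)) * W x))).
    { rewrite <- !E_scal by conti. rewrite <- E_plus by conti. apply E_le; [conti|conti|].
      intros x. eapply Rle_trans; [|apply exp_convex; lra]. right. f_equal.
      rewrite HS. field. lra. }
    apply Rmult_le_reg_l with t; [lra|]. nra.
  - set (R1 := exp ((1 + eps) * V / 4)).
    assert (Hc : 0 <= / t <= 1 + eps / 7).
    { split; [left; apply Rinv_0_lt_compat; lra|]. apply Rmult_le_reg_l with t; [lra|].
      rewrite Rinv_r by lra. unfold t. nra. }
    destruct (mgf_mask_scal s m o a K alpha (/ t) Hs Ho Hqs Hsupp Ha) as [_ H];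
      [lra|fold P; nra|].
    fold P S0 Vm in H.
    assert (H1 : E (fun x => exp (/ t * S0 x)) <= R1).
    { eapply Rle_trans; [exact H|]. apply exp_le.
      replace (P ^ 2 * (/ t * alpha) * ((/ t) ^ 2 * Vm)) with ((P ^ 2 * alpha) * / t * ((/ t) ^ 2 * Vm)) by ring.
      rewrite HPa.
      assert (Hc2 : (/ t) ^ 2 <= 1 + 3/7 * eps) by nra.
      assert (Hu : (/ t) ^ 2 * Vm <= (1 + 3/7 * eps) * V).
      { apply Rmult_le_compat; [apply pow2_ge_0|lra|exact Hc2|lra]. }
      set (u := (/ t) ^ 2 * Vm) in *.
      assert (Hu0 : 0 <= u) by (apply Rmult_le_pos; [apply pow2_ge_0|lra]).
      assert (eps / 64 * / t * u <= eps / 32 * u) by (apply Rmult_le_compat_r; nra).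
      nra. }
    assert (HW1 : E (fun x => exp (/ (1 - t) * W x)) <= R1).
    { eapply Rle_trans; [apply HW|]. apply exp_le.
      replace (C * ((/ (1 - t)) ^ 2 * Vg)) with (C * Vg / (1 - t) ^ 2) by (field; lra). nra. }
    (* Now [S = t (S0 / t) + (1 - t) (W / (1 - t))], and both means are at most [R1]. *)
    apply Rle_trans with (t * E (fun x => exp (/ t * S0 x)) + (1 - t) * E (fun x => exp (/ (1 - t) * W x))).
    { rewrite <- !E_scal by conti. rewrite <- E_plus by conti. apply E_le; [conti|conti|].
      intros x. eapply Rle_trans; [|apply exp_convex; lra]. right. f_equal.
      rewrite HS. field. lra. }
    nra.
Qed.

(** Replacing [exp (i S)] by the product costs [exp z - 1 <= 2 z], replacing the mean of the product
    by [exp (- V / 4)] one more [z]. For [z > 1] the bounds on cosine and sine suffice. *)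
Lemma charfun_mask s m o a K alpha :
  (0 < s)%nat -> (o < m)%nat -> 4 / (1 - / q) < q ^ s ->
  (forall k, (K <= k)%nat -> a k = 0) -> (forall k, Rabs (a k) <= alpha) -> INR (m * s) * alpha <= 1/2 ->
  let V := rsum (fun k => mask s m o a k ^ 2) K in
  let z := INR (m * s) ^ 2 * alpha * V in
  Rabs (E (fun x => cos (block (mask s m o a) 0 K x)) - exp (- (V / 4))) <= 3 * z /\
  Rabs (E (fun x => sin (block (mask s m o a) 0 K x))) <= 3 * z.
Proof.
  intros Hs Hom Hqs Hsupp Ha HPa V z.
  assert (Ha0 : 0 <= alpha) by (eapply Rle_trans; [apply Rabs_pos|apply (Ha 0%nat)]).
  assert (HP1 : 1 <= INR (m * s)) by (apply (le_INR 1); nia).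
  set (B := S K).
  assert (HB : (K <= ell s m o B)%nat) by (apply ell_ge; assumption).
  assert (HV0 : 0 <= V) by (apply rsum_nonneg; intros; apply pow2_ge_0).
  assert (Hz : 0 <= z).
  { unfold z. apply Rmult_le_pos; [apply Rmult_le_pos; [apply pow2_ge_0|lra]|exact HV0]. }
  set (S0 := block (mask s m o a) 0 K). assert (cS0 : cont S0) by apply cont_block.
  set (A := fun (b : nat) x => 1 - bl s m o a b x ^ 2 / 2).
  set (u := fun x => fst (cprod (fun b => A b x) (fun b => bl s m o a b x) B)).
  set (v := fun x => snd (cprod (fun b => A b x) (fun b => bl s m o a b x) B)).
  assert (Hext : forall x, cprod (fun b => 1 + 0 * bl s m o a b x + -1 * (bl s m o a b x ^ 2 / 2))
      (fun b => 1 * bl s m o a b x) B = cprod (fun b => A b x) (fun b => bl s m o a b x) B).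
  { intros x. apply cprod_ext; intros; unfold A; ring. }
  destruct (blocks_mean s m o Hs Hom Hqs a 0 (-1) 1 B) as [Hu Hv].
  rewrite (E_ext _ u) in Hu by (intros x; rewrite Hext; reflexivity).
  rewrite (E_ext _ v) in Hv by (intros x; rewrite Hext; reflexivity).
  assert (Hcuv : forall k, cont (fun x => fst (cprod (fun b => A b x) (fun b => bl s m o a b x) k)) /\
                           cont (fun x => snd (cprod (fun b => A b x) (fun b => bl s m o a b x) k))).
  { induction k as [|k [IH1 IH2]]; simpl; [split; apply cont_const|].
    assert (cb : cont (bl s m o a k)) by apply cont_bl.
    assert (cA : cont (A k)) by (unfold A; conti).
    split; eapply cont_ext; try (intros x; destruct (cprod (fun b => A b x) (fun b => bl s m o a b x) k) eqn:Huv;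
      cbn [fst snd]; replace r with (fst (cprod (fun b => A b x) (fun b => bl s m o a b x) k)) by (now rewrite Huv);
      replace r0 with (snd (cprod (fun b => A b x) (fun b => bl s m o a b x) k)) by (now rewrite Huv); reflexivity);
      conti. }
  assert (cu : cont u) by apply Hcuv. assert (cv : cont v) by apply Hcuv.
  assert (HS : forall x, S0 x = rsum (fun b => bl s m o a b x) B /\ V = rsum (var s m o a) B)
    by (intros x; now apply block_mask_split).
  assert (HVB : V = rsum (var s m o a) B) by apply (HS 0).
  assert (Hvar : forall b, 0 <= var s m o a b) by (intros; apply var_nonneg).
  assert (Hclose : forall x, Rabs (cos (S0 x) - u x) <= exp z - 1 /\ Rabs (sin (S0 x) - v x) <= exp z - 1).
  { intros x. destruct (HS x) as [-> _].
    assert (H := cprod_exp_close (fun b => bl s m o a b x) B).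
    assert (H1 : exp (rsum (fun b => Rabs (bl s m o a b x) ^ 3) B) <= exp z).
    { apply exp_le. unfold z. rewrite HVB, <- rsum_scal. apply rsum_le. intros b _.
      apply block_bounds; assumption. }
    match type of H with 1 + Cmod ?w <= _ => assert (H2 := Rmax_Cmod w) end.
    cbn [fst snd] in H2. unfold u, v, A.
    split; (eapply Rle_trans; [|apply Rplus_le_reg_l with 1; eapply Rle_trans;
      [apply Rplus_le_compat_l, H2|eapply Rle_trans; [apply H|]; rewrite Rplus_minus; exact H1]]).
    - apply Rmax_l.
    - apply Rmax_r. }
  assert (Hdiff : forall f g, cont f -> cont g -> (forall x, Rabs (f x - g x) <= exp z - 1) ->
    Rabs (E f - E g) <= exp z - 1).
  { intros f g cf cg H. rewrite <- E_minus by assumption. eapply Rle_trans; [apply E_abs; conti|].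
    rewrite <- (E_const (exp z - 1)). apply E_le; conti. exact H. }
  assert (Hc := Hdiff (fun x => cos (S0 x)) u ltac:(conti) cu ltac:(intros; apply Hclose)).
  assert (Hsn := Hdiff (fun x => sin (S0 x)) v ltac:(conti) cv ltac:(intros; apply Hclose)).
  rewrite Hv, Rminus_0_r in Hsn. rewrite Hu in Hc.
  set (tau := fun b => 1 + -1 * (var s m o a b / 4)) in *.
  assert (Htau : exp (- (V / 4) - z) <= rprod tau B <= exp (- (V / 4))).
  { assert (Hb : forall b, 0 <= var s m o a b / 4 <= 1/2 /\ (var s m o a b / 4)^2 <= INR (m * s) ^ 2 * alpha * var s m o a b).
    { intros b. destruct (block_bounds s m o Hs Hom a alpha b 0 Ha) as (_ & _ & H).
      specialize (Hvar b). set (w := var s m o a b) in *. set (P := INR (m * s)) in *.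
      assert (H1 : P * alpha ^ 2 <= P ^ 2 * alpha) by nra.
      assert (H2 : P * alpha ^ 2 <= 1/2) by nra.
      split; [lra|]. nra. }
    replace (- (V / 4) - z) with (rsum (fun b => (- / 4 - INR (m * s) ^ 2 * alpha) * var s m o a b) B)
      by (rewrite rsum_scal, <- HVB; unfold z; field).
    replace (- (V / 4)) with (rsum (fun b => - / 4 * var s m o a b) B) by (rewrite rsum_scal, <- HVB; field).
    rewrite <- !rprod_exp. split; apply rprod_le; intros b _; destruct (Hb b) as [H1 H2];
      destruct (exp_1minus _ H1) as [H3 H4]; unfold tau.
    - split; [left; apply exp_pos|]. eapply Rle_trans; [|eapply Rle_trans; [exact H3|lra]].
      apply exp_le. lra.
    - split; [lra|]. eapply Rle_trans; [|eapply Rle_trans; [exact H4|]]; [lra|]. apply exp_le. lra. }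
  assert (He : exp (- (V / 4)) - exp (- (V / 4) - z) <= z).
  { assert (H := exp_opp_lip (V / 4) (V / 4 + z) ltac:(lra) ltac:(lra)).
    replace (- (V / 4 + z)) with (- (V / 4) - z) in H by ring.
    replace (V / 4 - (V / 4 + z)) with (- z) in H by ring. rewrite Rabs_Ropp, (Rabs_pos_eq z) in H by exact Hz.
    generalize (Rle_abs (exp (- (V / 4)) - exp (- (V / 4) - z))). lra. }
  assert (He1 : exp (- (V / 4)) <= 1) by (rewrite <- exp_0; apply exp_le; lra).
  assert (He0 : 0 < exp (- (V / 4))) by apply exp_pos.
  assert (Hbc := E_between (fun x => cos (S0 x)) (-1) 1 ltac:(conti) ltac:(intros; apply COS_bound)).
  assert (Hbs := E_between (fun x => sin (S0 x)) (-1) 1 ltac:(conti) ltac:(intros; apply SIN_bound)).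
  destruct (Rle_dec z 1) as [Hz1|Hz1].
  - assert (Hez : exp z <= 1 + 2 * z).
    { generalize (exp_le_cubic z (conj Hz Hz1)). nra. }
    apply Rabs_le_between in Hc. apply Rabs_le_between in Hsn.
    split; apply Rabs_le; lra.
  - split; apply Rabs_le; lra.
Qed.

(** Dropping the gaps changes cosine and sine by at most [|W|], whose mean is controlled by its
    exact second moment. The exponent 8 leaves room for blocks of length [nu^2 s]. *)
Lemma charfun_bounds : exists C, 0 < C /\ forall (nu : nat) a K, (0 < nu)%nat ->
  (forall k, (K <= k)%nat -> a k = 0) -> (forall k, Rabs (a k) <= / INR nu ^ 8) ->
  let V := rsum (fun k => a k ^ 2) K in
  Rabs (E (fun x => cos (block a 0 K x)) - exp (- (V / 4))) <= C * (1 + V) / INR nu /\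
  Rabs (E (fun x => sin (block a 0 K x))) <= C * (1 + V) / INR nu.
Proof.
  destruct good_gap as (s & Hs & Hqs).
  assert (Hs1 : 1 <= INR s) by (apply (le_INR 1); lia).
  exists (3 * INR s ^ 2 + 4 * INR s + 2). split; [nra|].
  intros nu a K Hnu Hsupp Ha V. set (C := 3 * INR s ^ 2 + 4 * INR s + 2).
  assert (HN : 1 <= INR nu) by (apply (le_INR 1); lia). set (N := INR nu) in *.
  assert (HV0 : 0 <= V) by (apply rsum_nonneg; intros; apply pow2_ge_0).
  assert (cS : cont (block a 0 K)) by apply cont_block.
  assert (HiN : 0 < / N) by (apply Rinv_0_lt_compat; lra).
  (* For [N < 2 s] the right side is at least 2, a trivial bound. Otherwise block length times
     coefficient bound is at most [s / N <= 1/2], as the block estimate requires. *)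
  destruct (Rlt_dec N (2 * INR s)) as [Hsmall|Hlarge].
  - assert (H2 : 2 <= C * (1 + V) / N).
    { apply Rmult_le_reg_r with N; [lra|]. unfold Rdiv. rewrite Rmult_assoc, Rinv_l by lra.
      assert (C <= C * (1 + V)) by (unfold C; nra). assert (4 * INR s <= C) by (unfold C; nra). lra. }
    assert (He1 : exp (- (V / 4)) <= 1) by (rewrite <- exp_0; apply exp_le; lra).
    assert (He0 : 0 < exp (- (V / 4))) by apply exp_pos.
    assert (Hbc := E_between (fun x => cos (block a 0 K x)) (-1) 1 ltac:(conti) ltac:(intros; apply COS_bound)).
    assert (Hbs := E_between (fun x => sin (block a 0 K x)) (-1) 1 ltac:(conti) ltac:(intros; apply SIN_bound)).
    split; apply Rabs_le; lra.
  (* With [nu^2] positions the gaps carry at most [V / nu^2], and the block error [(m s)^2 / nu^8]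
     is of order [nu^-4]. *)
  - set (m := (nu * nu)%nat). assert (Hm : (0 < m)%nat) by (unfold m; nia).
    destruct (gap_choice s m a K Hm) as (o & Ho & HVg). fold V in HVg.
    assert (HmN : INR m = N ^ 2) by (unfold m; rewrite mult_INR; fold N; ring). rewrite HmN in HVg.
    assert (HPN : INR (m * s) = N ^ 2 * INR s) by (rewrite mult_INR, HmN; reflexivity).
    set (Vg := rsum (fun k => unmask s m o a k ^ 2) K) in *.
    assert (HV : V = rsum (fun k => mask s m o a k ^ 2) K + Vg) by apply mask_sqr.
    assert (HVg0 : 0 <= Vg) by (apply rsum_nonneg; intros; apply pow2_ge_0).
    assert (HVm0 : 0 <= rsum (fun k => mask s m o a k ^ 2) K) by (apply rsum_nonneg; intros; apply pow2_ge_0).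
    assert (HN4 : N <= N ^ 4) by (replace (N ^ 4) with (N * N ^ 3) by ring; generalize (pow_R1_Rle N 3 HN); nra).
    assert (HN6 : N <= N ^ 6) by (replace (N ^ 6) with (N * N ^ 5) by ring; generalize (pow_R1_Rle N 5 HN); nra).
    destruct (charfun_mask s m o a K (/ N ^ 8) Hs Ho Hqs Hsupp Ha) as [Hc Hsn].
    { rewrite HPN. replace (N ^ 2 * INR s * / N ^ 8) with (INR s * / N ^ 6) by (field; lra).
      apply Rle_trans with (INR s * / N).
      - apply Rmult_le_compat_l; [lra|]. apply Rinv_le_contravar; lra.
      - apply Rmult_le_reg_r with N; [lra|]. rewrite Rmult_assoc, Rinv_l by lra. lra. }
    set (Vm := rsum (fun k => mask s m o a k ^ 2) K) in *.
    assert (Hz : INR (m * s) ^ 2 * / N ^ 8 * Vm <= INR s ^ 2 * V / N).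
    { rewrite HPN. replace ((N ^ 2 * INR s) ^ 2 * / N ^ 8 * Vm) with (INR s ^ 2 * Vm * / N ^ 4) by (field; lra).
      unfold Rdiv. apply Rmult_le_compat; [|left; apply Rinv_0_lt_compat; apply pow_lt; lra| |].
      - apply Rmult_le_pos; [apply pow2_ge_0|lra].
      - apply Rmult_le_compat_l; [apply pow2_ge_0|lra].
      - apply Rinv_le_contravar; lra. }
    set (S0 := block (mask s m o a) 0 K) in *. set (W := block (unmask s m o a) 0 K).
    assert (HS : forall x, block a 0 K x = S0 x + W x) by (intros; apply mask_block).
    assert (cS0 : cont S0) by apply cont_block. assert (cW : cont W) by apply cont_block.
    assert (HW2 : E (fun x => W x ^ 2) = Vg / 2) by apply block_sqr_mean.
    assert (HVgN : N * Vg <= V / N).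
    { apply Rmult_le_reg_r with N; [lra|]. unfold Rdiv. rewrite (Rmult_assoc V), Rinv_l by lra. lra. }
    assert (HVgN' : Vg <= V / N) by nra.
    assert (HEW : E (fun x => (N * W x ^ 2 + / N) / 2) <= (1 + V) / N / 2).
    { rewrite (E_ext _ (fun x => (N / 2) * W x ^ 2 + / N / 2)) by (intros; field; lra).
      rewrite E_plus by conti. rewrite E_scal, E_const, HW2 by conti.
      unfold Rdiv in *. rewrite Rmult_plus_distr_r. assert (0 <= V * / N) by (apply Rmult_le_pos; lra). lra. }
    (* Arithmetic-geometric mean in place of Cauchy-Schwarz for the mean of [|W|]; the weight [N]
       balances [N Vg <= V / N] against [/ N]. *)
    assert (Hamgm : forall x, Rabs (W x) <= (N * W x ^ 2 + / N) / 2).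
    { intros x. rewrite <- pow2_abs. set (w := Rabs (W x)).
      assert (0 <= N * (w - / N) ^ 2) by (apply Rmult_le_pos; [lra|apply pow2_ge_0]).
      assert (N * (w - / N) ^ 2 = N * w ^ 2 - 2 * w + / N) by (field; lra). lra. }
    assert (Hdiff : forall f, cont f -> (forall y z, Rabs (f y - f z) <= Rabs (y - z)) ->
      Rabs (E (fun x => f (block a 0 K x)) - E (fun x => f (S0 x))) <= (1 + V) / N / 2).
    { intros f cf Hf.
      assert (c1 : cont (fun x => f (block a 0 K x))) by (apply cont_comp; assumption).
      assert (c2 : cont (fun x => f (S0 x))) by (apply cont_comp; assumption).
      rewrite <- E_minus by assumption. eapply Rle_trans; [apply E_abs; conti|].
      eapply Rle_trans; [|exact HEW]. apply E_le; [conti|conti|].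
      intros x. eapply Rle_trans; [apply Hf|]. rewrite HS. replace (S0 x + W x - S0 x) with (W x) by ring.
      apply Hamgm. }
    assert (H1 := Hdiff cos cont_cos cos_lip). assert (H2 := Hdiff sin cont_sin sin_lip).
    assert (H3 := exp_opp_lip (Vm / 4) (V / 4) ltac:(lra) ltac:(lra)).
    rewrite (Rabs_minus_sym (Vm / 4)) in H3.
    rewrite (Rabs_pos_eq (V / 4 - Vm / 4)) in H3 by lra.
    assert (HsV : INR s ^ 2 * V / N = INR s ^ 2 * (V / N)) by (unfold Rdiv; ring).
    assert (HVN : (1 + V) / N = / N + V / N) by (unfold Rdiv; ring).
    assert (HC : C * (1 + V) / N = C * (/ N + V / N)) by (rewrite <- HVN; unfold Rdiv; ring).
    rewrite HC. rewrite HVN in H1, H2. rewrite HsV in Hz.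
    assert (HC2 : (3 * INR s ^ 2 + 2) * (/ N + V / N) <= C * (/ N + V / N)).
    { apply Rmult_le_compat_r; [lra|]. unfold C. lra. }
    assert (0 <= INR s ^ 2 * / N) by (apply Rmult_le_pos; [apply pow2_ge_0|lra]).
    apply Rabs_le_between in H1, H2, H3, Hc, Hsn.
    split; apply Rabs_le; lra.
Qed.

End Lacunary.

(** * Coverings by intervals *)

Definition covered (P : R -> Prop) (delta : R) : Prop :=
  exists a b : nat -> R,
    (forall i, a i <= b i) /\ (forall x, P x -> exists i, a i < x < b i) /\
    (forall m, rsum (fun i => b i - a i) m <= delta).

Lemma rsum_sum_f_R0 f m : sum_f_R0 f m = rsum f (S m).
Proof. induction m as [|m IH]; [simpl; lra|]. rewrite tech5, IH. reflexivity. Qed.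

Lemma null_covered P : lebesgue_null P <-> forall eps, 0 < eps -> covered P eps.
Proof.
  split; intros H eps Heps.
  - destruct (H eps Heps) as (a & b & H1 & H2 & H3). exists a, b. repeat split; auto.
    intros [|m]; [simpl; lra|]. rewrite <- rsum_sum_f_R0. apply H3.
  - destruct (H eps Heps) as (a & b & H1 & H2 & H3). exists a, b. repeat split; auto.
    intros m. rewrite rsum_sum_f_R0. apply H3.
Qed.

Lemma covered_mono (P Q : R -> Prop) d : (forall x, P x -> Q x) -> covered Q d -> covered P d.
Proof. intros H (a & b & H1 & H2 & H3). exists a, b. repeat split; auto. Qed.

Lemma rsum_select_le c m y : 0 <= y -> rsum (fun i => if Nat.eqb c i then y else 0) m <= y.
Proof.
  intros Hy. destruct (Nat.lt_ge_cases c m) as [H|H].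
  - rewrite rsum_select by exact H. lra.
  - rewrite rsum_zero; [lra|]. intros i Hi.
    replace (Nat.eqb c i) with false by (symmetry; apply Nat.eqb_neq; lia). reflexivity.
Qed.

(** The pairing dominates its arguments, so every code below [m] belongs to a pair in the [m] by [m]
    square. *)
Lemma rsum_pairing (L : nat -> nat -> R) m : (forall j k, 0 <= L j k) ->
  rsum (fun i => let (j, k) := of_nat i in L j k) m <= rsum (fun j => rsum (L j) m) m.
Proof.
  intros HL.
  set (sel := fun i j k => if Nat.eqb (to_nat (j, k)) i then L j k else 0).
  assert (Hsel : forall i j k, 0 <= sel i j k).
  { intros. unfold sel. destruct Nat.eqb; [apply HL|lra]. }
  apply Rle_trans with (rsum (fun i => rsum (fun j => rsum (fun k => sel i j k) m) m) m).
  - apply rsum_le. intros i Hi. destruct (of_nat i) as [j k] eqn:Hjk.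
    assert (Hi' : to_nat (j, k) = i) by (rewrite <- Hjk; apply cancel_to_of).
    assert (Hle := to_nat_non_decreasing j k). rewrite Hi' in Hle.
    apply Rle_trans with (rsum (fun k => sel i j k) m).
    + apply Rle_trans with (sel i j k).
      * unfold sel. rewrite Hi', Nat.eqb_refl. lra.
      * apply (rsum_term (fun k => sel i j k)); [auto|lia].
    + apply (rsum_term (fun j => rsum (fun k => sel i j k) m)); [|lia].
      intros. apply rsum_nonneg. auto.
  - rewrite (rsum_exchange (fun i j => rsum (fun k => sel i j k) m)).
    apply rsum_le. intros j _.
    rewrite (rsum_exchange (fun i k => sel i j k)). apply rsum_le. intros k _.
    apply rsum_select_le, HL.
Qed.

Lemma covered_union (P : nat -> R -> Prop) (d : nat -> R) D :
  (forall j, covered (P j) (d j)) -> (forall J, rsum d J <= D) ->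
  covered (fun x => exists j, P j x) D.
Proof.
  intros H HD.
  set (A := fun j => proj1_sig (constructive_indefinite_description _ (H j))).
  assert (HA : forall j, exists b, (forall i, A j i <= b i) /\ (forall x, P j x -> exists i, A j i < x < b i) /\
    (forall m, rsum (fun i => b i - A j i) m <= d j)).
  { intros j. unfold A. destruct (constructive_indefinite_description _ (H j)) as (a & Ha). exact Ha. }
  clearbody A.
  set (B := fun j => proj1_sig (constructive_indefinite_description _ (HA j))).
  assert (HB : forall j, (forall i, A j i <= B j i) /\ (forall x, P j x -> exists i, A j i < x < B j i) /\
    (forall m, rsum (fun i => B j i - A j i) m <= d j)).
  { intros j. unfold B. destruct (constructive_indefinite_description _ (HA j)) as (b & Hb). exact Hb. }
  clearbody B.
  exists (fun i => let (j, k) := of_nat i in A j k), (fun i => let (j, k) := of_nat i in B j k).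
  split; [|split].
  - intros i. destruct (of_nat i) as [j k]. apply HB.
  - intros x (j & Hj). destruct (HB j) as (_ & H2 & _). destruct (H2 x Hj) as (k & Hk).
    exists (to_nat (j, k)). rewrite cancel_of_to. exact Hk.
  - intros m. eapply Rle_trans; [|apply (HD m)].
    eapply Rle_trans; [|apply rsum_le; intros j _; apply (proj2 (proj2 (HB j)) m)].
    eapply Rle_trans; [|apply rsum_pairing].
    + right. apply rsum_ext. intros i _. destruct (of_nat i); reflexivity.
    + intros j k. destruct (HB j) as (H1 & _). generalize (H1 k). lra.
Qed.

Lemma null_mono (P Q : R -> Prop) : (forall x, P x -> Q x) -> lebesgue_null Q -> lebesgue_null P.
Proof.
  rewrite !null_covered. intros H HQ eps Heps. apply covered_mono with Q; auto.
Qed.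

Lemma rsum_geom c J : 0 <= c -> rsum (fun j => c * (/ 2) ^ (S j)) J <= c.
Proof.
  intros Hc. assert (H : rsum (fun j => c * (/ 2) ^ (S j)) J = c * (1 - (/ 2) ^ J)).
  { induction J as [|J IH]; [simpl; lra|]. cbn [rsum]. rewrite IH. simpl. field. }
  rewrite H. assert (0 <= (/ 2) ^ J) by (apply pow_le; lra). nra.
Qed.

Lemma null_union (P : nat -> R -> Prop) :
  (forall j, lebesgue_null (P j)) -> lebesgue_null (fun x => exists j, P j x).
Proof.
  intros H. apply null_covered. intros eps Heps.
  apply covered_union with (fun j => eps * (/ 2) ^ (S j)).
  - intros j. apply (proj1 (null_covered _) (H j)). apply Rmult_lt_0_compat; [exact Heps|].
    apply pow_lt. lra.
  - intros J. apply rsum_geom. lra.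
Qed.

Lemma RInt_const_R (a b c : R) : RInt (fun _ => c) a b = (b - a) * c.
Proof. rewrite RInt_const. reflexivity. Qed.

Lemma RInt_cells f M k : cont f -> 0 < M ->
  rsum (fun i => RInt f (INR i / M) (INR (S i) / M)) k = RInt f 0 (INR k / M).
Proof.
  intros Hf HM. induction k as [|k IH].
  - simpl. unfold Rdiv. rewrite Rmult_0_l, RInt_point. reflexivity.
  - cbn [rsum]. rewrite IH. apply (RInt_Chasles f); now apply cont_ex_RInt.
Qed.

Lemma uniform_continuity F eta : cont F -> 0 < eta ->
  exists d, 0 < d /\ forall x y, 0 <= x <= 1 -> 0 <= y <= 1 -> Rabs (x - y) < d -> Rabs (F x - F y) < eta.
Proof.
  intros HF Heta.
  destruct (Heine F (fun x => 0 <= x <= 1) (compact_P3 0 1)) with (eps := mkposreal eta Heta) as (d & Hd).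
  - intros x _. apply continuity_pt_filterlim, HF.
  - exists d. split; [apply cond_pos|]. exact Hd.
Qed.

(** Cut [[0, 1]] into cells on which [F] varies by less than [eta]. A cell meeting the set has
    [F >= 1 - eta] throughout, so such cells have total length at most [E F / (1 - eta)]; the slack
    up to [delta] pays for widening them into open intervals. *)
Lemma markov F delta : cont F -> (forall x, 0 <= F x) -> E F < delta ->
  covered (fun x => 0 <= x <= 1 /\ 1 <= F x) delta.
Proof.
  intros HF Hpos HE. assert (HE0 : 0 <= E F) by now apply E_nonneg.
  (* Half of the relative slack, so that [E F / (1 - eta)] stays below [delta]. *)
  set (eta := (1 - E F / delta) / 2).
  assert (Hr : 0 <= E F / delta < 1).
  { split; [apply Rdiv_le_0_compat; lra|]. apply Rmult_lt_reg_r with delta; [lra|].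
    unfold Rdiv. rewrite Rmult_assoc, Rinv_l; lra. }
  assert (Heta : 0 < eta < 1) by (unfold eta; lra).
  destruct (uniform_continuity F eta HF) as (d & Hd & Huc); [lra|].
  destruct (INR_unbounded (/ d)) as (M0 & HM0).
  assert (HM : 0 < INR M0) by (eapply Rlt_trans; [apply Rinv_0_lt_compat, Hd|exact HM0]).
  set (M := INR M0) in *.
  set (bad := fun i => (i < M0)%nat /\ exists x, INR i / M <= x <= INR (S i) / M /\ 1 <= F x).
  set (w := fun i => if excluded_middle_informative (bad i) then 1 else 0).
  assert (Hw : forall i, 0 <= w i <= 1) by (intros i; unfold w; destruct excluded_middle_informative; lra).
  assert (Hcell : forall i, (i < M0)%nat -> 0 <= INR i / M /\ INR (S i) / M = INR i / M + / M /\ INR (S i) / M <= 1).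
  { intros i Hi. split; [|split].
    - apply Rdiv_le_0_compat; [apply pos_INR|exact HM].
    - rewrite S_INR. field. lra.
    - apply Rmult_le_reg_r with M; [exact HM|]. unfold Rdiv. rewrite Rmult_assoc, Rinv_l by lra.
      rewrite Rmult_1_r, Rmult_1_l. apply le_INR. lia. }
  assert (HiM : 0 < / M) by now apply Rinv_0_lt_compat.
  assert (HdM : / M < d).
  { rewrite <- (Rinv_inv d). apply Rinv_lt_contravar; [|exact HM0].
    apply Rmult_lt_0_compat; [now apply Rinv_0_lt_compat|exact HM]. }
  assert (Hsum : rsum w M0 * ((1 - eta) / M) <= E F).
  { assert (HEF : E F = RInt F 0 (INR M0 / M)) by (unfold E; f_equal; unfold M; field; fold M; lra).
    rewrite HEF, <- RInt_cells by assumption. rewrite Rmult_comm, <- rsum_scal. apply rsum_le. intros i Hi.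
    destruct (Hcell i Hi) as (H0 & H1 & H2).
    assert (Hex : ex_RInt F (INR i / M) (INR (S i) / M)) by now apply cont_ex_RInt.
    unfold w. destruct excluded_middle_informative as [(_ & x & Hx & HFx)|_].
    - apply Rle_trans with (RInt (fun _ => 1 - eta) (INR i / M) (INR (S i) / M)).
      + rewrite RInt_const_R. right. rewrite H1. field. lra.
      + apply RInt_le; [lra|apply ex_RInt_const|exact Hex|]. intros y Hy.
        assert (Rabs (F x - F y) < eta).
        { apply Huc; [lra|lra|]. apply Rabs_def1; lra. }
        apply Rabs_def2 in H. lra.
    - rewrite Rmult_0_r. apply RInt_ge_0; [lra|exact Hex|]. intros; apply Hpos. }
  (* Widening up to [M] cells by [g] on both sides uses at most the remaining slack. *)
  set (g := (delta - E F / (1 - eta)) / (2 * M)).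
  assert (Hg : 0 < delta - E F / (1 - eta)).
  { assert (E F / (1 - eta) < delta); [|lra].
    apply Rmult_lt_reg_r with (1 - eta); [lra|]. unfold Rdiv at 1. rewrite Rmult_assoc, Rinv_l by lra.
    assert (E F = (E F / delta) * delta) by (field; lra). unfold eta. nra. }
  assert (Hg0 : 0 < g) by (apply Rdiv_lt_0_compat; lra).
  (* All other indices get the degenerate interval from 0 to 0, empty and of length zero. *)
  exists (fun i => if excluded_middle_informative (bad i) then INR i / M - g else 0),
         (fun i => if excluded_middle_informative (bad i) then INR (S i) / M + g else 0).
  split; [|split].
  - intros i. destruct excluded_middle_informative as [(Hi & _)|_]; [|lra].
    destruct (Hcell i Hi) as (H0 & H1 & H2). lra.
  - intros x (Hx & HFx).
    assert (Hloc : exists i, (i < M0)%nat /\ INR i / M <= x <= INR (S i) / M).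
    { assert (Hk : forall k, (k <= M0)%nat -> x <= INR k / M -> (0 < k)%nat ->
        exists i, (i < M0)%nat /\ INR i / M <= x <= INR (S i) / M).
      { induction k as [|k IH]; [lia|]. intros Hk Hxk _.
        destruct (Rle_dec (INR k / M) x) as [H|H].
        - exists k. split; [lia|]. lra.
        - apply IH; [lia|lra|]. destruct k; [|lia]. exfalso. apply H. simpl. unfold Rdiv. rewrite Rmult_0_l. lra. }
      apply (Hk M0); [lia| |].
      - unfold M. rewrite Rdiv_diag by (fold M; lra). lra.
      - apply INR_lt. exact HM. }
    destruct Hloc as (i & Hi & Hxi). exists i.
    destruct excluded_middle_informative as [_|Hn]; [lra|].
    exfalso. apply Hn. split; [exact Hi|]. exists x. split; [exact Hxi|exact HFx].
  - intros m. apply Rle_trans with (rsum (fun i => w i * (/ M) + (if Nat.ltb i M0 then 2 * g else 0)) (m + M0)).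
    + eapply Rle_trans; [|apply (rsum_mono _ m (m + M0)); [lia|]].
      * apply rsum_le. intros i _. unfold w. destruct excluded_middle_informative as [(Hi & _)|_].
        -- destruct (Hcell i Hi) as (H0 & H1 & H2).
           replace (Nat.ltb i M0) with true by (symmetry; now apply Nat.ltb_lt). lra.
        -- destruct Nat.ltb; lra.
      * intros i. generalize (Hw i). destruct Nat.ltb; nra.
    + rewrite (rsum_supp _ M0); [|lia|].
      2:{ intros i Hi0. unfold w. destruct excluded_middle_informative as [(Hi & _)|_]; [lia|].
          replace (Nat.ltb i M0) with false by (symmetry; apply Nat.ltb_ge; lia). ring. }
      rewrite (rsum_ext _ (fun i => / M * w i + 2 * g)).
      2:{ intros i Hi. replace (Nat.ltb i M0) with true by (symmetry; now apply Nat.ltb_lt). ring. }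
      rewrite rsum_plus, rsum_scal, rsum_const. fold M.
      assert (/ M * rsum w M0 <= E F / (1 - eta)).
      { apply Rmult_le_reg_r with (1 - eta); [lra|]. unfold Rdiv. rewrite (Rmult_assoc (E F)), Rinv_l by lra.
        replace (/ M * rsum w M0 * (1 - eta)) with (rsum w M0 * ((1 - eta) / M)) by (unfold Rdiv; ring). lra. }
      assert (M * (2 * g) = delta - E F / (1 - eta)) by (unfold g; field; lra). lra.
Qed.

(** Summability is encoded by a telescoping majorant with [t] tending to zero: covering all events
    from [k] on then costs at most [t k - t (k + J)] for each finite [J]. *)
Lemma borel_cantelli (F : nat -> R -> R) (t : nat -> R) i0 :
  (forall i, cont (F i)) -> (forall i x, 0 <= F i x) ->
  (forall i, (i0 <= i)%nat -> E (F i) < t i - t (S i)) ->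
  (forall eps, 0 < eps -> exists I, forall i, (I <= i)%nat -> Rabs (t i) <= eps) ->
  lebesgue_null (fun x => 0 <= x <= 1 /\ forall I, exists i, (I <= i)%nat /\ 1 <= F i x).
Proof.
  intros Hc Hp HE Ht. apply null_covered. intros eps Heps.
  destruct (Ht (eps / 2)) as (I & HI); [lra|].
  set (k := Nat.max i0 I).
  apply covered_mono with (fun x => exists j, 0 <= x <= 1 /\ 1 <= F (k + j)%nat x).
  - intros x (Hx & H). destruct (H k) as (i & Hi & HFi). exists (i - k)%nat.
    replace (k + (i - k))%nat with i by lia. split; assumption.
  - apply covered_union with (fun j => t (k + j)%nat - t (S (k + j))).
    + intros j. apply markov; auto. apply HE. lia.
    + intros J. assert (H : rsum (fun j => t (k + j)%nat - t (S (k + j))) J = t k - t (k + J)%nat).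
      { induction J as [|J IH]; simpl; [rewrite Nat.add_0_r; lra|]. rewrite IH, Nat.add_succ_r. lra. }
      rewrite H. generalize (HI k ltac:(lia)) (HI (k + J)%nat ltac:(lia)). intros H1 H2.
      apply Rabs_le_between in H1, H2. lra.
Qed.

(** A point for which [F i] is at least 1 from [J] on lies in each single event from [J] on, so one
    event of small mean covers them all; no summability is involved. *)
Lemma null_eventually (F : nat -> R -> R) :
  (forall i, cont (F i)) -> (forall i x, 0 <= F i x) ->
  (forall eps, 0 < eps -> exists I, forall i, (I <= i)%nat -> E (F i) < eps) ->
  lebesgue_null (fun x => 0 <= x <= 1 /\ exists J, forall i, (J <= i)%nat -> 1 <= F i x).
Proof.
  intros Hc Hp HE.
  apply null_mono with (fun x => exists J, 0 <= x <= 1 /\ forall i, (J <= i)%nat -> 1 <= F i x).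
  - intros x (Hx & J & HJ). exists J. split; assumption.
  - apply null_union. intros J. apply null_covered. intros eps Heps.
    destruct (HE eps Heps) as (I & HI). set (i := Nat.max I J).
    apply covered_mono with (fun x => 0 <= x <= 1 /\ 1 <= F i x).
    + intros x (Hx & H). split; [exact Hx|]. apply H. lia.
    + apply markov; auto. apply HI. lia.
Qed.

(** * Weighted sums of functions that behave like independent random variables *)

Definition wsum (d : nat -> R -> R) (w : nat -> R) (N : nat) (x : R) : R :=
  rsum (fun i => w i * d i x) N.
Definition wvar (w : nat -> R) (N : nat) : R := rsum (fun i => w i ^ 2) N.

(** The probabilistic input of the limit theorems. Because the weights are arbitrary, it applies
    alike to partial sums, to increments and to combinations of increments. *)
Record quasi_gaussian (d : nat -> R -> R) : Prop := {
  qg_cont : forall i, cont (d i);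
  qg_sqr : forall w N, E (fun x => wsum d w N x ^ 2) = wvar w N / 2;
  qg_sub : exists C, 0 < C /\ forall w N, E (fun x => exp (wsum d w N x)) <= exp (C * wvar w N);
  qg_mgf : forall eps, 0 < eps <= 1/2 -> exists alpha, 0 < alpha /\
    forall w N, (forall i, Rabs (w i) <= alpha) ->
    exp ((1 - eps) * wvar w N / 4) <= E (fun x => exp (wsum d w N x)) <= exp ((1 + eps) * wvar w N / 4);
  qg_char : exists C, 0 < C /\ forall (nu : nat) w N, (0 < nu)%nat ->
    (forall i, Rabs (w i) <= / INR nu ^ 8) ->
    Rabs (E (fun x => cos (wsum d w N x)) - exp (- (wvar w N / 4))) <= C * (1 + wvar w N) / INR nu /\
    Rabs (E (fun x => sin (wsum d w N x))) <= C * (1 + wvar w N) / INR nu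
}.

Lemma cont_wsum d w N : (forall i, cont (d i)) -> cont (wsum d w N).
Proof. intros H. unfold wsum. conti. Qed.

Lemma rsum_update (G : nat -> R -> R) a j v K : (j < K)%nat ->
  rsum (fun k => G k (if Nat.eqb j k then v else a k)) K = rsum (fun k => G k (a k)) K + G j v - G j (a j).
Proof.
  intros Hj.
  rewrite (rsum_ext _ (fun k => G k (a k) + (if Nat.eqb j k then G j v - G j (a j) else 0))).
  - rewrite rsum_plus, rsum_select by exact Hj. ring.
  - intros k _. destruct (Nat.eqb_spec j k) as [->|_]; ring.
Qed.

(* The order of summation is forgotten: only the set of summands and its weights matter. *)
Lemma reorder n s w N : (forall i j, s i = s j -> i = j) ->
  exists a K, (forall k, (K <= k)%nat -> a k = 0) /\
    (forall k, a k = 0 \/ exists i, (i < N)%nat /\ a k = w i) /\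
    (forall x, block n a 0 K x = wsum (fun i => wave n (s i)) w N x) /\
    rsum (fun k => a k ^ 2) K = wvar w N.
Proof.
  intros Hs.
  (* The induction has to know which summand filled position [k], so that position [s N] is still
     free; quantifying over [G] yields the sum and the sum of squares at once. *)
  cut (exists a K, (forall k, (K <= k)%nat -> a k = 0) /\
    (forall k, a k = 0 \/ exists i, (i < N)%nat /\ s i = k /\ a k = w i) /\
    (forall G : nat -> R -> R, (forall k, G k 0 = 0) ->
       rsum (fun k => G k (a k)) K = rsum (fun i => G (s i) (w i)) N)).
  { intros (a & K & H1 & H2 & H3). exists a, K. split; [exact H1|]. split; [|split].
    - intros k. destruct (H2 k) as [H|(i & Hi & _ & H)]; [now left|right; now exists i].
    - intros x. apply (H3 (fun k y => y * wave n k x)). intros; ring.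
    - apply (H3 (fun _ y => y ^ 2)). intros; ring. }
  induction N as [|N (a & K & H1 & H2 & H3)].
  - exists (fun _ => 0), 0%nat. split; [reflexivity|]. split; [now left|]. reflexivity.
  - assert (Ha : a (s N) = 0).
    { destruct (H2 (s N)) as [H|(i & Hi & Hsi & _)]; [exact H|]. apply Hs in Hsi. lia. }
    exists (fun k => if Nat.eqb (s N) k then w N else a k), (Nat.max K (S (s N))).
    split; [|split].
    + intros k Hk. replace (Nat.eqb (s N) k) with false by (symmetry; apply Nat.eqb_neq; lia).
      apply H1. lia.
    + intros k. destruct (Nat.eqb_spec (s N) k) as [He|He].
      * right. exists N. repeat split; [lia|exact He].
      * destruct (H2 k) as [H|(i & Hi & H)]; [now left|right]. exists i. split; [lia|exact H].
    + intros G HG. rewrite rsum_update by lia. rewrite Ha, HG.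
      rewrite (rsum_supp _ K) by (try lia; intros k Hk; now rewrite H1, HG).
      rewrite H3 by exact HG. simpl. lra.
Qed.

Lemma lacunary_quasi_gaussian n s : hadamard_gap n -> is_permutation s ->
  quasi_gaussian (fun i => wave n (s i)).
Proof.
  intros (Hpos & q & Hq & Hgap) (Hs & _).
  assert (Hle : forall a w N alpha, 0 <= alpha -> (forall i, Rabs (w i) <= alpha) ->
    (forall k, a k = 0 \/ exists i, (i < N)%nat /\ a k = w i) -> forall k : nat, Rabs (a k) <= alpha).
  { intros a w N alpha H0 Hw Ha k. destruct (Ha k) as [->|(i & _ & ->)]; [now rewrite Rabs_R0|auto]. }
  split.
  - intros i. apply cont_wave.
  - intros w N. destruct (reorder n s w N Hs) as (a & K & H1 & H2 & H3 & H4).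
    rewrite <- H4. rewrite <- (block_sqr_mean n q Hpos Hq Hgap). apply E_ext. intros x. now rewrite H3.
  - destruct (subgaussian n q Hpos Hq Hgap) as (C & HC & H). exists C. split; [exact HC|].
    intros w N. destruct (reorder n s w N Hs) as (a & K & H1 & H2 & H3 & H4).
    rewrite <- H4. rewrite <- (E_ext (fun x => exp (block n a 0 K x))) by (intros; now rewrite H3). auto.
  - intros eps Heps. destruct (mgf_bounds n q Hpos Hq Hgap eps Heps) as (alpha & Halpha & H).
    exists alpha. split; [exact Halpha|].
    intros w N Hw. destruct (reorder n s w N Hs) as (a & K & H1 & H2 & H3 & H4).
    rewrite <- H4. rewrite <- (E_ext (fun x => exp (block n a 0 K x))) by (intros; now rewrite H3).
    apply H; [exact H1|]. apply Hle with w N; [lra|exact Hw|exact H2].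
  - destruct (charfun_bounds n q Hpos Hq Hgap) as (C & HC & H). exists C. split; [exact HC|].
    intros nu w N Hnu Hw. destruct (reorder n s w N Hs) as (a & K & H1 & H2 & H3 & H4).
    rewrite <- H4. rewrite <- (E_ext (fun x => cos (block n a 0 K x))) by (intros; now rewrite H3).
    rewrite <- (E_ext (fun x => sin (block n a 0 K x)) (fun x => sin (wsum _ w N x)))
      by (intros; now rewrite H3).
    apply H; [exact Hnu|exact H1|]. apply Hle with w N; [|exact Hw|exact H2].
    left. apply Rinv_0_lt_compat, pow_lt, lt_0_INR, Hnu.
Qed.

(** The sign moves into the weights. In the lower half of the law this bounds the partial sum
    preceding a block from below. *)
Lemma quasi_gaussian_opp d : quasi_gaussian d -> quasi_gaussian (fun i x => - d i x).
Proof.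
  intros [H1 H2 H3 H4 H5].
  assert (Hw : forall w N x, wsum (fun i x => - d i x) w N x = wsum d (fun i => - w i) N x).
  { intros. apply rsum_ext. intros. ring. }
  assert (Hv : forall w N, wvar (fun i => - w i) N = wvar w N).
  { intros. apply rsum_ext. intros. ring. }
  split.
  - intros i. apply cont_opp, H1.
  - intros w N. rewrite <- Hv, <- H2. apply E_ext. intros. now rewrite Hw.
  - destruct H3 as (C & HC & H). exists C. split; [exact HC|]. intros w N. rewrite <- Hv.
    rewrite (E_ext _ (fun x => exp (wsum d (fun i => - w i) N x))) by (intros; now rewrite Hw). apply H.
  - intros eps Heps. destruct (H4 eps Heps) as (al & Hal & H). exists al. split; [exact Hal|].
    intros w N Hwa. rewrite <- Hv.
    rewrite (E_ext _ (fun x => exp (wsum d (fun i => - w i) N x))) by (intros; now rewrite Hw).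
    apply H. intros; now rewrite Rabs_Ropp.
  - destruct H5 as (C & HC & H). exists C. split; [exact HC|]. intros nu w N Hnu Hwa. rewrite <- Hv.
    rewrite (E_ext _ (fun x => cos (wsum d (fun i => - w i) N x))) by (intros; now rewrite Hw).
    rewrite (E_ext (fun x => sin _) (fun x => sin (wsum d (fun i => - w i) N x))) by (intros; now rewrite Hw).
    apply H; [exact Hnu|]. intros; now rewrite Rabs_Ropp.
Qed.

(** * The upper half of the law of the iterated logarithm *)

Definition dsum (d : nat -> R -> R) (N : nat) (x : R) : R := rsum (fun i => d i x) N.

(** Cut off only from below; the upper end is the length of the [wsum] in which it is used. *)
Definition range_weight (lam : R) (p i : nat) : R := if Nat.leb p i then lam else 0.

Lemma wsum_range d lam p q x : (p <= q)%nat ->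
  wsum d (range_weight lam p) q x = lam * (dsum d q x - dsum d p x).
Proof.
  intros H. unfold wsum, dsum, range_weight. replace q with (p + (q - p))%nat by lia. rewrite !rsum_add.
  rewrite rsum_zero.
  2:{ intros i Hi. replace (Nat.leb p i) with false by (symmetry; apply Nat.leb_gt; lia). ring. }
  rewrite (rsum_ext (fun i => (if Nat.leb p (p + i) then lam else 0) * d (p + i)%nat x) (fun i => lam * d (p + i)%nat x)).
  - rewrite rsum_scal. ring.
  - intros i Hi. replace (Nat.leb p (p + i)) with true by (symmetry; apply Nat.leb_le; lia). ring.
Qed.

Lemma wvar_range lam p q : (p <= q)%nat -> wvar (range_weight lam p) q = lam ^ 2 * INR (q - p).
Proof.
  intros H. unfold wvar, range_weight. replace q with (p + (q - p))%nat at 1 by lia. rewrite rsum_add.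
  rewrite rsum_zero.
  2:{ intros i Hi. replace (Nat.leb p i) with false by (symmetry; apply Nat.leb_gt; lia). ring. }
  rewrite (rsum_ext _ (fun i => lam ^ 2)).
  - rewrite rsum_const. ring.
  - intros i Hi. replace (Nat.leb p (p + i)) with true by (symmetry; apply Nat.leb_le; lia). ring.
Qed.

Lemma range_weight_le lam p i : Rabs (range_weight lam p i) <= Rabs lam.
Proof. unfold range_weight. destruct Nat.leb; [lra|]. rewrite Rabs_R0. apply Rabs_pos. Qed.

Lemma cont_sum d N : (forall i, cont (d i)) -> cont (dsum d N).
Proof. intros H. unfold dsum. conti. Qed.

(** With [b = c / (k + 1)], raise [b x <= exp (b x)] to the power [k + 1]; the spare factor [x]
    absorbs the constant. *)
Lemma poly_le_exp A k c : 0 < c -> exists X, 0 < X /\ forall x, X <= x -> A * x ^ k <= exp (c * x).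
Proof.
  intros Hc. assert (Hk : 0 < INR (S k)) by (apply lt_0_INR; lia).
  set (b := c / INR (S k)). assert (Hb : 0 < b) by (apply Rdiv_lt_0_compat; lra).
  assert (Hbk : 0 < b ^ S k) by now apply pow_lt.
  exists (Rabs A / b ^ S k + 1).
  assert (HA : 0 <= Rabs A / b ^ S k) by (apply Rdiv_le_0_compat; [apply Rabs_pos|exact Hbk]).
  split; [lra|]. intros x Hx.
  replace (c * x) with (INR (S k) * (b * x)) by (unfold b; field; lra).
  assert (He : forall m y, exp (INR m * y) = exp y ^ m).
  { induction m as [|m IH]; intros y; [simpl; rewrite Rmult_0_l; apply exp_0|].
    rewrite S_INR. replace ((INR m + 1) * y) with (INR m * y + y) by ring.
    rewrite exp_plus, IH. simpl. ring. }
  rewrite He. apply Rle_trans with ((b * x) ^ S k).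
  - rewrite Rpow_mult_distr. simpl (x ^ S k). apply Rle_trans with (b ^ S k * x * x ^ k); [|right; ring].
    apply Rmult_le_compat_r; [apply pow_le; lra|].
    apply Rle_trans with (Rabs A); [apply Rle_abs|].
    apply Rle_trans with (b ^ S k * (Rabs A / b ^ S k)); [right; field; lra|].
    apply Rmult_le_compat_l; lra.
  - apply pow_incr. split; [apply Rmult_le_pos; lra|]. generalize (exp_ineq1_le (b * x)). lra.
Qed.

Lemma INR_pow2 k : INR (2 ^ k) = 2 ^ k.
Proof. rewrite pow_INR. reflexivity. Qed.

Lemma pow_exp_ln a k : 0 < a -> a ^ k = exp (INR k * ln a).
Proof. intros Ha. rewrite <- Rpower_pow by exact Ha. reflexivity. Qed.

Lemma ln_le_self x : 0 < x -> ln x <= x.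
Proof. intros H. generalize (exp_ineq1_le (ln x)). rewrite exp_ln by exact H. lra. Qed.

Lemma ln_large A : exists I, (2 <= I)%nat /\ forall i, (I <= i)%nat -> A <= ln (INR i).
Proof.
  destruct (INR_unbounded (exp A)) as (I & HI). exists (Nat.max 2 I). split; [lia|].
  intros i Hi. rewrite <- (ln_exp A). apply ln_le; [apply exp_pos|].
  apply Rle_trans with (INR I); [lra|]. apply le_INR. lia.
Qed.

(** A telescoping majorant of [i ^ (- 1 - p)], in the form that [borel_cantelli] expects. *)
Lemma p_series_step p i : 0 < p -> (2 <= i)%nat ->
  p * exp (- ((1 + p) * ln (INR i))) <= exp (- (p * ln (INR (i - 1)))) - exp (- (p * ln (INR i))).
Proof.
  intros Hp Hi. rewrite minus_INR by lia. simpl (INR 1).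
  assert (H2 : 2 <= INR i) by (apply (le_INR 2); lia). set (x := INR i) in *.
  set (a := ln x). set (b := ln (x - 1)).
  assert (Hab : exp (- a) <= a - b).
  { unfold a. rewrite exp_Ropp, exp_ln by lra.
    assert (H : b - a <= - / x); [|unfold a in H; lra].
    unfold b, a. rewrite <- ln_div by lra.
    generalize (exp_ineq1_le (ln ((x - 1) / x))). rewrite exp_ln by (apply Rdiv_lt_0_compat; lra).
    replace ((x - 1) / x) with (1 - / x) by (field; lra). lra. }
  replace (- (p * b)) with (- (p * a) + p * (a - b)) by ring.
  replace (- ((1 + p) * a)) with (- (p * a) + - a) by ring. rewrite !exp_plus.
  assert (H1 := exp_ineq1_le (p * (a - b))). assert (H3 := exp_pos (- (p * a))).
  assert (p * exp (- a) <= p * (a - b)) by (apply Rmult_le_compat_l; lra). nra.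
Qed.

(* Binary chaining: [N] is reached from its multiple-of-[2^L] part by dyadic steps of decreasing size. *)
Lemma chaining (S : nat -> R) (rho : nat -> R) N L : (forall e, 0 <= rho e) ->
  (forall e c, (e < L)%nat -> ((c + 1) * 2 ^ (L - e - 1) <= N)%nat ->
    Rabs (S ((c + 1) * 2 ^ (L - e - 1))%nat - S (c * 2 ^ (L - e - 1))%nat) <= rho e) ->
  Rabs (S N - S (N / 2 ^ L * 2 ^ L)%nat) <= rsum rho L.
Proof.
  intros Hr H.
  assert (Hd : forall k, (k <= L)%nat ->
    Rabs (S (N / 2 ^ (L - k) * 2 ^ (L - k))%nat - S (N / 2 ^ L * 2 ^ L)%nat) <= rsum rho k).
  { induction k as [|k IH]; intros Hk.
    - rewrite Nat.sub_0_r, Rminus_diag, Rabs_R0. simpl. lra.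
    - specialize (IH ltac:(lia)). simpl rsum.
      set (M := (2 ^ (L - k - 1))%nat).
      replace (2 ^ (L - Datatypes.S k))%nat with M by (unfold M; f_equal; lia).
      assert (HM2 : (2 ^ (L - k) = M * 2)%nat).
      { unfold M. replace (L - k)%nat with (Datatypes.S (L - k - 1)) at 1 by lia. simpl. lia. }
      rewrite HM2 in IH. rewrite <- Nat.Div0.div_div in IH. set (y := (N / M)%nat) in *.
      assert (HyN : (y * M <= N)%nat) by (unfold y; generalize (Nat.Div0.mul_div_le N M); lia).
      assert (Hy := Nat.div_mod_eq y 2). assert (Hy2 := Nat.mod_upper_bound y 2 ltac:(lia)).
      set (z := (y / 2)%nat) in *.
      assert (Hstep : Rabs (S (y * M)%nat - S (z * (M * 2))%nat) <= rho k).
      { destruct (Nat.eq_dec (y mod 2) 0) as [H0|H0].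
        - replace (y * M)%nat with (z * (M * 2))%nat by nia. rewrite Rminus_diag, Rabs_R0. apply Hr.
        - assert (Hyz : (y = 2 * z + 1)%nat) by lia.
          specialize (H k (2 * z)%nat ltac:(lia)). fold M in H.
          replace (y * M)%nat with ((2 * z + 1) * M)%nat by (rewrite Hyz; reflexivity).
          replace (z * (M * 2))%nat with (2 * z * M)%nat by lia.
          apply H. rewrite <- Hyz. exact HyN. }
      replace (S (y * M)%nat - S (N / 2 ^ L * 2 ^ L)%nat) with
        ((S (y * M)%nat - S (z * (M * 2))%nat) + (S (z * (M * 2))%nat - S (N / 2 ^ L * 2 ^ L)%nat)) by ring.
      eapply Rle_trans; [apply Rabs_triang|]. lra. }
  specialize (Hd L ltac:(lia)). rewrite Nat.sub_diag in Hd. simpl (2 ^ 0)%nat in Hd.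
  rewrite Nat.div_1_r, Nat.mul_1_r in Hd. exact Hd.
Qed.

Lemma rsum_geom34 L : rsum (fun e => (3/4) ^ Datatypes.S e) L <= 3.
Proof.
  assert (H : rsum (fun e => (3/4) ^ S e) L = 3 * (1 - (3/4) ^ L)).
  { induction L as [|L IH]; [simpl; lra|]. cbn [rsum]. rewrite IH. simpl. field. }
  rewrite H. assert (0 <= (3/4) ^ L) by (apply pow_le; lra). lra.
Qed.

Lemma exp_lt_1 y : exp y < 1 -> y < 0.
Proof. intros H. apply exp_lt_inv. now rewrite exp_0. Qed.

Section Upper.

Context (d : nat -> R -> R) (Hd : quasi_gaussian d).

Let cd : forall i, cont (d i) := qg_cont d Hd.

(** Exponential Chebyshev bound for an increment with the sharp constant, available for small [lam].
    Its companion [coarse_mean] has a worse constant but no restriction on [lam]; short increments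
    need this, since their optimal tilt is large. *)
Lemma tail_mean lam u p N eps alpha : (p <= N)%nat ->
  (forall w N, (forall i, Rabs (w i) <= alpha) ->
    exp ((1 - eps) * wvar w N / 4) <= E (fun x => exp (wsum d w N x)) <= exp ((1 + eps) * wvar w N / 4)) ->
  Rabs lam <= alpha ->
  E (fun x => exp (lam * (dsum d N x - dsum d p x) - u)) <= exp ((1 + eps) * (lam ^ 2 * INR (N - p)) / 4 - u).
Proof.
  intros HpN H Hl.
  rewrite (E_ext _ (fun x => exp (- u) * exp (wsum d (range_weight lam p) N x))).
  - rewrite E_scal by (apply cont_expf, cont_wsum, cd).
    replace ((1 + eps) * (lam ^ 2 * INR (N - p)) / 4 - u) with (- u + (1 + eps) * (lam ^ 2 * INR (N - p)) / 4) by ring.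
    rewrite exp_plus. apply Rmult_le_compat_l; [left; apply exp_pos|].
    rewrite <- (wvar_range lam p N HpN). apply H. intros i.
    eapply Rle_trans; [apply range_weight_le|exact Hl].
  - intros x. rewrite wsum_range by exact HpN. rewrite <- exp_plus. f_equal. ring.
Qed.

Lemma coarse_mean C lam u p N : (p <= N)%nat ->
  (forall w N, E (fun x => exp (wsum d w N x)) <= exp (C * wvar w N)) ->
  E (fun x => exp (lam * (dsum d N x - dsum d p x) - u)) <= exp (C * (lam ^ 2 * INR (N - p)) - u).
Proof.
  intros HpN H.
  rewrite (E_ext _ (fun x => exp (- u) * exp (wsum d (range_weight lam p) N x))).
  - rewrite E_scal by (apply cont_expf, cont_wsum, cd).
    replace (C * (lam ^ 2 * INR (N - p)) - u) with (- u + C * (lam ^ 2 * INR (N - p))) by ring.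
    rewrite exp_plus. apply Rmult_le_compat_l; [left; apply exp_pos|].
    rewrite <- (wvar_range lam p N HpN). apply H.
  - intros x. rewrite wsum_range by exact HpN. rewrite <- exp_plus. f_equal. ring.
Qed.

Definition lil_norm (N : nat) : R := sqrt (INR N * ln (ln (INR N))).

Section Scale.

(* [h] leading binary digits of [N] are treated exactly, the remaining [i - h] ones by chaining. *)
Context (delta C : R) (h : nat) (Hdelta : 0 < delta <= 1) (HC : 0 < C).

Let l (i : nat) : R := ln (INR i).
Let R0 : R := sqrt (64 * C).
Let Ng (i g : nat) : nat := ((2 ^ h + g) * 2 ^ (i - h))%nat.
Let ug (i g : nat) : R := (1 + delta / 2) * sqrt (INR (Ng i g) * l i).
(** Minimizes [lam^2 N / 4 - lam u]; in the same way [mu] below minimizes [C mu^2 M - mu rho]. *)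
Let lam (i g : nat) : R := 2 * ug i g / INR (Ng i g).
(** Allowed deviation of a step of length [M i e]. The ratio [3/4] lies between [1 / sqrt 2] and 1:
    the deviations are summable, yet [rho^2 / M] grows like [(9/8)^e] and beats the growing number
    of steps. The 64 in [R0] makes the tail exponent [16 l (9/8)^(e+1)]. *)
Let rho (i e : nat) : R := R0 * sqrt (l i) * sqrt (2 ^ (i - h)) * (3/4) ^ S e.
Let M (i e : nat) : nat := (2 ^ (i - h - e - 1))%nat.
Let mu (i e : nat) : R := rho i e / (2 * C * INR (M i e)).

(** [F1] and [F2] are continuous majorants of exceptional events: a summand reaches 1 when its
    threshold is crossed, so a total below 1 excludes every crossing. The range [2 ^ (h + e + 2)] in
    [F2] counts the steps of length [M i e] below [2 ^ (i + 1)]. *)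
Let F1 (i : nat) (x : R) : R :=
  rsum (fun g => exp (lam i g * (dsum d (Ng i g) x - dsum d 0 x) - lam i g * ug i g)) (2 ^ h).
Let G2 (i e c : nat) (s x : R) : R :=
  exp (s * mu i e * (dsum d ((c + 1) * M i e) x - dsum d (c * M i e) x) - mu i e * rho i e).
Let F2 (i : nat) (x : R) : R :=
  rsum (fun e => rsum (fun c => G2 i e c 1 x + G2 i e c (-1) x) (2 ^ (h + e + 2))) (i - h).

Definition scale_fun (i : nat) (x : R) : R := F1 i x + F2 i x.

Lemma scale_cont i : cont (scale_fun i).
Proof.
  unfold scale_fun.
  assert (Hs : forall N, cont (dsum d N)) by (intros; apply cont_sum, cd).
  unfold F1, F2, G2. conti.
Qed.

Lemma scale_nonneg i x : 0 <= scale_fun i x.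
Proof.
  unfold scale_fun.
  apply Rplus_le_le_0_compat; apply rsum_nonneg; intros; [left; apply exp_pos|].
  apply rsum_nonneg; intros. apply Rplus_le_le_0_compat; left; apply exp_pos.
Qed.

Lemma Ng_pos i g : 0 < INR (Ng i g) /\ ((h <= i)%nat -> 2 ^ i <= INR (Ng i g)).
Proof.
  assert (H : (2 ^ h * 2 ^ (i - h) <= Ng i g)%nat) by (unfold Ng; nia).
  assert (H1 : (0 < 2 ^ h)%nat) by (generalize (Nat.pow_nonzero 2 h); lia).
  assert (H2 : (0 < 2 ^ (i - h))%nat) by (generalize (Nat.pow_nonzero 2 (i - h)); lia).
  split.
  - apply lt_0_INR. nia.
  - intros Hi. rewrite <- Nat.pow_add_r in H. replace (h + (i - h))%nat with i in H by lia.
    rewrite <- INR_pow2. now apply le_INR.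
Qed.

Lemma rho_sqr i e : 0 <= l i -> (e < i - h)%nat ->
  rho i e ^ 2 = 64 * C * l i * (9/8) ^ S e * INR (M i e).
Proof.
  intros Hl He. unfold rho, R0, M. rewrite !Rpow_mult_distr, !pow2_sqrt; [|apply pow_le; lra|lra|lra].
  rewrite INR_pow2. rewrite <- pow_mult.
  replace (S e * 2)%nat with (2 * S e)%nat by lia. rewrite pow_mult.
  replace (2 ^ (i - h)) with (2 ^ (i - h - e - 1) * 2 ^ S e)
    by (rewrite <- pow_add; f_equal; lia).
  replace ((3/4) ^ 2) with (9/16) by field.
  replace (9/8) with (2 * (9/16)) by field. rewrite (Rpow_mult_distr 2). ring.
Qed.

(** At each leading multiple the exponent is [- (1 - delta/4) (1 + delta/2)^2 l i <= - (1 + delta/2)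
    l i]; the last hypothesis keeps [lam] below [alpha]. A chained step of level [e] gains a further
    factor [4 ^ - (e + 1)], which outweighs the number of such steps. *)
Lemma scale_means alpha i :
  (forall w N, (forall i, Rabs (w i) <= alpha) ->
    exp ((1 - delta/4) * wvar w N / 4) <= E (fun x => exp (wsum d w N x)) <= exp ((1 + delta/4) * wvar w N / 4)) ->
  (forall w N, E (fun x => exp (wsum d w N x)) <= exp (C * wvar w N)) ->
  0 < alpha -> (4 <= i)%nat -> (h <= i)%nat -> 9 * INR i <= alpha ^ 2 * 2 ^ i ->
  E (scale_fun i) <= 2 ^ (h + 3) * exp (- ((1 + delta / 2) * l i)).
Proof.
  intros Hmgf Hsub Halpha Hi Hhi Hbig.
  assert (Hi2 : 4 <= INR i) by (replace 4 with (INR 4) by (simpl; lra); apply le_INR; lia).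
  assert (Hl1 : 1 <= l i).
  { unfold l. rewrite <- (ln_exp 1). apply ln_le; [apply exp_pos|]. generalize exp_le_3; lra. }
  assert (Hli : l i <= INR i) by (apply ln_le_self; lra).
  assert (Hs : forall N, cont (dsum d N)) by (intros; apply cont_sum, cd).
  set (p := exp (- ((1 + delta / 2) * l i))).
  assert (HF1 : E (F1 i) <= 2 ^ h * p).
  { unfold F1. rewrite E_rsum by (intros; conti).
    rewrite <- INR_pow2, <- rsum_const. apply rsum_le. intros g _.
    destruct (Ng_pos i g) as [HN0 HN]. specialize (HN Hhi). set (N := INR (Ng i g)) in *.
    assert (Hug : ug i g ^ 2 = (1 + delta / 2) ^ 2 * (N * l i)).
    { unfold ug. rewrite Rpow_mult_distr, pow2_sqrt; [reflexivity|]. fold N. nra. }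
    assert (Hug0 : 0 <= ug i g).
    { unfold ug. apply Rmult_le_pos; [lra|apply sqrt_pos]. }
    assert (Hlam0 : 0 <= lam i g) by (unfold lam; apply Rdiv_le_0_compat; fold N; lra).
    assert (Hlam2 : lam i g ^ 2 * N = 4 * ((1 + delta / 2) ^ 2 * l i)).
    { unfold lam. fold N. replace ((2 * ug i g / N) ^ 2 * N) with (4 * ug i g ^ 2 / N) by (field; lra).
      rewrite Hug. field. lra. }
    eapply Rle_trans; [apply (tail_mean _ _ 0 (Ng i g) (delta/4) alpha); [lia|exact Hmgf|]|].
    - rewrite Rabs_pos_eq by exact Hlam0.
      apply Rsqr_incr_0_var; [|lra]. rewrite !Rsqr_pow2.
      apply Rmult_le_reg_r with N; [exact HN0|]. rewrite Hlam2.
      assert ((1 + delta / 2) ^ 2 <= 9/4) by nra.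
      assert (4 * ((1 + delta / 2) ^ 2 * l i) <= 9 * INR i) by nra.
      assert (alpha ^ 2 * 2 ^ i <= alpha ^ 2 * N) by (apply Rmult_le_compat_l; [apply pow2_ge_0|exact HN]).
      lra.
    - rewrite Nat.sub_0_r. fold N. rewrite Hlam2. apply exp_le.
      replace (lam i g * ug i g) with (2 * ((1 + delta/2) ^ 2 * l i)).
      + assert ((1 + delta / 2) <= (1 - delta / 4) * (1 + delta / 2) ^ 2) by nra. nra.
      + unfold lam. fold N. replace (2 * ug i g / N * ug i g) with (2 * ug i g ^ 2 / N) by (field; lra).
        rewrite Hug. field. lra. }
  assert (HG : forall e c s, (e < i - h)%nat -> s ^ 2 = 1 ->
    E (G2 i e c s) <= p * (/ 4) ^ S e).
  { intros e c s He Hs1. unfold G2.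
    assert (HM0 : 0 < INR (M i e)).
    { unfold M. rewrite INR_pow2. apply pow_lt. lra. }
    eapply Rle_trans; [apply (coarse_mean C); [nia|exact Hsub]|].
    replace ((c + 1) * M i e - c * M i e)%nat with (M i e) by nia.
    rewrite Rpow_mult_distr, Hs1.
    replace (C * (1 * mu i e ^ 2 * INR (M i e)) - mu i e * rho i e) with
      (- (rho i e ^ 2 / (4 * C * INR (M i e)))) by (unfold mu; field; lra).
    rewrite rho_sqr by (try lra; exact He).
    replace (64 * C * l i * (9 / 8) ^ S e * INR (M i e) / (4 * C * INR (M i e))) with (16 * l i * (9/8) ^ S e)
      by (field; lra).
    (* Of the resulting exponent [16 l + 2 l (e + 1)], the first part yields [p] and the second, by
       [ln 4 <= 2 l], the power of [/ 4]. *)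
    assert (Hb : 1 + INR (S e) * (1/8) <= (9/8) ^ S e).
    { replace (9/8) with (1 + 1/8) by field. apply poly; lra. }
    unfold p. rewrite (pow_exp_ln (/ 4)) by lra. rewrite <- exp_plus. apply exp_le.
    rewrite ln_Rinv by lra.
    assert (Hln4 : ln 4 <= 2 * l i).
    { assert (ln 4 <= l i) by (apply ln_le; lra). lra. }
    assert (0 <= INR (S e)) by apply pos_INR.
    nra. }
  assert (cG : forall e c s, cont (G2 i e c s)) by (intros; unfold G2; conti).
  assert (HF2 : E (F2 i) <= 2 ^ (h + 2) * p).
  { unfold F2. rewrite E_rsum by (intros; apply cont_rsum; intros; apply cont_plus; apply cG).
    assert (Hp : 0 < p) by apply exp_pos.
    eapply Rle_trans; [|apply (rsum_geom (2 ^ (h + 2) * p) (i - h))].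
    - apply rsum_le. intros e He.
      rewrite E_rsum by (intros; apply cont_plus; apply cG).
      apply Rle_trans with (rsum (fun _ => 2 * (p * (/ 4) ^ S e)) (2 ^ (h + e + 2))).
      + apply rsum_le. intros c _. rewrite E_plus by apply cG.
        assert (E (G2 i e c 1) <= p * (/ 4) ^ S e) by (apply HG; [exact He|ring]).
        assert (E (G2 i e c (-1)) <= p * (/ 4) ^ S e) by (apply HG; [exact He|ring]). lra.
      + rewrite rsum_const, INR_pow2. replace (/ 4) with (/ 2 * / 2) by field. rewrite (Rpow_mult_distr (/ 2)).
        right. replace (h + e + 2)%nat with (h + 2 + e)%nat by lia. rewrite (pow_add 2 (h + 2) e).
        assert (H2e : 2 ^ e * (/ 2) ^ e = 1).
        { rewrite <- Rpow_mult_distr. replace (2 * / 2) with 1 by field. apply pow1. }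
        replace (2 ^ (h + 2) * 2 ^ e * (2 * (p * ((/ 2) ^ S e * (/ 2) ^ S e)))) with
          (2 ^ (h + 2) * p * (/ 2) ^ S e * (2 ^ e * (/ 2) ^ e)) by (simpl; field).
        rewrite H2e. ring.
    - apply Rmult_le_pos; [apply pow_le; lra|lra]. }
  unfold scale_fun. rewrite E_plus.
  - rewrite !pow_add in *. simpl (2 ^ 2) in HF2. simpl (2 ^ 3).
    assert (0 < 2 ^ h) by (apply pow_lt; lra). assert (0 < p) by apply exp_pos.
    assert (0 < 2 ^ h * p) by now apply Rmult_lt_0_compat. nra.
  - unfold F1. conti.
  - unfold F2. apply cont_rsum; intros; apply cont_rsum; intros; apply cont_plus; apply cG.
Qed.

(** Three losses add up: the thresholds give [1 + delta / 2], the chained digits at most [delta / 8]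
    thanks to the size of [2 ^ h], and the remaining [3/8 delta] pays for [ln i] in place of
    [ln (ln N)]. *)
Lemma scale_bound i N x : (4 <= i)%nat -> (h <= i)%nat -> 6 / delta <= l i ->
  (24 * R0 / delta) ^ 2 <= 2 ^ h ->
  (2 ^ i <= N < 2 ^ S i)%nat -> scale_fun i x < 1 -> dsum d N x <= (1 + delta) * lil_norm N.
Proof.
  intros Hi Hhi Hl Hh HN HF. unfold scale_fun in HF.
  assert (Hi2 : 4 <= INR i) by (replace 4 with (INR 4) by (simpl; lra); apply le_INR; lia).
  assert (Hl1 : 6 <= l i).
  { apply Rle_trans with (6 / delta); [|exact Hl]. apply Rmult_le_reg_r with delta; [lra|].
    unfold Rdiv. rewrite Rmult_assoc, Rinv_l by lra. nra. }
  assert (HF10 : 0 <= F1 i x) by (apply rsum_nonneg; intros; left; apply exp_pos).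
  assert (HGpos : forall e c s, 0 <= G2 i e c s x) by (intros; left; apply exp_pos).
  assert (HF20 : 0 <= F2 i x).
  { apply rsum_nonneg; intros. apply rsum_nonneg; intros. apply Rplus_le_le_0_compat; apply HGpos. }
  set (L := (i - h)%nat).
  assert (HM0 : forall e, 0 < INR (M i e)).
  { intros e. unfold M. rewrite INR_pow2. apply pow_lt. lra. }
  assert (H2L : 0 < 2 ^ L) by (apply pow_lt; lra).
  assert (HR0 : 0 < R0) by (apply sqrt_lt_R0; lra).
  assert (Hrho : forall e, 0 < rho i e).
  { intros e. unfold rho. fold L. repeat apply Rmult_lt_0_compat; try (apply sqrt_lt_R0); try apply pow_lt; lra. }
  assert (Hmu : forall e, 0 < mu i e).
  { intros e. unfold mu. apply Rdiv_lt_0_compat; [apply Hrho|]. specialize (HM0 e). nra. }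
  assert (Hdiff : forall e c, (e < L)%nat -> ((c + 1) * M i e <= N)%nat ->
    Rabs (dsum d ((c + 1) * M i e) x - dsum d (c * M i e) x) <= rho i e).
  { intros e c He Hc.
    assert (Hc2 : (c < 2 ^ (h + e + 2))%nat).
    { assert (Hpow : (2 ^ (h + e + 2) * M i e = 2 ^ S i)%nat).
      { unfold M. rewrite <- Nat.pow_add_r. f_equal. unfold L in He. lia. }
      assert (M i e <> 0)%nat by (apply Nat.pow_nonzero; lia). nia. }
    assert (Hterm : forall s, (s = 1 \/ s = -1) -> G2 i e c s x < 1).
    { intros s Hs1. eapply Rle_lt_trans; [|exact HF].
      apply Rle_trans with (F2 i x); [|lra].
      apply Rle_trans with (rsum (fun c => G2 i e c 1 x + G2 i e c (-1) x) (2 ^ (h + e + 2))).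
      - apply Rle_trans with (G2 i e c 1 x + G2 i e c (-1) x).
        + generalize (HGpos e c 1) (HGpos e c (-1)). destruct Hs1 as [->| ->]; lra.
        + apply (rsum_term (fun c => G2 i e c 1 x + G2 i e c (-1) x)); [|exact Hc2].
          intros. apply Rplus_le_le_0_compat; apply HGpos.
      - unfold F2. fold L. apply (rsum_term (fun e => rsum (fun c => G2 i e c 1 x + G2 i e c (-1) x) (2 ^ (h + e + 2)))); [|exact He].
        intros. apply rsum_nonneg; intros. apply Rplus_le_le_0_compat; apply HGpos. }
    assert (H1 := exp_lt_1 _ (Hterm 1 (or_introl eq_refl))).
    assert (H2 := exp_lt_1 _ (Hterm (-1) (or_intror eq_refl))).
    specialize (Hmu e). set (D := dsum d ((c + 1) * M i e) x - dsum d (c * M i e) x) in *.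
    apply Rabs_le. split; apply Rmult_le_reg_l with (mu i e); lra. }
  assert (Hchain := chaining (fun k => dsum d k x) (rho i) N L (fun e => Rlt_le _ _ (Hrho e))).
  assert (Hc : Rabs (dsum d N x - dsum d (N / 2 ^ L * 2 ^ L) x) <= rsum (rho i) L).
  { apply Hchain. intros e c He Hc. unfold M, L in *. apply Hdiff; assumption. }
  assert (H2L' : (2 ^ L <> 0)%nat) by (apply Nat.pow_nonzero; lia).
  assert (Hpi : (2 ^ i = 2 ^ h * 2 ^ L)%nat) by (rewrite <- Nat.pow_add_r; f_equal; unfold L; lia).
  assert (Hq1 : (2 ^ h <= N / 2 ^ L)%nat) by (apply Nat.div_le_lower_bound; [exact H2L'|lia]).
  assert (Hq2 : (N / 2 ^ L < 2 * 2 ^ h)%nat).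
  { apply Nat.Div0.div_lt_upper_bound. simpl in HN. lia. }
  set (g := (N / 2 ^ L - 2 ^ h)%nat).
  assert (Hg : (N / 2 ^ L * 2 ^ L)%nat = Ng i g).
  { unfold Ng. fold L. f_equal. unfold g. lia. }
  rewrite Hg in Hc.
  assert (HNg : INR (Ng i g) <= INR N).
  { apply le_INR. rewrite <- Hg. generalize (Nat.Div0.mul_div_le N (2 ^ L)). lia. }
  destruct (Ng_pos i g) as [HNg0 HNg1]. specialize (HNg1 Hhi).
  assert (Hu0 : 0 < ug i g).
  { unfold ug. apply Rmult_lt_0_compat; [lra|]. apply sqrt_lt_R0. apply Rmult_lt_0_compat; lra. }
  assert (Hlam0 : 0 < lam i g) by (unfold lam; apply Rdiv_lt_0_compat; lra).
  assert (HS : dsum d (Ng i g) x <= ug i g).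
  { assert (H1 : exp (lam i g * (dsum d (Ng i g) x - dsum d 0 x) - lam i g * ug i g) < 1).
    { eapply Rle_lt_trans; [|exact HF]. apply Rle_trans with (F1 i x); [|lra].
      apply (rsum_term (fun g => exp (lam i g * (dsum d (Ng i g) x - dsum d 0 x) - lam i g * ug i g)));
        [intros; left; apply exp_pos|unfold g; lia]. }
    apply exp_lt_1 in H1. unfold dsum at 2 in H1. simpl in H1.
    apply Rmult_le_reg_l with (lam i g); [exact Hlam0|]. lra. }
  assert (HNR : 2 ^ i <= INR N) by lra.
  assert (H2i : 0 < 2 ^ i) by (apply pow_lt; lra).
  set (Q := sqrt (INR N * l i)).
  assert (Hu : ug i g <= (1 + delta / 2) * Q).
  { unfold ug, Q. apply Rmult_le_compat_l; [lra|]. apply sqrt_le_1_alt. apply Rmult_le_compat_r; lra. }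
  assert (Hsum : rsum (rho i) L <= delta / 8 * Q).
  { unfold rho. fold L. rewrite rsum_scal.
    apply Rle_trans with (R0 * sqrt (l i) * sqrt (2 ^ L) * 3).
    - apply Rmult_le_compat_l; [|apply rsum_geom34].
      repeat apply Rmult_le_pos; try apply sqrt_pos; lra.
    - assert (HLh : 24 * R0 / delta * sqrt (2 ^ L) <= sqrt (INR N)).
      { rewrite <- (sqrt_pow2 (24 * R0 / delta)) by (apply Rdiv_le_0_compat; lra).
        rewrite <- sqrt_mult_alt by apply pow2_ge_0. apply sqrt_le_1_alt.
        apply Rle_trans with (2 ^ i); [|exact HNR].
        replace (2 ^ i) with (2 ^ h * 2 ^ L) by (rewrite <- pow_add; f_equal; unfold L; lia).
        apply Rmult_le_compat_r; lra. }
      unfold Q. rewrite sqrt_mult_alt by lra.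
      replace (R0 * sqrt (l i) * sqrt (2 ^ L) * 3) with (delta / 8 * ((24 * R0 / delta * sqrt (2 ^ L)) * sqrt (l i)))
        by (field; lra).
      apply Rmult_le_compat_l; [lra|]. apply Rmult_le_compat_r; [apply sqrt_pos|exact HLh]. }
  assert (HQn : (1 + 5/8 * delta) * Q <= (1 + delta) * lil_norm N).
  { unfold Q, lil_norm.
    rewrite <- (sqrt_pow2 (1 + 5/8 * delta)) by lra. rewrite <- (sqrt_pow2 (1 + delta)) by lra.
    rewrite <- !sqrt_mult_alt by apply pow2_ge_0. apply sqrt_le_1_alt.
    (* From [ln N >= i ln 2 >= i / 2] the loss is at most [ln 2 <= 1], and [6 <= delta * l i]
       absorbs it. *)
    assert (Hll : l i - 1 <= ln (ln (INR N))).
    { assert (H1 : INR i * / 2 <= ln (INR N)).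
      { apply Rle_trans with (ln (2 ^ i)); [|apply ln_le; lra]. rewrite pow_exp_ln, ln_exp by lra.
        apply Rmult_le_compat_l; [lra|]. generalize ln_lt_2; lra. }
      apply Rle_trans with (ln (INR i * / 2)); [|apply ln_le; lra].
      rewrite ln_mult, ln_Rinv by lra. fold (l i). generalize (ln_le_self 2).
      assert (ln 2 <= 1); [|lra]. rewrite <- (ln_exp 1). apply ln_le; [lra|]. generalize (exp_ineq1_le 1); lra. }
    assert (H0 : (1 + 5 / 8 * delta) ^ 2 * l i <= (1 + delta) ^ 2 * ln (ln (INR N))).
    { apply Rle_trans with ((1 + delta) ^ 2 * (l i - 1)); [|apply Rmult_le_compat_l; [apply pow2_ge_0|lra]].
      assert (Hdl : 6 <= delta * l i).
      { apply Rmult_le_reg_r with (/ delta); [apply Rinv_0_lt_compat; lra|].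
        replace (delta * l i * / delta) with (l i) by (field; lra). exact Hl. }
      nra. }
    assert (0 < INR N) by lra. nra. }
  apply Rabs_le_between in Hc. lra.
Qed.

End Scale.

Theorem lil_upper delta : 0 < delta <= 1 ->
  lebesgue_null (fun x => 0 <= x <= 1 /\
    ~ exists N0, forall N, (N0 <= N)%nat -> dsum d N x <= (1 + delta) * lil_norm N).
Proof.
  intros Hdelta. destruct (qg_sub d Hd) as (C & HC & Hsub).
  destruct (qg_mgf d Hd (delta / 4)) as (alpha & Halpha & Hmgf); [lra|].
  set (R0 := sqrt (64 * C)).
  (* [h] is fixed before the scale [i]: the chained digits make up at most a share [2 ^ - h] of
     [N]. *)
  destruct (pow_unbounded 2 ((24 * R0 / delta) ^ 2)) as (h & _ & Hh); [lra|].
  destruct (poly_le_exp (9 / alpha ^ 2) 1 (ln 2)) as (X & HX & Hpoly); [generalize ln_lt_2; lra|].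
  destruct (INR_unbounded X) as (I1 & HI1).
  destruct (ln_large (6 / delta)) as (I2 & _ & HI2).
  set (i0 := (4 + h + I1 + I2)%nat).
  assert (Hbig : forall i, (i0 <= i)%nat -> 9 * INR i <= alpha ^ 2 * 2 ^ i).
  { intros i Hi. rewrite (pow_exp_ln 2) by lra.
    assert (H := Hpoly (INR i)). rewrite (Rmult_comm (ln 2)) in H.
    assert (X <= INR i).
    { apply Rle_trans with (INR I1); [lra|]. apply le_INR. unfold i0 in Hi. lia. }
    specialize (H H0). apply Rmult_le_compat_l with (r := alpha ^ 2) in H; [|apply pow2_ge_0].
    replace (alpha ^ 2 * (9 / alpha ^ 2 * INR i ^ 1)) with (9 * INR i) in H by (field; lra). exact H. }
  (* The majorant comes from [p_series_step] with [p = delta / 2], whose shift explains [i - 1]; the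
     power [h + 4] in place of [h + 3] makes the inequality strict. *)
  eapply null_mono; [|apply (borel_cantelli
    (scale_fun delta C h) (fun i => 2 ^ (h + 4) / (delta / 2) * exp (- (delta / 2 * ln (INR (i - 1))))) i0
    (scale_cont delta C h) (scale_nonneg delta C h))].
  - intros x (Hx & Hn). split; [exact Hx|]. intros I.
    destruct (excluded_middle_informative (exists i, (I <= i)%nat /\ 1 <= scale_fun delta C h i x)) as [H|H]; [exact H|].
    exfalso. apply Hn. set (I' := Nat.max I i0). exists (2 ^ I')%nat. intros N HN.
    assert (HN0 : (0 < N)%nat) by (generalize (Nat.pow_nonzero 2 I'); lia).
    set (i := Nat.log2 N). assert (Hlog := Nat.log2_spec N HN0). fold i in Hlog.
    assert (HiI : (I' <= i)%nat).
    { unfold i. rewrite <- (Nat.log2_pow2 I') by lia. now apply Nat.log2_le_mono. }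
    apply (scale_bound delta C h Hdelta HC i N x); [unfold i0 in *; lia|unfold i0 in *; lia| |exact Hh|exact Hlog|].
    + apply HI2. unfold i0 in *; lia.
    + apply Rnot_le_lt. intros H1. apply H. exists i. split; [lia|exact H1].
  - intros i Hi.
    eapply Rle_lt_trans; [apply (scale_means delta C h Hdelta HC alpha i Hmgf Hsub Halpha);
      [unfold i0 in Hi; lia|unfold i0 in Hi; lia|now apply Hbig]|].
    assert (Hp := p_series_step (delta / 2) i ltac:(lra) ltac:(unfold i0 in Hi; lia)).
    assert (0 < exp (- ((1 + delta / 2) * ln (INR i)))) by apply exp_pos.
    assert (H2 : 0 < 2 ^ h) by (apply pow_lt; lra).
    replace (S i - 1)%nat with i by lia. rewrite !pow_add. rewrite <- Rmult_minus_distr_l.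
    apply Rlt_le_trans with (2 ^ h * 2 ^ 4 / (delta / 2) * (delta / 2 * exp (- ((1 + delta / 2) * ln (INR i))))).
    + replace (2 ^ h * 2 ^ 4 / (delta / 2) * (delta / 2 * exp (- ((1 + delta / 2) * ln (INR i))))) with
        (16 * (2 ^ h * exp (- ((1 + delta / 2) * ln (INR i))))) by (field; lra).
      assert (0 < 2 ^ h * exp (- ((1 + delta / 2) * ln (INR i)))) by (apply Rmult_lt_0_compat; lra).
      simpl (2 ^ 3). lra.
    + apply Rmult_le_compat_l; [|exact Hp]. apply Rdiv_le_0_compat; lra.
  - intros eps Heps. set (A := 2 ^ (h + 4) / (delta / 2)).
    assert (HA : 0 < A) by (apply Rdiv_lt_0_compat; [apply pow_lt|]; lra).
    destruct (ln_large (- ln (eps / A) / (delta / 2))) as (I & HI2' & HI). exists (S I). intros i Hi.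
    rewrite Rabs_pos_eq by (apply Rmult_le_pos; [lra|left; apply exp_pos]).
    apply Rle_trans with (A * (eps / A)); [|right; field; lra].
    apply Rmult_le_compat_l; [lra|]. rewrite <- (exp_ln (eps / A)) by (apply Rdiv_lt_0_compat; lra).
    apply exp_le. specialize (HI (i - 1)%nat ltac:(lia)).
    apply Rmult_le_compat_l with (r := delta / 2) in HI; [|lra].
    replace (delta / 2 * (- ln (eps / A) / (delta / 2))) with (- ln (eps / A)) in HI by (field; lra). lra.
Qed.

End Upper.

(** * Trigonometric test functions *)

(* A triple [(c, t, e)] stands for the function [c * cos (t * y + e)]. *)
Fixpoint tval (P : list (R * R * R)) (y : R) : R :=
  match P with
  | [] => 0
  | (c, t, e) :: Q => c * cos (t * y + e) + tval Q y
  end.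

Fixpoint tnorm (P : list (R * R * R)) : R :=
  match P with [] => 0 | (c, _, _) :: Q => Rabs c + tnorm Q end.

(* Mean of [tval P] under a symmetric law with characteristic function [g]. *)
Fixpoint tmean (g : R -> R) (P : list (R * R * R)) : R :=
  match P with [] => 0 | (c, t, e) :: Q => c * (g t * cos e) + tmean g Q end.

Definition tfreq (T : R) (P : list (R * R * R)) : Prop :=
  List.Forall (fun p => Rabs (snd (fst p)) <= T) P.

Lemma tnorm_nonneg P : 0 <= tnorm P.
Proof. induction P as [|[[c t] e] P IH]; simpl; [lra|]. generalize (Rabs_pos c). lra. Qed.

Lemma cont_tval P X : cont X -> cont (fun x => tval P (X x)).
Proof. intros H. induction P as [|[[c t] e] P IH]; simpl; conti. Qed.

Lemma tfreq_mono T T' P : T <= T' -> tfreq T P -> tfreq T' P.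
Proof. intros H. apply List.Forall_impl. intros; lra. Qed.

Lemma tmean_bound g P : (forall t, Rabs (g t) <= 1) -> Rabs (tmean g P) <= tnorm P.
Proof.
  intros Hg. induction P as [|[[c t] e] P IH]; simpl; [rewrite Rabs_R0; lra|].
  eapply Rle_trans; [apply Rabs_triang|]. apply Rplus_le_compat; [|exact IH].
  rewrite !Rabs_mult. rewrite <- (Rmult_1_r (Rabs c)) at 2.
  apply Rmult_le_compat_l; [apply Rabs_pos|].
  assert (Rabs (cos e) <= 1) by apply Rabs_le, COS_bound.
  generalize (Hg t) (Rabs_pos (g t)) (Rabs_pos (cos e)). nra.
Qed.

Definition tmul_cos (t0 e0 : R) (P : list (R * R * R)) : list (R * R * R) :=
  flat_map (fun p => let '(c, t, e) := p in [(c / 2, t + t0, e + e0); (c / 2, t - t0, e - e0)]) P.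

Lemma tmul_cos_val t0 e0 P y : tval (tmul_cos t0 e0 P) y = tval P y * cos (t0 * y + e0).
Proof.
  induction P as [|[[c t] e] P IH]; simpl; [ring|]. fold (tmul_cos t0 e0 P). rewrite IH.
  replace ((t + t0) * y + (e + e0)) with ((t * y + e) + (t0 * y + e0)) by ring.
  replace ((t - t0) * y + (e - e0)) with ((t * y + e) - (t0 * y + e0)) by ring.
  rewrite (cos_plus (t * y + e)), (cos_minus (t * y + e)). field.
Qed.

Lemma tmul_cos_norm t0 e0 P : tnorm (tmul_cos t0 e0 P) = tnorm P.
Proof.
  induction P as [|[[c t] e] P IH]; simpl; [reflexivity|]. fold (tmul_cos t0 e0 P). rewrite IH.
  unfold Rdiv. rewrite Rabs_mult, (Rabs_pos_eq (/ 2)) by lra. field.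
Qed.

Lemma tmul_cos_freq t0 e0 T P : tfreq T P -> tfreq (T + Rabs t0) (tmul_cos t0 e0 P).
Proof.
  induction 1 as [|[[c t] e] P H HP IH]; simpl; [constructor|]. fold (tmul_cos t0 e0 P).
  simpl in H. constructor; simpl; [|constructor; simpl; [|exact IH]].
  - eapply Rle_trans; [apply Rabs_triang|]. lra.
  - unfold Rminus. eapply Rle_trans; [apply Rabs_triang|]. rewrite Rabs_Ropp. lra.
Qed.

(** Multiplication by a cosine halves the coefficients and doubles their number, so the norm does
    not grow with the power; only the frequencies do, linearly in [k]. *)
Lemma cos_pow_test t0 e0 k : exists P, (forall y, tval P y = cos (t0 * y + e0) ^ k) /\
  tnorm P <= 1 /\ tfreq (INR k * Rabs t0) P.
Proof.
  induction k as [|k (P & H1 & H2 & H3)].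
  - exists [(1, 0, 0)]. split; [|split].
    + intros y. simpl. rewrite Rmult_0_l, Rplus_0_l, cos_0. ring.
    + simpl. rewrite Rabs_R1. lra.
    + constructor; [|constructor]. simpl. rewrite Rabs_R0. lra.
  - exists (tmul_cos t0 e0 P). split; [|split].
    + intros y. rewrite tmul_cos_val, H1. simpl. ring.
    + now rewrite tmul_cos_norm.
    + rewrite S_INR. replace ((INR k + 1) * Rabs t0) with (INR k * Rabs t0 + Rabs t0) by ring.
      now apply tmul_cos_freq.
Qed.

Lemma test_mean g X T kappa P : cont X ->
  (forall t e, Rabs t <= T -> Rabs (E (fun x => cos (t * X x + e)) - g t * cos e) <= kappa) ->
  tfreq T P -> Rabs (E (fun x => tval P (X x)) - tmean g P) <= tnorm P * kappa.
Proof.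
  intros cX H. induction 1 as [|[[c t] e] P Ht HP IH]; simpl.
  - rewrite E_const, Rminus_0_r, Rabs_R0. lra.
  - assert (cP := cont_tval P X cX). rewrite E_plus by conti. rewrite E_scal by conti.
    replace (c * E (fun x => cos (t * X x + e)) + E (fun x => tval P (X x)) - (c * (g t * cos e) + tmean g P))
      with (c * (E (fun x => cos (t * X x + e)) - g t * cos e) + (E (fun x => tval P (X x)) - tmean g P)) by ring.
    eapply Rle_trans; [apply Rabs_triang|]. rewrite Rabs_mult, Rmult_plus_distr_r.
    apply Rplus_le_compat; [|exact IH]. apply Rmult_le_compat_l; [apply Rabs_pos|]. apply H, Ht.
Qed.

(** By product-to-sum, the mean of a product of two cosines is half the sum of joint means at
    [(t, u)] and [(t, - u)]; evenness of [g] lets the main terms recombine into a product. *)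
Lemma test_mean2 g X Y T kappa P Q : cont X -> cont Y -> 0 <= kappa -> (forall u, g (- u) = g u) ->
  (forall t u e, Rabs t <= T -> Rabs u <= T ->
     Rabs (E (fun x => cos (t * X x + u * Y x + e)) - g t * g u * cos e) <= kappa) ->
  tfreq T P -> tfreq T Q ->
  Rabs (E (fun x => tval P (X x) * tval Q (Y x)) - tmean g P * tmean g Q) <= tnorm P * tnorm Q * kappa.
Proof.
  intros cX cY Hk Hg H HP HQ.
  assert (H1 : forall t e, Rabs t <= T ->
    Rabs (E (fun x => cos (t * X x + e) * tval Q (Y x)) - g t * cos e * tmean g Q) <= tnorm Q * kappa).
  { intros t e Ht. induction HQ as [|[[c u] e'] Q Hu HQ IH]; simpl.
    - rewrite (E_ext _ (fun _ => 0)) by (intros; ring). rewrite E_const, Rmult_0_r, Rminus_0_r, Rabs_R0. lra.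
    - simpl in Hu. assert (cQ := cont_tval Q Y cY).
      rewrite (E_ext _ (fun x => c / 2 * cos (t * X x + u * Y x + (e + e')) +
        (c / 2 * cos (t * X x + (- u) * Y x + (e - e')) + cos (t * X x + e) * tval Q (Y x)))).
      2:{ intros x. replace (t * X x + u * Y x + (e + e')) with ((t * X x + e) + (u * Y x + e')) by ring.
          replace (t * X x + - u * Y x + (e - e')) with ((t * X x + e) - (u * Y x + e')) by ring.
          rewrite (cos_plus (t * X x + e)), (cos_minus (t * X x + e)). field. }
      rewrite !E_plus by conti. rewrite !E_scal by conti.
      assert (Ha := H t u (e + e') Ht Hu).
      assert (Hb := H t (- u) (e - e') Ht ltac:(now rewrite Rabs_Ropp)). rewrite Hg in Hb.
      rewrite cos_plus in Ha. rewrite cos_minus in Hb.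
      set (A := E (fun x => cos (t * X x + u * Y x + (e + e')))) in *.
      set (B := E (fun x => cos (t * X x + - u * Y x + (e - e')))) in *.
      set (D := E (fun x => cos (t * X x + e) * tval Q (Y x))) in *.
      match goal with |- Rabs ?z <= _ => replace z with
        (c / 2 * (A - g t * g u * (cos e * cos e' - sin e * sin e')) +
         c / 2 * (B - g t * g u * (cos e * cos e' + sin e * sin e')) + (D - g t * cos e * tmean g Q)) by field end.
      eapply Rle_trans; [apply Rabs_triang|]. rewrite Rmult_plus_distr_r.
      apply Rplus_le_compat; [|exact IH]. eapply Rle_trans; [apply Rabs_triang|].
      rewrite !Rabs_mult. unfold Rdiv. rewrite !Rabs_mult, (Rabs_pos_eq (/ 2)) by lra.
      generalize (Rabs_pos c). nra. }
  induction HP as [|[[c t] e] P Ht HP IH]; simpl.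
  - rewrite (E_ext _ (fun _ => 0)) by (intros; ring). rewrite E_const, Rmult_0_l, Rminus_0_r, Rabs_R0. lra.
  - simpl in Ht. assert (cQ := cont_tval Q Y cY). assert (cP := cont_tval P X cX).
    rewrite (E_ext _ (fun x => c * (cos (t * X x + e) * tval Q (Y x)) + tval P (X x) * tval Q (Y x)))
      by (intros; ring).
    rewrite E_plus by conti. rewrite E_scal by conti. specialize (H1 t e Ht).
    match goal with |- Rabs ?z <= _ => replace z with
      (c * (E (fun x => cos (t * X x + e) * tval Q (Y x)) - g t * cos e * tmean g Q) +
       (E (fun x => tval P (X x) * tval Q (Y x)) - tmean g P * tmean g Q)) by ring end.
    eapply Rle_trans; [apply Rabs_triang|].
    replace ((Rabs c + tnorm P) * tnorm Q * kappa) with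
      (Rabs c * (tnorm Q * kappa) + tnorm P * tnorm Q * kappa) by ring.
    apply Rplus_le_compat; [|exact IH]. rewrite Rabs_mult.
    apply Rmult_le_compat_l; [apply Rabs_pos|exact H1].
Qed.

Lemma exp_ge_1 y : 0 <= y -> 1 <= exp y.
Proof. intros H. generalize (exp_ineq1_le y). lra. Qed.

(** * The lower half of the law of the iterated logarithm *)

(** Diagonal terms are at most [E (f i)] because [f^2 <= f], and each off-diagonal covariance is at
    most [kappa]. So the variance is of the order of the mean when [kappa] is small. *)
Lemma second_moment (f : nat -> R -> R) kappa I : (forall i, cont (f i)) ->
  (forall i x, 0 <= f i x <= 1) -> 0 <= kappa ->
  (forall i j, (i < I)%nat -> (j < I)%nat -> i <> j ->
     E (fun x => f i x * f j x) <= E (f i) * E (f j) + kappa) ->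
  let m := rsum (fun i => E (f i)) I in
  E (fun x => (rsum (fun i => f i x) I - m) ^ 2) <= m + INR I ^ 2 * kappa.
Proof.
  intros cf Hf Hk H m.
  set (S := fun x => rsum (fun i => f i x) I). assert (cS : cont S) by (unfold S; conti).
  assert (HES : E S = m) by (unfold S, m; apply E_rsum, cf).
  rewrite (E_ext _ (fun x => S x ^ 2 + (-2 * m * S x + m ^ 2))) by (intros; fold (S x); ring).
  rewrite E_plus by conti. rewrite E_plus by conti. rewrite E_scal, E_const, HES by conti.
  assert (HS2 : forall x, S x ^ 2 = rsum (fun i => rsum (fun j => f i x * f j x) I) I).
  { intros x. rewrite (rsum_ext _ (fun i => S x * f i x)).
    - rewrite rsum_scal. fold (S x). ring.
    - intros i _. rewrite rsum_scal. fold (S x). ring. }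
  rewrite (E_ext _ _ HS2). rewrite E_rsum by (intros; conti).
  assert (Hm0 : forall i, 0 <= E (f i)) by (intros; apply E_nonneg; [apply cf|intros; apply Hf]).
  assert (Hle : rsum (fun i => E (fun x => rsum (fun j => f i x * f j x) I)) I <=
    rsum (fun i => E (f i) * m + (INR I * kappa + E (f i))) I).
  { apply rsum_le. intros i Hi. rewrite E_rsum by (intros; conti).
    apply Rle_trans with (rsum (fun j => E (f i) * E (f j) + (kappa + if Nat.eqb i j then E (f i) else 0)) I).
    - apply rsum_le. intros j Hj. destruct (Nat.eqb_spec i j) as [<-|Hij].
      + assert (E (fun x => f i x * f i x) <= E (f i)).
        { apply E_le; [apply cont_mult; apply cf|apply cf|]. intros x. generalize (Hf i x). nra. }
        generalize (Hm0 i). nra.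
      + rewrite Rplus_0_r. now apply H.
    - rewrite !rsum_plus, rsum_scal, rsum_const. fold m.
      assert (Hs := rsum_select_le i I (E (f i)) (Hm0 i)). lra. }
  rewrite !rsum_plus in Hle. rewrite rsum_const in Hle. fold m in Hle.
  rewrite (rsum_ext (fun i => E (f i) * m) (fun i => m * E (f i))) in Hle by (intros; ring).
  rewrite rsum_scal in Hle. fold m in Hle.
  replace (INR I ^ 2 * kappa) with (INR I * (INR I * kappa)) by ring. nra.
Qed.

(* Exponential tilting by [exp (b * X)] moves the mass of [X] to a neighbourhood of [b]. *)
Lemma tilting X b a eps k : cont X -> 0 < b -> 0 < a <= 1/2 -> 0 <= eps <= a ^ 2 / 8 -> 11 <= b ^ 2 * a ^ 2 ->
  exp ((1 - eps) * b ^ 2 / 2) <= E (fun x => exp (b * X x)) ->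
  (forall c, (c = b * (1 + a) \/ c = b * (1 - a)) -> E (fun x => exp (c * X x)) <= exp ((1 + eps) * c ^ 2 / 2)) ->
  / 2 * (cos (a / 2) ^ (2 * k) * exp (- (b ^ 2 / 2 * (1 + 2 * a + eps))))
    <= E (fun x => cos ((X x - b) / (2 * b)) ^ (2 * k)).
Proof.
  intros cX Hb Ha Heps Hba Hlow Hup.
  set (K := cos (a / 2) ^ (2 * k)).
  assert (Hca : 0 < cos (a / 2)) by (apply cos_gt_0; generalize PI2_1; lra).
  assert (HK : 0 < K) by now apply pow_lt.
  set (phi := fun x => cos ((X x - b) / (2 * b)) ^ (2 * k)).
  assert (cphi : cont phi) by (unfold phi; conti).
  assert (Hphi : forall x, 0 <= phi x) by (intros; unfold phi; rewrite pow_mult; apply pow_le, pow2_ge_0).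
  (* With these offsets the first tilted exponential dominates [exp (b X)] for [X >= b (1 + a)], the
     second for [X <= b (1 - a)]; in between the cosine power is at least [K]. *)
  set (u1 := a * b * b * (1 + a)). set (u2 := a * b * b * (1 - a)).
  assert (Hpt : forall x, exp (b * X x) - (exp (- u1) * exp (b * (1 + a) * X x) + exp u2 * exp (b * (1 - a) * X x))
    <= exp (b ^ 2 * (1 + a)) / K * phi x).
  { intros x. set (y := X x).
    assert (E1 : exp (- u1) * exp (b * (1 + a) * y) = exp (b * y) * exp (a * b * (y - b * (1 + a)))).
    { rewrite <- !exp_plus. f_equal. unfold u1. ring. }
    assert (E2 : exp u2 * exp (b * (1 - a) * y) = exp (b * y) * exp (- (a * b * (y - b * (1 - a))))).
    { rewrite <- !exp_plus. f_equal. unfold u2. ring. }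
    rewrite E1, E2.
    assert (P0 := exp_pos (b * y)). assert (P1 := exp_pos (a * b * (y - b * (1 + a)))).
    assert (P2 := exp_pos (- (a * b * (y - b * (1 - a))))).
    assert (P3 := exp_pos (b ^ 2 * (1 + a))). assert (Hphix := Hphi x).
    assert (Hrhs : 0 <= exp (b ^ 2 * (1 + a)) / K * phi x).
    { apply Rmult_le_pos; [apply Rdiv_le_0_compat; lra|exact Hphix]. }
    assert (Hab : 0 < a * b) by nra.
    assert (P4 := Rmult_lt_0_compat _ _ P0 P1). assert (P5 := Rmult_lt_0_compat _ _ P0 P2).
    destruct (Rle_dec (b * (1 + a)) y) as [H1|H1].
    { assert (H3 : 1 <= exp (a * b * (y - b * (1 + a)))).
      { apply exp_ge_1. apply Rmult_le_pos; lra. }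
      apply (Rmult_le_compat_l (exp (b * y))) in H3; lra. }
    destruct (Rle_dec y (b * (1 - a))) as [H2|H2].
    { assert (H3 : 1 <= exp (- (a * b * (y - b * (1 - a))))).
      { apply exp_ge_1. rewrite Ropp_mult_distr_r. apply Rmult_le_pos; lra. }
      apply (Rmult_le_compat_l (exp (b * y))) in H3; lra. }
    apply Rle_trans with (exp (b ^ 2 * (1 + a))).
    - assert (exp (b * y) <= exp (b ^ 2 * (1 + a))); [apply exp_le; nra|lra].
    - assert (HKphi : K <= phi x).
      { unfold K, phi. apply pow_incr. split; [lra|]. fold y.
        assert (Hz : Rabs ((y - b) / (2 * b)) <= a / 2).
        { unfold Rdiv at 1. rewrite Rabs_mult, (Rabs_pos_eq (/ (2 * b))) by (left; apply Rinv_0_lt_compat; lra).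
          apply Rmult_le_reg_r with (2 * b); [lra|]. rewrite Rmult_assoc, Rinv_l by lra.
          rewrite Rmult_1_r. apply Rabs_le. lra. }
        assert (Hcz : cos ((y - b) / (2 * b)) = cos (Rabs ((y - b) / (2 * b)))).
        { unfold Rabs. destruct Rcase_abs; [now rewrite cos_neg|reflexivity]. }
        rewrite Hcz. apply cos_decr_1; try apply Rabs_pos; try (generalize PI2_1; lra); exact Hz. }
      apply Rmult_le_reg_r with K; [exact HK|].
      replace (exp (b ^ 2 * (1 + a)) / K * phi x * K) with (exp (b ^ 2 * (1 + a)) * phi x) by (field; lra).
      apply Rmult_le_compat_l; lra. }
  assert (HE : E (fun x => exp (b * X x) - (exp (- u1) * exp (b * (1 + a) * X x) + exp u2 * exp (b * (1 - a) * X x)))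
    <= exp (b ^ 2 * (1 + a)) / K * E phi).
  { rewrite <- E_scal by exact cphi. apply E_le; [conti|conti|exact Hpt]. }
  rewrite E_minus in HE by conti. rewrite E_plus in HE by conti. rewrite !E_scal in HE by conti.
  set (L := exp ((1 - eps) * b ^ 2 / 2)) in *. assert (HL : 0 < L) by apply exp_pos.
  (* From [11 <= b^2 a^2] and [3/16 * 11 > 2 >= ln 4]: each tail takes at most a quarter of [L], so
     half of [L] remains. *)
  assert (Hquarter : exp (- (3 / 16 * (b ^ 2 * a ^ 2))) <= / 4).
  { apply Rle_trans with (exp (- ln 4)).
    - apply exp_le. assert (ln 4 <= 2); [|lra]. rewrite <- (ln_exp 2). apply ln_le; [lra|].
      replace 2 with (1 + 1) by ring. rewrite exp_plus. generalize (exp_ineq1_le 1). nra.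
    - rewrite exp_Ropp, exp_ln by lra. lra. }
  assert (HA1 : exp (- u1) * E (fun x => exp (b * (1 + a) * X x)) <= L / 4).
  { apply Rle_trans with (exp (- u1) * exp ((1 + eps) * (b * (1 + a)) ^ 2 / 2)).
    - apply Rmult_le_compat_l; [left; apply exp_pos|]. apply Hup. now left.
    - rewrite <- exp_plus. apply Rle_trans with (exp ((1 - eps) * b ^ 2 / 2 + - (3 / 16 * (b ^ 2 * a ^ 2)))).
      + apply exp_le. unfold u1.
        assert (Hq : eps * (1 + a) ^ 2 <= a ^ 2 / 8 * (9 / 4)) by (apply Rmult_le_compat; nra).
        assert (Hc : (1 + eps) * (1 + a) ^ 2 / 2 - a * (1 + a) <= (1 - eps) / 2 - 3 / 16 * a ^ 2) by lra.
        apply (Rmult_le_compat_l (b ^ 2)) in Hc; [lra|apply pow2_ge_0].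
      + rewrite exp_plus. fold L. unfold Rdiv. apply Rmult_le_compat_l; lra. }
  assert (HA2 : exp u2 * E (fun x => exp (b * (1 - a) * X x)) <= L / 4).
  { apply Rle_trans with (exp u2 * exp ((1 + eps) * (b * (1 - a)) ^ 2 / 2)).
    - apply Rmult_le_compat_l; [left; apply exp_pos|]. apply Hup. now right.
    - rewrite <- exp_plus. apply Rle_trans with (exp ((1 - eps) * b ^ 2 / 2 + - (3 / 16 * (b ^ 2 * a ^ 2)))).
      + apply exp_le. unfold u2.
        assert (Hq : eps * (1 - a) ^ 2 <= a ^ 2 / 8 * (9 / 4)) by (apply Rmult_le_compat; nra).
        assert (Hc : (1 + eps) * (1 - a) ^ 2 / 2 + a * (1 - a) <= (1 - eps) / 2 - 3 / 16 * a ^ 2) by lra.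
        apply (Rmult_le_compat_l (b ^ 2)) in Hc; [lra|apply pow2_ge_0].
      + rewrite exp_plus. fold L. unfold Rdiv. apply Rmult_le_compat_l; lra. }
  assert (P3 := exp_pos (b ^ 2 * (1 + a))). set (W := exp (b ^ 2 * (1 + a))) in *.
  assert (HW : exp (- (b ^ 2 / 2 * (1 + 2 * a + eps))) * W = L).
  { unfold W, L. rewrite <- exp_plus. f_equal. field. }
  fold phi. apply Rmult_le_reg_r with (W / K); [apply Rdiv_lt_0_compat; lra|].
  replace (/ 2 * (K * exp (- (b ^ 2 / 2 * (1 + 2 * a + eps)))) * (W / K)) with
    (/ 2 * (exp (- (b ^ 2 / 2 * (1 + 2 * a + eps))) * W)) by (field; lra).
  rewrite HW. lra.
Qed.

(** Unlike [range_weight] it vanishes from [q] on, so that two increments fit into one [wsum] of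
    common length. *)
Definition rng (lam : R) (p q i : nat) : R := if andb (Nat.leb p i) (Nat.ltb i q) then lam else 0.

Lemma rng_range lam p q i : (i < q)%nat -> rng lam p q i = range_weight lam p i.
Proof.
  intros H. unfold rng, range_weight. replace (Nat.ltb i q) with true by (symmetry; now apply Nat.ltb_lt).
  now rewrite Bool.andb_true_r.
Qed.

Lemma rng_out lam p q i : (q <= i)%nat -> rng lam p q i = 0.
Proof.
  intros H. unfold rng. replace (Nat.ltb i q) with false by (symmetry; now apply Nat.ltb_ge).
  now rewrite Bool.andb_false_r.
Qed.

Lemma rng_le lam p q i : Rabs (rng lam p q i) <= Rabs lam.
Proof. unfold rng. destruct andb; [lra|]. rewrite Rabs_R0. apply Rabs_pos. Qed.

Lemma wsum_rng d lam p q N x : (p <= q)%nat -> (q <= N)%nat ->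
  wsum d (rng lam p q) N x = lam * (dsum d q x - dsum d p x).
Proof.
  intros H HN. rewrite <- wsum_range by exact H. unfold wsum.
  rewrite (rsum_supp _ q N HN) by (intros k Hk; rewrite rng_out by exact Hk; ring).
  apply rsum_ext. intros i Hi. now rewrite rng_range.
Qed.

Lemma wvar_rng lam p q N : (p <= q)%nat -> (q <= N)%nat ->
  wvar (rng lam p q) N = lam ^ 2 * INR (q - p).
Proof.
  intros H HN. rewrite <- wvar_range by exact H. unfold wvar.
  rewrite (rsum_supp _ q N HN) by (intros k Hk; rewrite rng_out by exact Hk; ring).
  apply rsum_ext. intros i Hi. now rewrite rng_range.
Qed.

Lemma rng_disjoint lam lam' p q p' q' i : (q <= p')%nat \/ (q' <= p)%nat ->
  rng lam p q i * rng lam' p' q' i = 0.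
Proof.
  intros H. unfold rng. destruct (andb (Nat.leb p i) (Nat.ltb i q)) eqn:H1; [|ring].
  destruct (andb (Nat.leb p' i) (Nat.ltb i q')) eqn:H2; [|ring].
  apply andb_prop in H1, H2. rewrite Nat.leb_le, Nat.ltb_lt in H1, H2. lia.
Qed.

Lemma char_phase Y G r e : cont Y ->
  Rabs (E (fun x => cos (Y x)) - G) <= r -> Rabs (E (fun x => sin (Y x))) <= r ->
  Rabs (E (fun x => cos (Y x + e)) - G * cos e) <= 2 * r.
Proof.
  intros cY H1 H2.
  rewrite (E_ext _ (fun x => cos e * cos (Y x) - sin e * sin (Y x))) by (intros; rewrite cos_plus; ring).
  rewrite E_minus, !E_scal by conti.
  replace (cos e * E (fun x => cos (Y x)) - sin e * E (fun x => sin (Y x)) - G * cos e) with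
    (cos e * (E (fun x => cos (Y x)) - G) + - (sin e * E (fun x => sin (Y x)))) by ring.
  eapply Rle_trans; [apply Rabs_triang|]. rewrite Rabs_Ropp, !Rabs_mult.
  assert (Rabs (cos e) <= 1) by apply Rabs_le, COS_bound.
  assert (Rabs (sin e) <= 1) by apply Rabs_le, SIN_bound.
  generalize (Rabs_pos (cos e)) (Rabs_pos (sin e)) (Rabs_pos (E (fun x => cos (Y x)) - G))
    (Rabs_pos (E (fun x => sin (Y x)))). nra.
Qed.

(** Variance one, because [bscale] doubles the variance [1/2] of the cosines; the central limit
    theorem below uses [half_char] for variance [1/2]. *)
Definition gauss_char (t : R) : R := exp (- (t ^ 2 / 2)).

Section Lower.

Context (d : nat -> R -> R) (Hd : quasi_gaussian d) (theta : nat) (Htheta : (2 <= theta)%nat).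

Let cd : forall i, cont (d i) := qg_cont d Hd.

Definition bsize (j : nat) : nat := (theta ^ S j - theta ^ j)%nat.
Definition bscale (j : nat) : R := sqrt (2 / INR (bsize j)).
Definition bsum (j : nat) (x : R) : R := bscale j * (dsum d (theta ^ S j) x - dsum d (theta ^ j) x).

Lemma theta_pow_le i j : (i <= j)%nat -> (theta ^ i <= theta ^ j)%nat.
Proof. intros. apply Nat.pow_le_mono_r; lia. Qed.

Lemma bsize_ge j : 2 ^ j <= INR (bsize j).
Proof.
  rewrite <- INR_pow2. apply le_INR. unfold bsize. rewrite Nat.pow_succ_r'.
  assert (2 ^ j <= theta ^ j)%nat by (apply Nat.pow_le_mono_l; lia).
  assert (2 * theta ^ j <= theta * theta ^ j)%nat by (apply Nat.mul_le_mono_r; lia).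
  set (y := (theta ^ j)%nat) in *. lia.
Qed.

Lemma bsize_pos j : 0 < INR (bsize j).
Proof. eapply Rlt_le_trans; [|apply bsize_ge]. apply pow_lt. lra. Qed.

Lemma bscale_sqr j : bscale j ^ 2 * INR (bsize j) = 2.
Proof.
  assert (H := bsize_pos j). unfold bscale. rewrite pow2_sqrt by (apply Rdiv_le_0_compat; lra). field. lra.
Qed.

Lemma bscale_sqr_le I j : (I <= j)%nat -> bscale j ^ 2 <= 2 / 2 ^ I.
Proof.
  intros H. unfold bscale. rewrite pow2_sqrt by (apply Rdiv_le_0_compat; [lra|apply bsize_pos]).
  unfold Rdiv. apply Rmult_le_compat_l; [lra|]. apply Rinv_le_contravar; [apply pow_lt; lra|].
  eapply Rle_trans; [|apply bsize_ge]. apply Rle_pow; [lra|exact H].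
Qed.

Lemma cont_bsum j : cont (bsum j).
Proof.
  assert (Hs : forall N, cont (dsum d N)) by (intros; apply cont_sum, cd). unfold bsum. conti.
Qed.

Lemma scaled_le t j I r : (I <= j)%nat -> 0 <= r -> 2 * t ^ 2 <= r ^ 2 * 2 ^ I -> Rabs (t * bscale j) <= r.
Proof.
  intros HI Hr H. assert (HP : 0 < 2 ^ I) by (apply pow_lt; lra).
  rewrite <- (Rabs_pos_eq r Hr). apply Rsqr_le_abs_0. rewrite !Rsqr_pow2, Rpow_mult_distr.
  assert (H1 := bscale_sqr_le I j HI). apply (Rmult_le_compat_l (t ^ 2)) in H1; [|apply pow2_ge_0].
  eapply Rle_trans; [exact H1|]. apply Rmult_le_reg_r with (2 ^ I); [exact HP|].
  replace (t ^ 2 * (2 / 2 ^ I) * 2 ^ I) with (2 * t ^ 2) by (field; lra). exact H.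
Qed.

Lemma bsum_mgf alpha eps mu j :
  (forall w N, (forall i, Rabs (w i) <= alpha) ->
    exp ((1 - eps) * wvar w N / 4) <= E (fun x => exp (wsum d w N x)) <= exp ((1 + eps) * wvar w N / 4)) ->
  Rabs (mu * bscale j) <= alpha ->
  exp ((1 - eps) * mu ^ 2 / 2) <= E (fun x => exp (mu * bsum j x)) <= exp ((1 + eps) * mu ^ 2 / 2).
Proof.
  intros H Hmu. assert (Hp : (theta ^ j <= theta ^ S j)%nat) by (apply theta_pow_le; lia).
  destruct (H (rng (mu * bscale j) (theta ^ j)%nat (theta ^ S j)%nat) (theta ^ S j)%nat) as [H1 H2].
  { intros i. eapply Rle_trans; [apply rng_le|exact Hmu]. }
  rewrite wvar_rng in H1, H2 by lia. fold (bsize j) in H1, H2.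
  replace ((mu * bscale j) ^ 2 * INR (bsize j)) with (mu ^ 2 * (bscale j ^ 2 * INR (bsize j))) in H1, H2 by ring.
  rewrite bscale_sqr in H1, H2.
  rewrite (E_ext _ (fun x => exp (mu * bsum j x))) in H1, H2
    by (intros x; f_equal; rewrite wsum_rng by lia; unfold bsum; ring).
  split; (eapply Rle_trans; [|eassumption]) || (eapply Rle_trans; [eassumption|]); right; f_equal; field.
Qed.

(** Two disjoint increments combine into one [wsum] with [wvar] equal to [2 t^2 + 2 u^2], so the
    estimate for single sums already gives the joint characteristic function. This stands in for
    independence of the blocks. *)
Lemma bsum_char C nu T : (0 < nu)%nat ->
  (forall w N, (forall i, Rabs (w i) <= / INR nu ^ 8) ->
    Rabs (E (fun x => cos (wsum d w N x)) - exp (- (wvar w N / 4))) <= C * (1 + wvar w N) / INR nu /\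
    Rabs (E (fun x => sin (wsum d w N x))) <= C * (1 + wvar w N) / INR nu) ->
  0 <= C -> forall i j t u e, i <> j -> Rabs t <= T -> Rabs u <= T ->
  Rabs (t * bscale i) <= / INR nu ^ 8 -> Rabs (u * bscale j) <= / INR nu ^ 8 ->
  Rabs (E (fun x => cos (t * bsum i x + u * bsum j x + e)) - gauss_char t * gauss_char u * cos e)
    <= 2 * (C * (1 + 4 * T ^ 2) / INR nu).
Proof.
  intros Hnu H HC i j t u e Hij Ht Hu Hti Huj.
  assert (HN : 0 < INR nu) by now apply lt_0_INR.
  assert (Hp : forall k, (theta ^ k <= theta ^ S k)%nat) by (intros; apply theta_pow_le; lia).
  set (w1 := rng (t * bscale i) (theta ^ i)%nat (theta ^ S i)%nat).
  set (w2 := rng (u * bscale j) (theta ^ j)%nat (theta ^ S j)%nat).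
  set (N := Nat.max (theta ^ S i) (theta ^ S j)).
  assert (Hdis : forall k, w1 k * w2 k = 0).
  { intros k. apply rng_disjoint. destruct (Nat.lt_gt_cases i j) as [Hc _]. destruct (Hc Hij) as [Hlt|Hlt].
    - left. apply theta_pow_le. lia.
    - right. apply theta_pow_le. lia. }
  set (w := fun k => w1 k + w2 k).
  assert (Hw : forall k, Rabs (w k) <= / INR nu ^ 8).
  { intros k. unfold w. specialize (Hdis k). apply Rmult_integral in Hdis.
    assert (H1 : Rabs (w1 k) <= / INR nu ^ 8) by (eapply Rle_trans; [apply rng_le|exact Hti]).
    assert (H2 : Rabs (w2 k) <= / INR nu ^ 8) by (eapply Rle_trans; [apply rng_le|exact Huj]).
    destruct Hdis as [-> | ->]; [rewrite Rplus_0_l|rewrite Rplus_0_r]; assumption. }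
  assert (Hv : wvar w N = 2 * t ^ 2 + 2 * u ^ 2).
  { assert (Hvs : wvar w N = wvar w1 N + wvar w2 N).
    { unfold wvar. rewrite <- rsum_plus. apply rsum_ext. intros k _. specialize (Hdis k). unfold w. nra. }
    rewrite Hvs. unfold w1, w2. rewrite !wvar_rng by (unfold N; try apply Hp; lia). fold (bsize i) (bsize j).
    replace ((t * bscale i) ^ 2 * INR (bsize i)) with (t ^ 2 * (bscale i ^ 2 * INR (bsize i))) by ring.
    replace ((u * bscale j) ^ 2 * INR (bsize j)) with (u ^ 2 * (bscale j ^ 2 * INR (bsize j))) by ring.
    rewrite !bscale_sqr. ring. }
  destruct (H w N Hw) as [Hc Hs].
  assert (Hws : forall x, wsum d w N x = t * bsum i x + u * bsum j x).
  { intros x. unfold w, wsum.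
    rewrite (rsum_ext _ (fun k => w1 k * d k x + w2 k * d k x)) by (intros; ring). rewrite rsum_plus.
    fold (wsum d w1 N x) (wsum d w2 N x). unfold w1, w2.
    rewrite !wsum_rng by (unfold N; try apply Hp; lia). unfold bsum. ring. }
  assert (HG : exp (- (wvar w N / 4)) = gauss_char t * gauss_char u).
  { rewrite Hv. unfold gauss_char. rewrite <- exp_plus. f_equal. field. }
  rewrite HG in Hc.
  assert (Hr : C * (1 + wvar w N) / INR nu <= C * (1 + 4 * T ^ 2) / INR nu).
  { unfold Rdiv. apply Rmult_le_compat_r; [left; now apply Rinv_0_lt_compat|].
    apply Rmult_le_compat_l; [exact HC|]. rewrite Hv.
    assert (t ^ 2 <= T ^ 2) by (rewrite <- (pow2_abs t); apply pow_incr; split; [apply Rabs_pos|exact Ht]).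
    assert (u ^ 2 <= T ^ 2) by (rewrite <- (pow2_abs u); apply pow_incr; split; [apply Rabs_pos|exact Hu]).
    lra. }
  rewrite (E_ext _ (fun x => cos (wsum d w N x + e))) by (intros x; now rewrite Hws).
  apply char_phase; [apply cont_wsum, cd| |]; lra.
Qed.

(** * Test functions on the window of blocks from [I] to [2 I] *)

Section Window.

Context (delta : R) (Hdelta : 0 < delta <= 1/4).

Let l (I : nat) : R := ln (INR I).
Definition level (I : nat) : R := (1 - delta) * sqrt (2 * l I).
(** Dictated by [detector_bad]: when the block sum is a relative [delta] below the level, the
    squared cosine is at most [exp (- delta^2 / 8)], and its [M]-th power must not exceed
    [/ INR I]. *)
Let M (I : nat) : nat := Z.to_nat (up (8 * l I / delta ^ 2)).
Let f (I m : nat) (x : R) : R := cos ((bsum (I + m) x - level I) / (2 * level I)) ^ (2 * M I).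
Let mean (I : nat) : R := rsum (fun m => E (f I m)) I.
(** The first term reaches 1 when the sum of the tests misses its mean by half of it. The periodic
    test would rise again for very negative block sums; the second term reaches 1 once a block sum
    is at most [- 2 * level I]. *)
Definition detector (I : nat) (x : R) : R :=
  4 / mean I ^ 2 * (rsum (fun m => f I m x) I - mean I) ^ 2 +
  rsum (fun m => exp (- (2 * level I) * bsum (I + m) x - 4 * level I ^ 2)) I.

Lemma cont_f I m : cont (f I m).
Proof. assert (H := cont_bsum). unfold f. conti. Qed.

Lemma f_bounds I m x : 0 <= f I m x <= 1.
Proof.
  unfold f. rewrite pow_mult. split; [apply pow_le, pow2_ge_0|].
  rewrite <- (pow1 (M I)). apply pow_incr. split; [apply pow2_ge_0|].
  rewrite <- pow2_abs. rewrite <- (pow1 2). apply pow_incr. split; [apply Rabs_pos|apply Rabs_le, COS_bound].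
Qed.

Lemma cont_detector I : cont (detector I).
Proof.
  assert (H := cont_bsum). assert (H1 := cont_f). unfold detector.
  apply cont_plus.
  - apply cont_mult; [conti|]. apply cont_pow, cont_minus; [|conti]. apply cont_rsum. intros; apply H1.
  - conti.
Qed.

Lemma detector_nonneg I x : 0 <= detector I x.
Proof.
  unfold detector. apply Rplus_le_le_0_compat.
  - apply Rmult_le_pos; [|apply pow2_ge_0]. unfold Rdiv. apply Rmult_le_pos; [lra|].
    destruct (Req_dec (mean I ^ 2) 0) as [H|H]; [rewrite H, Rinv_0; lra|].
    left. apply Rinv_0_lt_compat. generalize (pow2_ge_0 (mean I)). lra.
  - apply rsum_nonneg. intros. left. apply exp_pos.
Qed.

Lemma M_bounds I : 0 <= l I -> 8 * l I / delta ^ 2 <= INR (M I) <= 8 * l I / delta ^ 2 + 1.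
Proof.
  intros Hl. assert (Hr : 0 <= 8 * l I / delta ^ 2) by (apply Rdiv_le_0_compat; [lra|apply pow_lt; lra]).
  destruct (archimed (8 * l I / delta ^ 2)) as [H1 H2]. unfold M.
  rewrite INR_IZR_INZ, Z2Nat.id by (apply le_IZR; lra). lra.
Qed.

Lemma level_sqr I : 0 <= l I -> level I ^ 2 = 2 * (1 - delta) ^ 2 * l I.
Proof. intros Hl. unfold level. rewrite Rpow_mult_distr, pow2_sqrt by lra. ring. Qed.

Lemma level_ge1 I : 1 <= l I -> 1 <= level I.
Proof.
  intros Hl. assert (H := level_sqr I ltac:(lra)).
  assert (0 <= level I) by (unfold level; apply Rmult_le_pos; [lra|apply sqrt_pos]).
  assert (9/16 <= (1 - delta) ^ 2) by nra. nra.
Qed.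

Lemma cos_sqr_upper a : 0 < a <= 1/2 -> cos (a / 2) ^ 2 <= exp (- (a ^ 2 / 8)).
Proof.
  intros Ha. apply Rle_trans with (1 - a ^ 2 / 8); [|generalize (exp_ineq1_le (- (a ^ 2 / 8))); lra].
  generalize (sin2_cos2 (a / 2)). rewrite !Rsqr_pow2. intros H.
  destruct (sin_taylor (a / 2)) as [H1 _]; [lra|].
  assert (0.4 * a <= a / 2 - (a / 2) ^ 3 / 6) by nra. nra.
Qed.

Lemma cos_sqr_lower a : 0 < a <= 1/2 -> exp (- (a ^ 2 / 2)) <= cos (a / 2) ^ 2.
Proof.
  intros Ha. generalize (sin2_cos2 (a / 2)). rewrite !Rsqr_pow2. intros H.
  destruct (sin_taylor (a / 2)) as [H1 H2]; [lra|].
  assert (0 <= sin (a / 2)).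
  { assert (0 <= a / 2 - (a / 2) ^ 3 / 6) by nra. lra. }
  assert (H3 : 1 - (a / 2) ^ 2 <= cos (a / 2) ^ 2) by nra.
  eapply Rle_trans; [|exact H3]. destruct (exp_1minus ((a / 2) ^ 2)) as [H4 _]; [nra|].
  eapply Rle_trans; [|exact H4]. apply exp_le. nra.
Qed.

Lemma exp_pow y k : exp y ^ k = exp (INR k * y).
Proof.
  rewrite pow_exp_ln by apply exp_pos. now rewrite ln_exp.
Qed.

(** If no block sum is below [- 2 * level I], the angles lie between [delta / 2] and [3/2 < PI / 2].
    Every test is then at most [/ INR I] and their sum at most 1, hence at most half of the mean. *)
Lemma detector_bad I x : (1 <= I)%nat -> 1 <= l I -> 2 <= mean I ->
  (forall j, (I <= j < 2 * I)%nat -> bsum j x < (1 - delta) * level I) -> 1 <= detector I x.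
Proof.
  intros HI Hl Hm Hbad. destruct (Rle_dec 1 (detector I x)) as [H|H]; [exact H|exfalso].
  apply Rnot_le_lt in H. unfold detector in H.
  assert (Hb := level_ge1 I Hl). set (b := level I) in *.
  set (Q := 4 / mean I ^ 2 * (rsum (fun m => f I m x) I - mean I) ^ 2) in *.
  assert (HQ : 0 <= Q).
  { unfold Q. apply Rmult_le_pos; [|apply pow2_ge_0]. apply Rdiv_le_0_compat; [lra|]. apply pow_lt. lra. }
  assert (Hlow : forall m, (m < I)%nat -> - (2 * b) < bsum (I + m) x).
  { intros m Hmi.
    assert (H1 : exp (- (2 * b) * bsum (I + m) x - 4 * b ^ 2) < 1).
    { eapply Rle_lt_trans; [|exact H].
      assert (Ht := rsum_term (fun m => exp (- (2 * b) * bsum (I + m) x - 4 * b ^ 2)) I m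
        (fun i => Rlt_le _ _ (exp_pos _)) Hmi). cbv beta in Ht. lra. }
    apply exp_lt_1 in H1. nra. }
  assert (Hf : forall m, (m < I)%nat -> f I m x <= / INR I).
  { intros m Hmi. specialize (Hlow m Hmi). specialize (Hbad (I + m)%nat ltac:(lia)). unfold f. fold b.
    set (y := bsum (I + m) x) in *.
    set (z := (b - y) / (2 * b)).
    replace ((y - b) / (2 * b)) with (- z) by (unfold z; field; lra). rewrite cos_neg.
    assert (Hz : delta / 2 <= z <= 3/2).
    { assert (Hz2 : z * (2 * b) = b - y) by (unfold z; field; lra).
      split; apply Rmult_le_reg_r with (2 * b); lra. }
    assert (Hcz : 0 <= cos z <= cos (delta / 2)).
    { split.
      - apply cos_ge_0; generalize PI2_3_2; lra.
      - apply cos_decr_1; generalize PI2_3_2 PI_RGT_0; lra. }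
    rewrite pow_mult. apply Rle_trans with (exp (- (delta ^ 2 / 8)) ^ M I).
    - apply pow_incr. split; [apply pow2_ge_0|]. eapply Rle_trans; [|apply cos_sqr_upper; lra].
      apply pow_incr. exact Hcz.
    - rewrite exp_pow. assert (HI0 : 0 < INR I) by (apply lt_0_INR; lia).
      rewrite <- (exp_ln (INR I)) by exact HI0. rewrite <- exp_Ropp. apply exp_le. fold (l I).
      destruct (M_bounds I) as [HM _]; [lra|].
      assert (8 * l I / delta ^ 2 * (delta ^ 2 / 8) <= INR (M I) * (delta ^ 2 / 8)).
      { apply Rmult_le_compat_r; [|exact HM]. generalize (pow2_ge_0 delta). lra. }
      replace (8 * l I / delta ^ 2 * (delta ^ 2 / 8)) with (l I) in H0 by (field; lra). lra. }
  assert (Hsum : rsum (fun m => f I m x) I <= 1).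
  { eapply Rle_trans; [apply (rsum_le _ (fun _ => / INR I)); exact Hf|].
    rewrite rsum_const, Rinv_r; [lra|]. apply not_0_INR. lia. }
  assert (HR : 0 <= rsum (fun m => exp (- (2 * b) * bsum (I + m) x - 4 * b ^ 2)) I)
    by (apply rsum_nonneg; intros; left; apply exp_pos).
  assert (1 <= Q); [|lra]. unfold Q.
  apply Rmult_le_reg_r with (mean I ^ 2); [apply pow_lt; lra|].
  replace (4 / mean I ^ 2 * (rsum (fun m => f I m x) I - mean I) ^ 2 * mean I ^ 2) with
    ((2 * (mean I - rsum (fun m => f I m x) I)) ^ 2) by (field; lra).
  rewrite Rmult_1_l. apply pow_incr. lra.
Qed.

(** Relative half-width of the tilting window, so small that [2 a + eps <= delta^2 / 2]; [eps] is
    the largest error that [tilting] admits for this [a]. *)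
Let a : R := delta ^ 2 / 8.
Let eps : R := a ^ 2 / 8.

Lemma a_eps_bounds : 0 < a <= 1/2 /\ 0 < eps <= 1/4 /\ eps <= delta ^ 2 / 4.
Proof.
  assert (Hd2 : 0 < delta ^ 2 <= 1/16) by (split; [apply pow_lt; lra|nra]).
  unfold eps, a. set (D := delta ^ 2) in *. repeat split; nra.
Qed.

Section Means.

Context (alpha : R) (I : nat)
  (Hmgf : forall w N, (forall i, Rabs (w i) <= alpha) ->
    exp ((1 - eps) * wvar w N / 4) <= E (fun x => exp (wsum d w N x)) <= exp ((1 + eps) * wvar w N / 4))
  (Halpha : 0 < alpha) (HI : (2 <= I)%nat) (Hl1 : 1 <= l I) (Hl2 : 11 / a ^ 2 <= l I)
  (Hbig : 16 * INR I <= alpha ^ 2 * 2 ^ I).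

Lemma I_pos : 0 < INR I.
Proof. apply lt_0_INR. lia. Qed.

Lemma tilt_ok c j : (I <= j)%nat -> Rabs c <= 2 * level I -> Rabs (c * bscale j) <= alpha.
Proof.
  intros Hj Hc. apply scaled_le with I; [exact Hj|lra|].
  eapply Rle_trans; [|exact Hbig].
  assert (H2 : c ^ 2 <= (2 * level I) ^ 2).
  { rewrite <- (pow2_abs c). apply pow_incr. split; [apply Rabs_pos|exact Hc]. }
  rewrite Rpow_mult_distr, level_sqr in H2 by lra.
  assert (l I <= INR I) by (apply ln_le_self, I_pos).
  assert (0 <= (1 - delta) ^ 2 <= 1) by nra. nra.
Qed.

(** Tilting costs [exp (- b^2/2 (1 + 2a + eps))] with [b^2 / 2 = (1 - delta)^2 l I], and the cosine
    power another [exp (- l I delta^2 / 16 - 1)]. Each mean is thus at least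
    [I ^ (delta/2 - 1) / 6], and [I] of them are summed. The 6 is the 2 of [tilting] times 3 for
    [exp 1]. *)
Lemma mean_lower : exp (delta / 2 * l I) / 6 <= mean I.
Proof.
  destruct a_eps_bounds as (Ha & He & He2).
  assert (Hb := level_ge1 I Hl1). assert (Hb2 := level_sqr I ltac:(lra)). set (b := level I) in *.
  apply Rle_trans with (rsum (fun _ => exp (- ((1 - delta / 2) * l I)) / 6) I).
  - rewrite rsum_const. assert (HI0 : INR I = exp (l I)) by (symmetry; apply exp_ln, I_pos).
    rewrite HI0. right.
    replace (exp (delta / 2 * l I)) with (exp (l I) * exp (- ((1 - delta / 2) * l I))); [field|].
    rewrite <- exp_plus. f_equal. field.
  - apply rsum_le. intros m Hm.
    assert (Hj : (I <= I + m)%nat) by lia.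
    eapply Rle_trans; [|apply (tilting (bsum (I + m)) b a eps (M I))].
    + assert (Hcos : exp (- (l I * delta ^ 2 / 16) - 1) <= cos (a / 2) ^ (2 * M I)).
      { rewrite pow_mult. apply Rle_trans with (exp (- (a ^ 2 / 2)) ^ M I).
        - rewrite exp_pow. apply exp_le. destruct (M_bounds I) as [_ HM]; [lra|].
          assert (H1 : INR (M I) * (a ^ 2 / 2) <= (8 * l I / delta ^ 2 + 1) * (a ^ 2 / 2)).
          { apply Rmult_le_compat_r; [nra|exact HM]. }
          assert (H2 : 8 * l I / delta ^ 2 * (a ^ 2 / 2) = l I * delta ^ 2 / 16) by (unfold a; field; lra).
          assert (a ^ 2 / 2 <= 1) by nra. lra.
        - apply pow_incr. split; [left; apply exp_pos|now apply cos_sqr_lower]. }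
      assert (He3 : 1 <= 3 * exp (Ropp 1)).
      { rewrite exp_Ropp. apply Rmult_le_reg_r with (exp 1); [apply exp_pos|].
        rewrite Rmult_assoc, Rinv_l by (apply Rgt_not_eq, exp_pos). generalize exp_le_3; lra. }
      assert (Hexp : exp (- ((1 - delta / 2) * l I)) <=
        exp (- (l I * delta ^ 2 / 16)) * exp (- (b ^ 2 / 2 * (1 + 2 * a + eps)))).
      { rewrite <- exp_plus. apply exp_le. rewrite Hb2.
        assert (Hc : (1 - delta) ^ 2 * (1 + 2 * a + eps) + delta ^ 2 / 16 <= 1 - delta / 2).
        { apply Rle_trans with ((1 - delta) ^ 2 * (1 + delta ^ 2 / 2) + delta ^ 2 / 16).
          - apply Rplus_le_compat_r, Rmult_le_compat_l; [apply pow2_ge_0|]. unfold a. lra.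
          - nra. }
        apply (Rmult_le_compat_r (l I)) in Hc; [|lra]. lra. }
      unfold Rminus in Hcos. rewrite exp_plus in Hcos.
      set (A1 := exp (- (l I * delta ^ 2 / 16))) in *.
      set (A2 := exp (- (b ^ 2 / 2 * (1 + 2 * a + eps)))) in *.
      assert (0 < A1) by apply exp_pos. assert (0 < A2) by apply exp_pos.
      assert (H3 : A1 * exp (Ropp 1) * A2 <= cos (a / 2) ^ (2 * M I) * A2) by (apply Rmult_le_compat_r; lra).
      assert (H4 : A1 * A2 * 1 <= A1 * A2 * (3 * exp (Ropp 1))) by (apply Rmult_le_compat_l; [nra|exact He3]).
      lra.
    + apply cont_bsum.
    + lra.
    + exact Ha.
    + split; [lra|right; reflexivity].
    + rewrite Hb2. apply Rle_trans with (l I * a ^ 2).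
      * apply Rmult_le_reg_r with (/ a ^ 2); [apply Rinv_0_lt_compat, pow_lt; lra|].
        rewrite Rmult_assoc, Rinv_r by (apply Rgt_not_eq, pow_lt; lra). unfold Rdiv in Hl2. lra.
      * apply Rmult_le_compat_r; [apply pow2_ge_0|].
        assert (9/16 <= (1 - delta) ^ 2) by nra. nra.
    + apply (bsum_mgf alpha eps b (I + m) Hmgf). apply tilt_ok; [exact Hj|]. fold b. rewrite Rabs_pos_eq; lra.
    + intros c Hc. apply (bsum_mgf alpha eps c (I + m) Hmgf). apply tilt_ok; [exact Hj|]. fold b.
      apply Rabs_le. destruct Hc as [-> | ->]; nra.
Qed.

(** The test has norm at most 1 and frequencies at most [M I <= T], so its means are read off from
    characteristic functions; the condition on [2 ^ I] makes the scaled weights at most [nu ^ -8].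
    One [kappa] is lost in the joint mean and one in each single mean, [3 kappa] in all. *)
Lemma decorrelation C nu T i j : (0 < nu)%nat -> 0 <= C ->
  (forall w N, (forall i, Rabs (w i) <= / INR nu ^ 8) ->
    Rabs (E (fun x => cos (wsum d w N x)) - exp (- (wvar w N / 4))) <= C * (1 + wvar w N) / INR nu /\
    Rabs (E (fun x => sin (wsum d w N x))) <= C * (1 + wvar w N) / INR nu) ->
  INR (M I) <= T -> 2 * T ^ 2 * INR nu ^ 16 <= 2 ^ I -> i <> j ->
  E (fun x => f I i x * f I j x) <= E (f I i) * E (f I j) + 6 * (C * (1 + 4 * T ^ 2) / INR nu).
Proof.
  intros Hnu HC Hchar HMT HT Hij.
  assert (HN : 0 < INR nu) by now apply lt_0_INR.
  assert (Hb := level_ge1 I Hl1). set (b := level I) in *.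
  set (kappa := 2 * (C * (1 + 4 * T ^ 2) / INR nu)).
  assert (Hk : 0 <= kappa).
  { unfold kappa. apply Rmult_le_pos; [lra|]. apply Rdiv_le_0_compat; [|lra].
    apply Rmult_le_pos; [exact HC|]. generalize (pow2_ge_0 T); lra. }
  destruct (cos_pow_test (/ (2 * b)) (- (1/2)) (2 * M I)) as (P & HP & HPn & HPf).
  assert (HfP : forall m x, f I m x = tval P (bsum (I + m) x)).
  { intros m x. rewrite HP. unfold f. fold b. f_equal. f_equal. field. lra. }
  assert (HPT : tfreq T P).
  { apply tfreq_mono with (2 := HPf). rewrite Rabs_pos_eq by (left; apply Rinv_0_lt_compat; lra).
    rewrite mult_INR. replace (INR 2 * INR (M I) * / (2 * b)) with (INR (M I) / b) by (simpl; field; lra).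
    apply Rle_trans with (INR (M I)); [|exact HMT].
    apply Rmult_le_reg_r with b; [lra|]. unfold Rdiv. rewrite Rmult_assoc, Rinv_l by lra.
    generalize (pos_INR (M I)). nra. }
  assert (Hsc : forall t m, Rabs t <= T -> Rabs (t * bscale (I + m)) <= / INR nu ^ 8).
  { intros t m Ht. apply scaled_le with I; [lia|left; apply Rinv_0_lt_compat, pow_lt, HN|].
    apply Rmult_le_reg_l with (INR nu ^ 16); [apply pow_lt, HN|].
    replace (INR nu ^ 16 * ((/ INR nu ^ 8) ^ 2 * 2 ^ I)) with (2 ^ I) by (field; lra).
    eapply Rle_trans; [|exact HT].
    assert (t ^ 2 <= T ^ 2) by (rewrite <- (pow2_abs t); apply pow_incr; split; [apply Rabs_pos|exact Ht]).
    assert (0 <= INR nu ^ 16) by (apply pow_le; lra).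
    replace (2 * T ^ 2 * INR nu ^ 16) with (INR nu ^ 16 * (2 * T ^ 2)) by ring.
    apply Rmult_le_compat_l; lra. }
  assert (HT0 : 0 <= T) by (generalize (pos_INR (M I)); lra).
  assert (H2 : forall t u e, Rabs t <= T -> Rabs u <= T ->
    Rabs (E (fun x => cos (t * bsum (I + i) x + u * bsum (I + j) x + e)) - gauss_char t * gauss_char u * cos e) <= kappa).
  { intros t u e Ht Hu. apply (bsum_char C nu T Hnu Hchar HC); auto. lia. }
  (* Single means come from the joint estimate with weight 0 on a second block [m']. *)
  assert (H1 : forall m m' t e, m <> m' -> Rabs t <= T ->
    Rabs (E (fun x => cos (t * bsum (I + m) x + e)) - gauss_char t * cos e) <= kappa).
  { intros m m' t e Hm Ht.
    assert (H := bsum_char C nu T Hnu Hchar HC (I + m) (I + m') t 0 e ltac:(lia) Ht ltac:(rewrite Rabs_R0; exact HT0)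
      (Hsc t m Ht) (Hsc 0 m' ltac:(rewrite Rabs_R0; exact HT0))).
    assert (Hg0 : gauss_char 0 = 1).
    { unfold gauss_char. replace (- (0 ^ 2 / 2)) with 0 by field. apply exp_0. }
    rewrite Hg0, Rmult_1_r in H.
    rewrite (E_ext _ (fun x => cos (t * bsum (I + m) x + e))) in H by (intros; f_equal; ring). exact H. }
  set (g := tmean gauss_char P).
  assert (Hg1 : Rabs g <= 1).
  { eapply Rle_trans; [apply tmean_bound|exact HPn]. intros t. unfold gauss_char.
    rewrite Rabs_pos_eq by (left; apply exp_pos). rewrite <- exp_0. apply exp_le.
    generalize (pow2_ge_0 t). lra. }
  assert (HP0 := tnorm_nonneg P).
  assert (HEm : forall m m', m <> m' -> Rabs (E (f I m) - g) <= kappa).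
  { intros m m' Hm. rewrite (E_ext _ _ (HfP m)).
    eapply Rle_trans; [apply (test_mean gauss_char (bsum (I + m)) T kappa P)|nra].
    - apply cont_bsum.
    - intros t e Ht. apply (H1 m m'); assumption.
    - exact HPT. }
  assert (HE2 : Rabs (E (fun x => f I i x * f I j x) - g * g) <= kappa).
  { rewrite (E_ext _ (fun x => tval P (bsum (I + i) x) * tval P (bsum (I + j) x))) by (intros; now rewrite !HfP).
    eapply Rle_trans; [apply (test_mean2 gauss_char (bsum (I + i)) (bsum (I + j)) T kappa P P)|].
    - apply cont_bsum.
    - apply cont_bsum.
    - exact Hk.
    - intros u. unfold gauss_char. f_equal. field.
    - exact H2.
    - exact HPT.
    - exact HPT.
    - assert (tnorm P * tnorm P <= 1) by nra. nra. }
  assert (Hi := HEm i j Hij). assert (Hj := HEm j i (not_eq_sym Hij)).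
  assert (Hfi : 0 <= E (f I i) <= 1).
  { apply E_between; [apply cont_f|apply f_bounds]. }
  set (x := E (f I i)) in *. set (y := E (f I j)) in *.
  apply Rabs_le_between in Hi, Hj, HE2, Hg1.
  replace (6 * (C * (1 + 4 * T ^ 2) / INR nu)) with (3 * kappa) by (unfold kappa; ring).
  assert (Hxy : g * g - x * y <= 2 * kappa).
  { replace (g * g - x * y) with (g * (g - x) + x * (g - y)) by ring.
    assert (g * (g - x) <= kappa) by (destruct (Rle_dec 0 g); nra). nra. }
  lra.
Qed.

(** [second_moment] bounds the first part. Each term of the second is an exponential moment at tilt
    [- 2 b], at most [exp (- 3/2 l I)], and there are [I = exp (l I)] of them. *)
Lemma detector_mean kappa : 0 <= kappa -> 2 <= mean I ->
  (forall i j, i <> j -> E (fun x => f I i x * f I j x) <= E (f I i) * E (f I j) + kappa) ->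
  E (detector I) <= 4 / mean I + INR I ^ 2 * kappa + exp (- (l I / 2)).
Proof.
  intros Hk Hm H. destruct a_eps_bounds as (Ha & He & He2).
  assert (cb := cont_bsum). assert (cf := cont_f I).
  assert (Hb := level_ge1 I Hl1). assert (Hb2 := level_sqr I ltac:(lra)).
  unfold detector. set (b := level I) in *.
  assert (cS : cont (fun x => (rsum (fun m => f I m x) I - mean I) ^ 2)) by conti.
  assert (cE : forall m, cont (fun x => exp (- (2 * b) * bsum (I + m) x - 4 * b ^ 2))) by (intros; conti).
  rewrite E_plus; [|apply cont_mult; [apply cont_const|exact cS]|apply cont_rsum; exact cE].
  rewrite E_scal by exact cS. rewrite E_rsum by exact cE.
  apply Rplus_le_compat.
  - assert (Hs := second_moment (f I) kappa I cf (f_bounds I) Hk (fun i j _ _ => H i j)). cbv zeta in Hs.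
    change (rsum (fun i => E (f I i)) I) with (mean I) in Hs.
    assert (H4 : 0 < 4 / mean I ^ 2 <= 1).
    { split; [apply Rdiv_lt_0_compat; [lra|apply pow_lt; lra]|].
      apply Rmult_le_reg_r with (mean I ^ 2); [apply pow_lt; lra|]. unfold Rdiv.
      rewrite Rmult_assoc, Rinv_l by (apply Rgt_not_eq, pow_lt; lra). nra. }
    apply Rle_trans with (4 / mean I ^ 2 * (mean I + INR I ^ 2 * kappa)); [apply Rmult_le_compat_l; lra|].
    rewrite Rmult_plus_distr_l.
    replace (4 / mean I ^ 2 * mean I) with (4 / mean I) by (field; lra).
    apply Rplus_le_compat_l. assert (0 <= INR I ^ 2 * kappa) by (apply Rmult_le_pos; [apply pow2_ge_0|exact Hk]).
    rewrite <- (Rmult_1_l (INR I ^ 2 * kappa)) at 2. apply Rmult_le_compat_r; lra.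
  - apply Rle_trans with (rsum (fun _ => exp (- (3/2 * l I))) I).
    + apply rsum_le. intros m _.
      rewrite (E_ext _ (fun x => exp (- (4 * b ^ 2)) * exp (- (2 * b) * bsum (I + m) x)))
        by (intros; rewrite <- exp_plus; f_equal; ring).
      rewrite (E_scal (exp (- (4 * b ^ 2))) (fun x => exp (- (2 * b) * bsum (I + m) x)))
        by (apply cont_expf, cont_mult; [apply cont_const|apply cb]).
      assert (Hc : Rabs (- (2 * b) * bscale (I + m)) <= alpha).
      { apply tilt_ok; [lia|]. rewrite Rabs_Ropp, Rabs_pos_eq; fold b; lra. }
      destruct (bsum_mgf alpha eps (- (2 * b)) (I + m) Hmgf Hc) as [_ H1].
      apply Rle_trans with (exp (- (4 * b ^ 2)) * exp ((1 + eps) * (- (2 * b)) ^ 2 / 2)).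
      * apply Rmult_le_compat_l; [left; apply exp_pos|exact H1].
      * rewrite <- exp_plus. apply exp_le.
        replace (- (4 * b ^ 2) + (1 + eps) * (- (2 * b)) ^ 2 / 2) with (- (2 * (1 - eps) * b ^ 2)) by field.
        rewrite Hb2. assert (9/16 <= (1 - delta) ^ 2) by nra.
        assert (3/4 * (9/16) <= (1 - eps) * (1 - delta) ^ 2) by (apply Rmult_le_compat; lra). nra.
    + rewrite rsum_const. rewrite <- (exp_ln (INR I)) by apply I_pos. fold (l I).
      rewrite <- exp_plus. apply exp_le. lra.
Qed.

End Means.

(** It is enough that the mean of the detector tends to zero, as [null_eventually] needs no rate.
    With [nu = I ^ 5] and [T] of order [I], [kappa] is of order [I ^ -3], so [I ^ 2 * kappa] is of
    order [1 / I]. *)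
Lemma blocks_infinitely_often :
  lebesgue_null (fun x => 0 <= x <= 1 /\ exists J, forall I, (J <= I)%nat ->
    forall j, (I <= j < 2 * I)%nat -> bsum j x < (1 - delta) * level I).
Proof.
  destruct a_eps_bounds as (Ha & He & He2).
  destruct (qg_mgf d Hd eps) as (alpha & Halpha & Hmgf); [lra|].
  destruct (qg_char d Hd) as (C & HC & Hchar).
  assert (Hln2 : 0 < ln 2) by (generalize ln_lt_2; lra).
  destruct (poly_le_exp (16 / alpha ^ 2) 1 (ln 2) Hln2) as (X1 & HX1 & Hp1).
  (* For [T = 9 I / delta^2] and [nu = I^5] the quantity [2 T^2 nu^16] equals
     [162 / delta^4 * I^82], to be dominated by [2 ^ I]. *)
  destruct (poly_le_exp (162 / delta ^ 4) 82 (ln 2) Hln2) as (X2 & HX2 & Hp2).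
  destruct (INR_unbounded X1) as (I1 & HI1). destruct (INR_unbounded X2) as (I2 & HI2).
  destruct (ln_large 1) as (I3 & HI3' & HI3). destruct (ln_large (11 / a ^ 2)) as (I4 & _ & HI4).
  destruct (ln_large (8 / delta)) as (I5 & _ & HI5).
  set (I0 := (I1 + I2 + I3 + I4 + I5)%nat).
  assert (Hd4 : 0 < delta ^ 4) by (apply pow_lt; lra).
  assert (Hd2 : 0 < delta ^ 2 <= 1) by (split; [apply pow_lt; lra|nra]).
  assert (HI0 : forall I, (I0 <= I)%nat ->
    (2 <= I)%nat /\ 1 <= l I /\ 11 / a ^ 2 <= l I /\ 8 / delta <= l I /\
    16 * INR I <= alpha ^ 2 * 2 ^ I /\ 2 * (9 * INR I / delta ^ 2) ^ 2 * INR (I ^ 5) ^ 16 <= 2 ^ I).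
  { intros I HI. unfold I0 in HI.
    assert (H2I : 2 ^ I = exp (ln 2 * INR I)) by (rewrite pow_exp_ln by lra; f_equal; ring).
    repeat split; [lia|apply HI3; lia|apply HI4; lia|apply HI5; lia| |].
    - assert (H := Hp1 (INR I)). rewrite <- H2I in H.
      assert (HX : X1 <= INR I) by (apply Rle_trans with (INR I1); [lra|apply le_INR; lia]). specialize (H HX).
      apply (Rmult_le_compat_l (alpha ^ 2)) in H; [|apply pow2_ge_0].
      replace (alpha ^ 2 * (16 / alpha ^ 2 * INR I ^ 1)) with (16 * INR I) in H by (field; lra). exact H.
    - assert (H := Hp2 (INR I)). rewrite <- H2I in H.
      assert (HX : X2 <= INR I) by (apply Rle_trans with (INR I2); [lra|apply le_INR; lia]). specialize (H HX).
      rewrite pow_INR, <- pow_mult. change (5 * 16)%nat with 80%nat.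
      replace (2 * (9 * INR I / delta ^ 2) ^ 2 * INR I ^ 80) with (162 / delta ^ 4 * INR I ^ 82); [exact H|].
      replace (INR I ^ 82) with (INR I ^ 2 * INR I ^ 80) by (rewrite <- pow_add; reflexivity).
      set (W := INR I ^ 80). field. lra. }
  assert (Hmean : forall I, (I0 <= I)%nat -> exp (delta / 2 * l I) / 6 <= mean I /\ 2 <= mean I).
  { intros I HI. destruct (HI0 I HI) as (H1 & H2 & H3 & H4 & H5 & _).
    assert (H := mean_lower alpha I Hmgf Halpha H1 H2 H3 H5). split; [exact H|].
    eapply Rle_trans; [|exact H].
    assert (H6 : 4 <= delta / 2 * l I).
    { apply (Rmult_le_compat_l (delta / 2)) in H4; [|lra].
      replace (delta / 2 * (8 / delta)) with 4 in H4 by (field; lra). exact H4. }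
    assert (H7 := exp_ge_1_plus_sqr (delta / 2 * l I) ltac:(lra)). nra. }
  eapply null_mono; [|apply (null_eventually (fun I => detector (I0 + I)))].
  - intros x (Hx & J & HJ). split; [exact Hx|]. exists J. intros I HI.
    destruct (HI0 (I0 + I)%nat ltac:(lia)) as (H1 & H2 & _).
    apply detector_bad; [lia|exact H2|apply Hmean; lia|]. apply HJ. lia.
  - intros I. apply cont_detector.
  - intros I x. apply detector_nonneg.
  - intros e He'. set (C2 := 6 * C * (1 + 324 / delta ^ 4)).
    assert (HC2 : 0 < C2).
    { unfold C2. assert (0 < 324 / delta ^ 4) by (apply Rdiv_lt_0_compat; lra). nra. }
    destruct (ln_large ((1 - ln (e / (25 + C2))) / (delta / 2))) as (I6 & _ & HI6). exists I6. intros I' HI'.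
    set (I := (I0 + I')%nat). destruct (HI0 I ltac:(unfold I; lia)) as (H1 & H2 & H3 & H4 & H5 & H6).
    destruct (Hmean I ltac:(unfold I; lia)) as [Hm1 Hm2].
    assert (HIr : 2 <= INR I) by (apply (le_INR 2); exact H1).
    assert (HlI : l I <= INR I) by (apply ln_le_self; lra).
    set (T := 9 * INR I / delta ^ 2) in *.
    assert (HMT : INR (M I) <= T).
    { destruct (M_bounds I) as [_ HM]; [lra|]. eapply Rle_trans; [exact HM|]. unfold T.
      apply Rmult_le_reg_r with (delta ^ 2); [lra|].
      replace ((8 * l I / delta ^ 2 + 1) * delta ^ 2) with (8 * l I + delta ^ 2) by (field; lra).
      replace (9 * INR I / delta ^ 2 * delta ^ 2) with (9 * INR I) by (field; lra). lra. }
    assert (Hnu : (0 < I ^ 5)%nat) by (generalize (Nat.pow_nonzero I 5); lia).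
    set (kappa := 6 * (C * (1 + 4 * T ^ 2) / INR (I ^ 5))).
    assert (HP5 : 0 < INR (I ^ 5)) by now apply lt_0_INR.
    assert (Hk : 0 <= kappa).
    { unfold kappa. apply Rmult_le_pos; [lra|]. apply Rdiv_le_0_compat; [|lra].
      apply Rmult_le_pos; [lra|]. generalize (pow2_ge_0 T); lra. }
    assert (HE : E (detector I) <= 4 / mean I + INR I ^ 2 * kappa + exp (- (l I / 2))).
    { apply (detector_mean alpha I Hmgf Halpha H1 H2 H5 kappa Hk Hm2).
      intros i j Hij. apply (decorrelation I H1 H2 C (I ^ 5)%nat T i j Hnu); auto; lra. }
    clear H6. eapply Rle_lt_trans; [exact HE|].
    (* This is [I ^ (- delta / 2)], the slowest of the three rates. The three terms are at most
       [24 y], [C2 y] and [y], whence the factor [25 + C2]. *)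
    set (y := exp (- (delta / 2 * l I))).
    assert (Hy1 : 4 / mean I <= 24 * y).
    { unfold y. rewrite exp_Ropp. set (z := exp (delta / 2 * l I)) in *.
      assert (Hz : 0 < z) by apply exp_pos.
      apply Rmult_le_reg_r with (mean I * z); [apply Rmult_lt_0_compat; lra|].
      replace (4 / mean I * (mean I * z)) with (4 * z) by (field; lra).
      replace (24 * / z * (mean I * z)) with (24 * mean I) by (field; lra). lra. }
    assert (Hy2 : exp (- (l I / 2)) <= y) by (apply exp_le; nra).
    assert (Hy3 : INR I ^ 2 * kappa <= C2 * y).
    { apply Rle_trans with (C2 * / INR I).
      - unfold kappa, C2, T. rewrite pow_INR.
        replace (INR I ^ 2 * (6 * (C * (1 + 4 * (9 * INR I / delta ^ 2) ^ 2) / INR I ^ 5))) with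
          (6 * C * / INR I * (/ INR I ^ 2 + 324 / delta ^ 4)) by (field; lra).
        replace (6 * C * (1 + 324 / delta ^ 4) * / INR I) with (6 * C * / INR I * (1 + 324 / delta ^ 4)) by ring.
        apply Rmult_le_compat_l.
        + apply Rmult_le_pos; [lra|]. left. apply Rinv_0_lt_compat. lra.
        + apply Rplus_le_compat_r. rewrite <- Rinv_1. apply Rinv_le_contravar; [lra|nra].
      - apply Rmult_le_compat_l; [lra|]. rewrite <- (exp_ln (INR I)), <- exp_Ropp by lra.
        fold (l I). apply exp_le. nra. }
    assert (Hy4 : (25 + C2) * y < e).
    { apply Rlt_le_trans with ((25 + C2) * (e / (25 + C2))); [|right; field; lra].
      apply Rmult_lt_compat_l; [lra|].
      rewrite <- (exp_ln (e / (25 + C2))) by (apply Rdiv_lt_0_compat; lra).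
      apply exp_increasing. specialize (HI6 I ltac:(unfold I; lia)). fold (l I) in HI6.
      apply (Rmult_le_compat_l (delta / 2)) in HI6; [|lra].
      replace (delta / 2 * ((1 - ln (e / (25 + C2))) / (delta / 2))) with (1 - ln (e / (25 + C2))) in HI6 by (field; lra).
      lra. }
    lra.
Qed.

End Window.

End Lower.

Lemma null_or (P Q : R -> Prop) : lebesgue_null P -> lebesgue_null Q -> lebesgue_null (fun x => P x \/ Q x).
Proof.
  intros HP HQ. apply null_mono with (fun x => exists j : nat, (match j with O => P | _ => Q end) x).
  - intros x [H|H]; [now exists 0%nat|now exists 1%nat].
  - apply null_union. intros [|j]; assumption.
Qed.

Lemma lil_norm_pos N : (16 <= N)%nat -> 0 < ln (ln (INR N)) /\ 0 < lil_norm N.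
Proof.
  intros HN. assert (H16 : 16 <= INR N) by (replace 16 with (INR 16) by (simpl; lra); now apply le_INR).
  assert (Hl : 2 <= ln (INR N)).
  { apply Rle_trans with (ln (2 ^ 4)); [|apply ln_le; lra]. rewrite pow_exp_ln, ln_exp by lra.
    simpl INR. generalize ln_lt_2. lra. }
  assert (H : 0 < ln (ln (INR N))) by (rewrite <- ln_1; apply ln_increasing; lra).
  split; [exact H|]. apply sqrt_lt_R0. apply Rmult_lt_0_compat; lra.
Qed.

(** Off a null set, infinitely many blocks ending at [N = theta ^ (j + 1)] have increment at least
    [(1 - delta)^3 >= 1 - 3 delta] times the norm. The sum before the block is at least [- 2 delta]
    times the norm, by the upper half for [- d] with constant 2 and by [theta > / delta^2]. This
    contradicts the bound [1 - 6 delta]. *)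
Theorem lil_lower d delta : quasi_gaussian d -> 0 < delta <= 1/4 ->
  lebesgue_null (fun x => 0 <= x <= 1 /\
    exists N0, forall N, (N0 <= N)%nat -> dsum d N x <= (1 - 6 * delta) * lil_norm N).
Proof.
  intros Hd Hdelta.
  destruct (INR_unbounded (Rmax 2 (/ delta ^ 2))) as (theta & Hth).
  assert (Hth2 : 2 < INR theta) by (eapply Rle_lt_trans; [apply Rmax_l|exact Hth]).
  assert (Hthd : / delta ^ 2 < INR theta) by (eapply Rle_lt_trans; [apply Rmax_r|exact Hth]).
  assert (Htheta : (2 <= theta)%nat) by (apply INR_le; simpl; lra).
  assert (Hd2 : 0 < delta ^ 2) by (apply pow_lt; lra).
  assert (Hthinv : / INR theta <= delta ^ 2).
  { rewrite <- (Rinv_inv (delta ^ 2)). apply Rinv_le_contravar; [now apply Rinv_0_lt_compat|lra]. }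
  eapply null_mono; [|apply null_or;
    [apply (blocks_infinitely_often d Hd theta Htheta delta Hdelta)
    |apply (lil_upper (fun i x => - d i x) (quasi_gaussian_opp d Hd) 1); lra]].
  intros x (Hx & N0 & HN0).
  destruct (excluded_middle_informative (exists N1, forall N, (N1 <= N)%nat ->
    dsum (fun i x => - d i x) N x <= (1 + 1) * lil_norm N)) as [(N1 & HN1)|Hn]; [left|right; split; assumption].
  split; [exact Hx|].
  set (K := ln (2 * ln (INR theta))).
  destruct (ln_large (Rabs K / delta)) as (I1 & HI1' & HI1).
  exists (3 + N0 + N1 + I1)%nat. intros I HI j Hj.
  apply Rnot_le_lt. intros Hbig.
  set (N := (theta ^ S j)%nat).
  assert (Hpow : forall k, (k < theta ^ k)%nat) by (intros; apply Nat.pow_gt_lin_r; lia).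
  assert (Hj1 := Hpow j). assert (Hj2 := Hpow (S j)). fold N in Hj2.
  specialize (HN0 N ltac:(lia)). specialize (HN1 (theta ^ j)%nat ltac:(lia)).
  assert (Hopp : dsum (fun i x => - d i x) (theta ^ j) x = - dsum d (theta ^ j) x).
  { unfold dsum. rewrite (rsum_ext _ (fun i => -1 * d i x)) by (intros; ring). rewrite rsum_scal. ring. }
  rewrite Hopp in HN1.
  assert (HNth : INR N = INR theta * INR (theta ^ j)).
  { unfold N. rewrite Nat.pow_succ_r', mult_INR. reflexivity. }
  assert (Htj0 : 0 < INR (theta ^ j)) by (apply lt_0_INR; lia).
  assert (HN16 : (16 <= N)%nat).
  { unfold N. apply Nat.le_trans with (2 ^ S j)%nat; [|apply Nat.pow_le_mono_l; lia].
    apply (Nat.pow_le_mono_r 2 4); lia. }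
  destruct (lil_norm_pos N HN16) as [HL Hlil]. set (Lam := ln (ln (INR N))) in *.
  assert (HNp : 0 < INR N) by (apply lt_0_INR; lia).
  assert (Hlth : 0 < ln (INR theta)) by (rewrite <- ln_1; apply ln_increasing; lra).
  assert (HIp : 0 < INR I) by (apply lt_0_INR; lia).
  assert (HlnN : forall k, ln (INR (theta ^ k)) = INR k * ln (INR theta)).
  { intros k. rewrite pow_INR, pow_exp_ln, ln_exp by lra. reflexivity. }
  (* As [j < 2 I], the iterated logarithm of [N] is at most [ln (2 I ln theta) = K + ln I], and [I]
     is large enough for [ln I] to dominate [K]. *)
  assert (HLam : (1 - delta) * Lam <= ln (INR I)).
  { assert (H1 : Lam <= K + ln (INR I)).
    { unfold Lam, K, N. rewrite HlnN. rewrite <- ln_mult by lra. apply ln_le.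
      - apply Rmult_lt_0_compat; [apply lt_0_INR; lia|exact Hlth].
      - assert (INR (S j) <= 2 * INR I).
        { replace 2 with (INR 2) by reflexivity. rewrite <- mult_INR. apply le_INR. lia. } nra. }
    specialize (HI1 I ltac:(lia)). apply (Rmult_le_compat_l delta) in HI1; [|lra].
    replace (delta * (Rabs K / delta)) with (Rabs K) in HI1 by (field; lra).
    generalize (Rle_abs K) (Rabs_pos K). nra. }
  assert (HA : INR (bsize theta j) = INR N - INR (theta ^ j)).
  { unfold bsize. fold N. apply minus_INR. unfold N. apply Nat.pow_le_mono_r; lia. }
  assert (Htj : INR (theta ^ j) <= delta ^ 2 * INR N).
  { apply Rle_trans with (/ INR theta * INR N); [right; rewrite HNth; field; lra|].
    apply Rmult_le_compat_r; lra. }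
  assert (HAp := bsize_pos theta Htheta j).
  assert (Hsq1 : (1 - delta) * lil_norm N <= sqrt (INR (bsize theta j) * ln (INR I))).
  { unfold lil_norm. fold Lam. rewrite <- (sqrt_pow2 (1 - delta)) by lra.
    rewrite <- sqrt_mult_alt by apply pow2_ge_0. apply sqrt_le_1_alt.
    replace ((1 - delta) ^ 2 * (INR N * Lam)) with ((1 - delta) * INR N * ((1 - delta) * Lam)) by ring.
    apply Rmult_le_compat; nra. }
  assert (Hsq2 : lil_norm (theta ^ j) <= delta * lil_norm N).
  { unfold lil_norm. fold Lam. rewrite <- (sqrt_pow2 delta) by lra.
    rewrite <- sqrt_mult_alt by apply pow2_ge_0. apply sqrt_le_1_alt.
    apply Rle_trans with (INR (theta ^ j) * Lam).
    - apply Rmult_le_compat_l; [lra|]. unfold Lam, N. rewrite !HlnN. apply ln_le.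
      + apply Rmult_lt_0_compat; [apply lt_0_INR; lia|exact Hlth].
      + apply Rmult_le_compat_r; [lra|]. apply le_INR. lia.
    - rewrite <- Rmult_assoc. apply Rmult_le_compat_r; lra. }
  set (D := dsum d N x - dsum d (theta ^ j) x).
  assert (Hsc : 0 < bscale theta j) by (apply sqrt_lt_R0; apply Rdiv_lt_0_compat; lra).
  assert (HD : (1 - delta) ^ 2 * sqrt (INR (bsize theta j) * ln (INR I)) <= D).
  { apply Rmult_le_reg_l with (bscale theta j); [exact Hsc|].
    change (bscale theta j * D) with (bsum d theta j x).
    eapply Rle_trans; [|exact Hbig]. right. unfold level.
    replace (sqrt (2 * ln (INR I))) with (bscale theta j * sqrt (INR (bsize theta j) * ln (INR I))); [ring|].
    unfold bscale. rewrite <- sqrt_mult_alt by (apply Rdiv_le_0_compat; lra). f_equal. field. lra. }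
  assert (H1 : (1 - delta) ^ 2 * ((1 - delta) * lil_norm N) <= D).
  { eapply Rle_trans; [|exact HD]. apply Rmult_le_compat_l; [apply pow2_ge_0|exact Hsq1]. }
  assert (H2 : (1 - 3 * delta) * lil_norm N <= (1 - delta) ^ 2 * ((1 - delta) * lil_norm N)).
  { rewrite <- Rmult_assoc. apply Rmult_le_compat_r; [lra|]. nra. }
  assert (0 < delta * lil_norm N) by (apply Rmult_lt_0_compat; lra).
  unfold D in H1. lra.
Qed.

(** * Both halves of the law of the iterated logarithm combined *)

Lemma psum_sum n s N x : psum n s N x = dsum (fun i => wave n (s i)) N x.
Proof. induction N as [|N IH]; [reflexivity|]. simpl. rewrite IH. reflexivity. Qed.

Theorem lil n s : hadamard_gap n -> is_permutation s ->
  lebesgue_null (fun x => 0 <= x <= 1 /\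
     ~ limsup_eq (fun N => psum n s N x / sqrt (INR N * ln (ln (INR N)))) 1).
Proof.
  intros Hn Hs. set (d := fun i => wave n (s i)).
  assert (Hd : quasi_gaussian d) by exact (lacunary_quasi_gaussian n s Hn Hs).
  assert (Hk : forall k : nat, 0 < / (INR k + 1) <= 1).
  { intros k. assert (H := pos_INR k). split; [apply Rinv_0_lt_compat; lra|].
    rewrite <- Rinv_1. apply Rinv_le_contravar; lra. }
  (* Countably many tolerances suffice; the factor 2 covers the deviations [/ (INR k + 1)] above and
     [6/4 * / (INR k + 1)] below. *)
  assert (Heps : forall eps, 0 < eps -> exists k : nat, 2 * / (INR k + 1) < eps).
  { intros eps He. destruct (INR_unbounded (2 / eps)) as (k & HK). exists k.
    assert (Hk0 := pos_INR k).
    apply Rmult_lt_reg_r with (INR k + 1); [lra|]. rewrite Rmult_assoc, Rinv_l by lra.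
    assert (2 < eps * INR k); [|lra].
    apply (Rmult_lt_compat_l eps) in HK; [|exact He]. replace (eps * (2 / eps)) with 2 in HK by (field; lra). exact HK. }
  eapply null_mono; [|apply null_or; apply null_union;
    [intros k; apply (lil_upper d Hd (/ (INR k + 1)) (Hk k))
    |intros k; apply (lil_lower d (/ (INR k + 1) / 4) Hd); generalize (Hk k); lra]].
  intros x (Hx & Hlim).
  destruct (excluded_middle_informative (exists k : nat, 0 <= x <= 1 /\ ~ (exists N0, forall N, (N0 <= N)%nat ->
    dsum d N x <= (1 + / (INR k + 1)) * lil_norm N))) as [H|Hup]; [now left|].
  destruct (excluded_middle_informative (exists k : nat, 0 <= x <= 1 /\ exists N0, forall N, (N0 <= N)%nat ->
    dsum d N x <= (1 - 6 * (/ (INR k + 1) / 4)) * lil_norm N)) as [H|Hlo]; [now right|].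
  exfalso. apply Hlim. split; intros eps He; destruct (Heps eps He) as (k & HK); generalize (Hk k); intros Hk1.
  - destruct (excluded_middle_informative (exists N0, forall N, (N0 <= N)%nat ->
      dsum d N x <= (1 + / (INR k + 1)) * lil_norm N)) as [(N0 & H)|H];
      [|exfalso; apply Hup; exists k; split; assumption].
    exists (N0 + 16)%nat. intros N HN. destruct (lil_norm_pos N ltac:(lia)) as [_ Hp].
    rewrite psum_sum. fold d. fold (lil_norm N). specialize (H N ltac:(lia)).
    apply Rmult_lt_reg_r with (lil_norm N); [exact Hp|]. unfold Rdiv. rewrite Rmult_assoc, Rinv_l by lra.
    rewrite Rmult_1_r. eapply Rle_lt_trans; [exact H|]. apply Rmult_lt_compat_r; lra.
  - intros N0. destruct (excluded_middle_informative (exists N, (N >= N0)%nat /\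
      psum n s N x / sqrt (INR N * ln (ln (INR N))) > 1 - eps)) as [H|H]; [exact H|].
    exfalso. apply Hlo. exists k. split; [exact Hx|]. exists (N0 + 16)%nat. intros N HN.
    destruct (lil_norm_pos N ltac:(lia)) as [_ Hp].
    assert (H1 : dsum d N x / lil_norm N <= 1 - eps).
    { apply Rnot_lt_le. intros H1. apply H. exists N. split; [lia|]. rewrite psum_sum. exact H1. }
    apply (Rmult_le_compat_r (lil_norm N)) in H1; [|lra]. unfold Rdiv in H1. rewrite Rmult_assoc, Rinv_l in H1 by lra.
    rewrite Rmult_1_r in H1. eapply Rle_trans; [exact H1|]. apply Rmult_le_compat_r; lra.
Qed.

(** * The Gaussian law *)

Lemma derive_RInt (f df : R -> R -> R) a b :
  (forall t u, is_derive (fun t => f t u) t (df t u)) ->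
  (forall t u, continuity_2d_pt df t u) -> (forall t, cont (f t)) ->
  forall t, is_derive (fun t => RInt (f t) a b) t (RInt (df t) a b).
Proof.
  intros Hd Hc Hf t.
  rewrite (RInt_ext (df t) (fun u => Derive (fun z => f z u) t)).
  - apply (is_derive_RInt_param f a b t).
    + apply filter_forall. intros y u _. exists (df y u). apply Hd.
    + intros u _. apply (continuity_2d_pt_ext df); [|apply Hc].
      intros y z. symmetry. apply is_derive_unique, Hd.
    + apply filter_forall. intros y. apply (cont_ex_RInt (f y)), Hf.
  - intros u _. symmetry. apply is_derive_unique, Hd.
Qed.

Lemma c2d_1 (f : R -> R) t u : cont f -> continuity_2d_pt (fun x y => f x) t u.
Proof.
  intros H. apply (continuity_1d_2d_pt_comp f (fun x y => x)); [|apply continuity_2d_pt_id1].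
  apply continuity_pt_filterlim, H.
Qed.

Lemma c2d_2 (f : R -> R) t u : cont f -> continuity_2d_pt (fun x y => f y) t u.
Proof.
  intros H. apply (continuity_1d_2d_pt_comp f (fun x y => y)); [|apply continuity_2d_pt_id2].
  apply continuity_pt_filterlim, H.
Qed.

Lemma c2d_comp (f : R -> R) (g : R -> R -> R) t u : cont f -> continuity_2d_pt g t u ->
  continuity_2d_pt (fun x y => f (g x y)) t u.
Proof. intros H Hg. apply (continuity_1d_2d_pt_comp f g); [apply continuity_pt_filterlim, H|exact Hg]. Qed.

Lemma sqr_mult_exp (x : R) : exp (- (x * x)) <= 1.
Proof. rewrite <- exp_0. apply exp_le. nra. Qed.

Definition gint (t : R) : R := RInt (fun u => exp (- (u * u))) 0 t.

Lemma cont_gauss : cont (fun u => exp (- (u * u))).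
Proof. conti. Qed.

Lemma derive_gint t : is_derive gint t (exp (- (t * t))).
Proof.
  apply (is_derive_RInt (fun u => exp (- (u * u))) gint 0 t).
  - apply filter_forall. intros x. apply (RInt_correct (fun u => exp (- (u * u)))).
    apply cont_ex_RInt, cont_gauss.
  - apply cont_gauss.
Qed.

(* The classical trick: [gint t ^ 2 + int_0^1 exp (- t^2 (1 + u^2)) / (1 + u^2) du] is constant. *)
Lemma gint_sqr t : PI / 4 - exp (- (t * t)) <= gint t ^ 2 <= PI / 4.
Proof.
  set (f := fun t u : R => exp (- (t * t * (1 + u * u))) * / (1 + u * u)).
  set (df := fun t u : R => - (2 * t) * exp (- (t * t * (1 + u * u)))).
  assert (Hpos : forall u : R, 0 < 1 + u * u) by (intros; nra).
  assert (cinv : cont (fun u : R => / (1 + u * u))).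
  { intros u. apply continuity_pt_filterlim. apply continuity_pt_inv.
    - apply continuity_pt_filterlim. apply (cont_plus (fun _ => 1) (fun u => u * u)); conti.
    - generalize (Hpos u). lra. }
  assert (cf : forall t, cont (f t)).
  { intros s. unfold f. apply cont_mult; [|exact cinv]. conti. }
  assert (Hder : forall t, is_derive (fun t => RInt (f t) 0 1) t (RInt (df t) 0 1)).
  { apply derive_RInt; [| |exact cf].
    - intros s u. unfold f, df. generalize (Hpos u). intros Hu. auto_derive; [lra|]. field. lra.
    - intros s u. unfold df. apply continuity_2d_pt_mult.
      + apply (c2d_1 (fun s => - (2 * s))). conti.
      + apply (c2d_comp exp); [apply cont_exp|].
        apply (continuity_2d_pt_opp (fun s u => s * s * (1 + u * u))).
        apply (continuity_2d_pt_mult (fun s u => s * s) (fun s u => 1 + u * u)).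
        * apply (c2d_1 (fun s => s * s)). conti.
        * apply (c2d_2 (fun u => 1 + u * u)). conti. }
  assert (Hdf : forall t, RInt (df t) 0 1 = - (2 * exp (- (t * t)) * gint t)).
  { intros s. unfold gint.
    (* The substitution [v = s u] turns the integral of [df s] into [gint s], so that it cancels the
       derivative of [gint ^ 2]. *)
    assert (H := RInt_comp_lin (fun u => exp (- (u * u))) s 0 0 1).
    rewrite Rmult_0_r, Rplus_0_r, Rmult_1_r, Rplus_0_r in H.
    rewrite <- H by (apply cont_ex_RInt, cont_gauss).
    rewrite (RInt_ext (df s) (fun u => scal (- (2 * exp (- (s * s)))) (scal s (exp (- ((s * u + 0) * (s * u + 0))))))).
    - rewrite (RInt_scal (V := R_CompleteNormedModule)).
      + unfold scal; simpl; unfold mult; simpl. ring.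
      + apply (cont_ex_RInt (fun u => s * exp (- ((s * u + 0) * (s * u + 0))))). conti.
    - intros u _. unfold df, scal; simpl; unfold mult; simpl.
      replace (- (s * s * (1 + u * u))) with (- (s * s) + - ((s * u + 0) * (s * u + 0))) by ring.
      rewrite exp_plus. ring. }
  set (h := fun t => gint t ^ 2 + RInt (f t) 0 1).
  assert (Hh : forall t, is_derive h t 0).
  { intros s.
    assert (H := is_derive_plus (fun t => gint t ^ 2) (fun t => RInt (f t) 0 1) s _ _
      (is_derive_pow gint 2 s _ (derive_gint s)) (Hder s)).
    match type of H with is_derive _ _ ?v => replace v with 0 in H; [exact H|] end.
    rewrite Hdf. unfold plus; simpl. ring. }
  assert (Hconst : h t = h 0).
  { destruct (Req_dec t 0) as [->|Ht]; [reflexivity|].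
    destruct (MVT_gen h 0 t (fun _ => 0)) as (c & _ & Hc).
    - intros x _. apply Hh.
    - intros x _. apply continuity_pt_filterlim. apply (ex_derive_continuous h). exists 0. apply Hh.
    - lra. }
  assert (H0 : h 0 = PI / 4).
  { unfold h, gint. rewrite RInt_point. unfold zero; simpl. rewrite Rmult_0_l, Rplus_0_l.
    transitivity (atan 1 - atan 0); [|rewrite atan_1, atan_0; lra].
    apply is_RInt_unique. apply (is_RInt_derive atan (f 0)).
    - intros x _. unfold f. replace (exp (- (0 * 0 * (1 + x * x))) * / (1 + x * x)) with (/ (1 + Rsqr x)).
      + apply is_derive_atan.
      + replace (- (0 * 0 * (1 + x * x))) with 0 by ring. rewrite exp_0. unfold Rsqr. ring.
    - intros x _. apply cf. }
  assert (Hf : 0 <= RInt (f t) 0 1 <= exp (- (t * t))).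
  { assert (Hb : forall u, 0 <= f t u <= exp (- (t * t))).
    { intros u. unfold f. assert (0 < / (1 + u * u) <= 1).
      { split; [apply Rinv_0_lt_compat, Hpos|]. rewrite <- Rinv_1. apply Rinv_le_contravar; nra. }
      assert (Hp := exp_pos (- (t * t * (1 + u * u)))).
      assert (exp (- (t * t * (1 + u * u))) <= exp (- (t * t))) by (apply exp_le; nra).
      nra. }
    apply (E_between (f t)); [apply cf|apply Hb]. }
  unfold h in Hconst, H0. lra.
Qed.

(* Truncated Fourier transform of [exp (- u^2)]: [F' = - t/2 F + boundary term]. *)
Lemma gauss_fourier A e t : 0 <= A ->
  Rabs (RInt (fun u => cos (t * u + e) * exp (- (u * u))) (- A) A
        - exp (- (t ^ 2 / 4)) * (cos e * RInt (fun u => exp (- (u * u))) (- A) A)) <= Rabs t * exp (- (A * A)).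
Proof.
  intros HA.
  set (f := fun t u : R => cos (t * u + e) * exp (- (u * u))).
  set (df := fun t u : R => - u * sin (t * u + e) * exp (- (u * u))).
  set (F := fun t => RInt (f t) (- A) A).
  set (bd := fun t => / 2 * (sin (t * A + e) - sin (t * - A + e)) * exp (- (A * A))).
  assert (cf : forall t, cont (f t)) by (intros; unfold f; conti).
  assert (cdf : forall t, cont (df t)) by (intros; unfold df; conti).
  assert (Hder : forall t, is_derive F t (RInt (df t) (- A) A)).
  { apply derive_RInt; [| |exact cf].
    - intros s u. unfold f, df. auto_derive; [trivial|]. ring.
    - intros s u. unfold df. apply continuity_2d_pt_mult.
      + apply (continuity_2d_pt_mult (fun s u => - u)).
        * apply (c2d_2 (fun u => - u)). conti.
        * apply (c2d_comp sin); [apply cont_sin|].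
          apply (continuity_2d_pt_plus (fun s u => s * u)).
          -- apply (continuity_2d_pt_mult (fun s u => s)); [apply continuity_2d_pt_id1|apply continuity_2d_pt_id2].
          -- apply (c2d_1 (fun _ => e)). conti.
      + apply (c2d_2 (fun u => exp (- (u * u)))). conti. }
  assert (Hibp : forall t, RInt (df t) (- A) A = bd t - t / 2 * F t).
  { intros s.
    assert (H : is_RInt (fun u => df s u + s / 2 * f s u) (- A) A (bd s)).
    { replace (bd s) with (minus (/ 2 * sin (s * A + e) * exp (- (A * A))) (/ 2 * sin (s * - A + e) * exp (- (- A * - A)))).
      - apply (is_RInt_derive (fun u => / 2 * sin (s * u + e) * exp (- (u * u)))).
        + intros u _. unfold df, f. auto_derive; [trivial|]. field.
        + intros u _. apply (cont_plus (df s) (fun u => s / 2 * f s u)); [apply cdf|].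
          apply cont_mult; [apply cont_const|apply cf].
      - unfold minus, plus, opp, bd; simpl. replace (- (- A * - A)) with (- (A * A)) by ring. ring. }
    apply (is_RInt_unique (V := R_CompleteNormedModule)) in H.
    assert (H2 : RInt (fun u => df s u + s / 2 * f s u) (- A) A = RInt (df s) (- A) A + s / 2 * F s).
    { rewrite (RInt_plus (df s) (fun u => s / 2 * f s u)).
      - unfold F. rewrite <- (RInt_scal (f s)) by (apply cont_ex_RInt, cf). reflexivity.
      - apply cont_ex_RInt, cdf.
      - apply cont_ex_RInt. apply cont_mult; [apply cont_const|apply cf]. }
    rewrite H2 in H. lra. }
  (* The integrating factor removes [- t / 2 * F t], leaving only the boundary term in the
     derivative. *)
  set (h := fun t => exp (t ^ 2 / 4) * F t).
  assert (Hh : forall t, is_derive h t (exp (t ^ 2 / 4) * bd t)).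
  { intros s. unfold h.
    replace (exp (s ^ 2 / 4) * bd s) with
      (plus (mult (s / 2 * exp (s ^ 2 / 4)) (F s)) (mult (exp (s ^ 2 / 4)) (RInt (df s) (- A) A))).
    - apply (is_derive_mult (fun t => exp (t ^ 2 / 4)) F).
      + auto_derive; [trivial|]. field_simplify. unfold Rdiv; simpl. lra.
      + apply Hder.
      + intros; unfold mult; simpl; apply Rmult_comm.
    - rewrite Hibp. unfold plus, mult; simpl. field. }
  assert (Hbd : forall s, Rabs s <= Rabs t -> Rabs (exp (s ^ 2 / 4) * bd s) <= exp (t ^ 2 / 4) * exp (- (A * A))).
  { intros s Hs. unfold bd. rewrite !Rabs_mult, (Rabs_pos_eq (/ 2)), !(Rabs_pos_eq (exp _)) by (try lra; left; apply exp_pos).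
    assert (H1 : exp (s ^ 2 / 4) <= exp (t ^ 2 / 4)).
    { apply exp_le. rewrite <- (pow2_abs s), <- (pow2_abs t). generalize (Rabs_pos s). nra. }
    assert (H2 : Rabs (sin (s * A + e) - sin (s * - A + e)) <= 2).
    { apply Rabs_le. generalize (SIN_bound (s * A + e)) (SIN_bound (s * - A + e)). lra. }
    assert (H3 := exp_pos (- (A * A))). assert (H4 := exp_pos (s ^ 2 / 4)).
    assert (H5 := Rabs_pos (sin (s * A + e) - sin (s * - A + e))).
    apply Rmult_le_compat; [lra|nra|exact H1|]. nra. }
  assert (HM : Rabs (h t - h 0) <= Rabs t * (exp (t ^ 2 / 4) * exp (- (A * A)))).
  { destruct (MVT_gen h 0 t (fun s => exp (s ^ 2 / 4) * bd s)) as (c & Hc & H).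
    - intros x _. apply Hh.
    - intros x _. apply continuity_pt_filterlim. apply (ex_derive_continuous h). eexists. apply Hh.
    - rewrite H, Rminus_0_r, Rabs_mult, Rmult_comm. apply Rmult_le_compat_l; [apply Rabs_pos|].
      apply Hbd. unfold Rmin, Rmax in Hc. destruct (Rle_dec 0 t).
      + rewrite !Rabs_pos_eq; lra.
      + rewrite !Rabs_left1; lra. }
  assert (H0 : h 0 = cos e * RInt (fun u => exp (- (u * u))) (- A) A).
  { unfold h. replace (0 ^ 2 / 4) with 0 by field. rewrite exp_0, Rmult_1_l. unfold F, f.
    rewrite <- (RInt_scal (fun u => exp (- (u * u)))) by (apply cont_ex_RInt, cont_gauss).
    apply RInt_ext. intros u _. rewrite Rmult_0_l, Rplus_0_l. reflexivity. }
  rewrite H0 in HM. change (RInt (fun u => cos (t * u + e) * exp (- (u * u))) (- A) A) with (F t).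
  set (J := cos e * RInt (fun u => exp (- (u * u))) (- A) A) in *. unfold h in HM.
  assert (Hp := exp_pos (t ^ 2 / 4)).
  apply Rmult_le_reg_l with (exp (t ^ 2 / 4)); [exact Hp|].
  rewrite <- (Rabs_pos_eq (exp (t ^ 2 / 4))) at 1 by lra. rewrite <- Rabs_mult.
  replace (exp (t ^ 2 / 4) * (F t - exp (- (t ^ 2 / 4)) * J)) with (exp (t ^ 2 / 4) * F t - J).
  - lra.
  - rewrite exp_Ropp. field. lra.
Qed.

Local Notation gd := gauss_half_density.

Lemma sqrt_PI_ge1 : 1 <= sqrt PI.
Proof. rewrite <- sqrt_1. apply sqrt_le_1_alt. generalize PI2_1. lra. Qed.

Lemma gd_eq u : gd u = / sqrt PI * exp (- (u * u)).
Proof. unfold gd. unfold Rdiv. ring. Qed.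

Lemma cont_gd : cont gd.
Proof. apply (cont_ext (fun u => / sqrt PI * exp (- (u * u)))); [intros; symmetry; apply gd_eq|conti]. Qed.

Lemma gd_bounds u : 0 <= gd u <= 1.
Proof.
  rewrite gd_eq. assert (H := sqrt_PI_ge1). assert (0 < / sqrt PI <= 1).
  { split; [apply Rinv_0_lt_compat; lra|]. rewrite <- Rinv_1. apply Rinv_le_contravar; lra. }
  generalize (exp_pos (- (u * u))) (sqr_mult_exp u). nra.
Qed.

Lemma RInt_gd a b : RInt gd a b = / sqrt PI * (gint b - gint a) :> R.
Proof.
  rewrite (RInt_ext gd (fun u => scal (/ sqrt PI) (exp (- (u * u))))) by (intros; apply gd_eq).
  rewrite (RInt_scal (V := R_CompleteNormedModule)) by (apply cont_ex_RInt, cont_gauss).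
  unfold scal; simpl; unfold mult; simpl. f_equal. unfold gint.
  assert (H := RInt_Chasles (fun u => exp (- (u * u))) 0 a b (cont_ex_RInt _ _ _ cont_gauss) (cont_ex_RInt _ _ _ cont_gauss)).
  unfold plus in H; simpl in H. lra.
Qed.

Lemma gint_sign A : 0 <= A -> 0 <= gint A /\ gint (- A) <= 0.
Proof.
  intros HA. split.
  - apply RInt_ge_0; [exact HA|apply cont_ex_RInt, cont_gauss|]. intros; left; apply exp_pos.
  - unfold gint. rewrite <- opp_RInt_swap by (apply cont_ex_RInt, cont_gauss).
    assert (0 <= RInt (fun u => exp (- (u * u))) (- A) 0).
    { apply RInt_ge_0; [lra|apply cont_ex_RInt, cont_gauss|]. intros; left; apply exp_pos. }
    unfold opp; simpl. lra.
Qed.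

(** For [z = y / sqrt PI], [1/4 - z^2 = (1/2 - z) (1/2 + z)]; since [PI >= 2] and [1/2 + z >= 1/2],
    an error [e] for the square gives an error [e] for the mass. *)
Lemma half_mass_aux y e : 0 <= y -> PI / 4 - e <= y ^ 2 <= PI / 4 ->
  0 <= 1/2 - / sqrt PI * y <= e.
Proof.
  intros Hy H. assert (Hs := sqrt_PI_ge1). assert (HPI := PI_RGT_0).
  assert (Hs2 : sqrt PI ^ 2 = PI) by (apply pow2_sqrt; lra).
  set (z := / sqrt PI * y).
  assert (Hz : y = sqrt PI * z) by (unfold z; field; lra).
  assert (Hz0 : 0 <= z) by (unfold z; apply Rmult_le_pos; [left; apply Rinv_0_lt_compat; lra|exact Hy]).
  rewrite Hz, Rpow_mult_distr, Hs2 in H. assert (HP2 : 2 <= PI) by (generalize PI2_1; lra).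
  assert (Hz1 : z ^ 2 <= 1/4) by nra.
  assert (PI * (1/4 - z ^ 2) <= e) by lra. nra.
Qed.

Lemma half_mass A : 0 <= A ->
  0 <= 1/2 - RInt gd 0 A <= exp (- (A * A)) /\ 0 <= 1/2 - RInt gd (- A) 0 <= exp (- (A * A)).
Proof.
  intros HA. destruct (gint_sign A HA) as [H1 H2].
  assert (H0 : gint 0 = 0) by (unfold gint; rewrite RInt_point; reflexivity).
  rewrite !RInt_gd, H0. split.
  - rewrite Rminus_0_r. apply half_mass_aux; [exact H1|apply gint_sqr].
  - rewrite Rminus_0_l. apply half_mass_aux; [lra|].
    replace ((- gint (- A)) ^ 2) with (gint (- A) ^ 2) by ring.
    replace (A * A) with (- A * - A) by ring. apply gint_sqr.
Qed.

(** Truncation avoids improper integrals; by [half_mass] the lost Gaussian mass is at most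
    [2 exp (- A^2)]. *)
Definition gmean (A : R) (f : R -> R) : R := RInt (fun u => f u * gd u) (- A) A.
Definition half_char (t : R) : R := exp (- (t ^ 2 / 4)).

(** The summand [Rabs t] is the boundary error of [gauss_fourier], the 2 the mass lost in the two
    tails. *)
Lemma gmean_cos A t e : 0 <= A ->
  Rabs (gmean A (fun u => cos (t * u + e)) - half_char t * cos e) <= (Rabs t + 2) * exp (- (A * A)).
Proof.
  intros HA. assert (H := gauss_fourier A e t HA).
  set (J := RInt (fun u => exp (- (u * u))) (- A) A) in *.
  set (F := RInt (fun u => cos (t * u + e) * exp (- (u * u))) (- A) A) in *.
  assert (HG : gmean A (fun u => cos (t * u + e)) = / sqrt PI * F).
  { unfold gmean, F. rewrite (RInt_ext _ (fun u => scal (/ sqrt PI) (cos (t * u + e) * exp (- (u * u))))).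
    - apply (RInt_scal (V := R_CompleteNormedModule)).
      apply (cont_ex_RInt (fun u => cos (t * u + e) * exp (- (u * u)))). conti.
    - intros u _. rewrite gd_eq. unfold scal; simpl; unfold mult; simpl. ring. }
  assert (HJ : / sqrt PI * J = RInt gd (- A) 0 + RInt gd 0 A).
  { rewrite !RInt_gd. unfold J.
    assert (Hc := RInt_Chasles (fun u => exp (- (u * u))) (- A) 0 A (cont_ex_RInt _ _ _ cont_gauss) (cont_ex_RInt _ _ _ cont_gauss)).
    unfold plus in Hc; simpl in Hc. rewrite <- Hc.
    rewrite <- (opp_RInt_swap (fun u => exp (- (u * u))) 0 (- A)) by (apply cont_ex_RInt, cont_gauss).
    fold (gint (- A)) (gint A). unfold opp; simpl.
    assert (H0 : gint 0 = 0) by (unfold gint; rewrite RInt_point; reflexivity). rewrite H0. ring. }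
  destruct (half_mass A HA) as [H1 H2]. rewrite HG. unfold half_char.
  set (g := exp (- (t ^ 2 / 4))) in *.
  assert (Hg : 0 < g <= 1).
  { split; [apply exp_pos|]. rewrite <- exp_0. apply exp_le. generalize (pow2_ge_0 t). lra. }
  replace (/ sqrt PI * F - g * cos e) with
    (/ sqrt PI * (F - g * (cos e * J)) + g * cos e * (/ sqrt PI * J - 1)) by ring.
  eapply Rle_trans; [apply Rabs_triang|]. rewrite !Rabs_mult.
  assert (Hs := sqrt_PI_ge1).
  assert (Hi : 0 < / sqrt PI <= 1).
  { split; [apply Rinv_0_lt_compat; lra|]. rewrite <- Rinv_1. apply Rinv_le_contravar; lra. }
  rewrite (Rabs_pos_eq (/ sqrt PI)), (Rabs_pos_eq g) by lra. rewrite HJ.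
  assert (Hc1 : Rabs (cos e) <= 1) by apply Rabs_le, COS_bound.
  assert (Hj : Rabs (RInt gd (- A) 0 + RInt gd 0 A - 1) <= 2 * exp (- (A * A))) by (apply Rabs_le; lra).
  set (q1 := Rabs (F - g * (cos e * J))) in *. set (q2 := Rabs (RInt gd (- A) 0 + RInt gd 0 A - 1)) in *.
  assert (0 <= q1) by apply Rabs_pos. assert (0 <= q2) by apply Rabs_pos.
  assert (/ sqrt PI * q1 <= q1) by nra.
  assert (g * Rabs (cos e) <= 1) by nra.
  assert (g * Rabs (cos e) * q2 <= q2) by nra. lra.
Qed.

Lemma gmean_plus A f g : cont f -> cont g -> gmean A (fun u => f u + g u) = gmean A f + gmean A g.
Proof.
  intros Hf Hg. unfold gmean. rewrite (RInt_ext _ (fun u => plus (f u * gd u) (g u * gd u))).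
  - apply (RInt_plus (V := R_CompleteNormedModule)); apply cont_ex_RInt, cont_mult; auto; apply cont_gd.
  - intros u _. unfold plus; simpl. ring.
Qed.

Lemma gmean_scal A c f : cont f -> gmean A (fun u => c * f u) = c * gmean A f.
Proof.
  intros Hf. unfold gmean. rewrite (RInt_ext _ (fun u => scal c (f u * gd u))).
  - apply (RInt_scal (V := R_CompleteNormedModule)). apply cont_ex_RInt, cont_mult; auto; apply cont_gd.
  - intros u _. unfold scal; simpl; unfold mult; simpl. ring.
Qed.

Lemma tfreq_exists P : exists T, 0 <= T /\ tfreq T P.
Proof.
  induction P as [|[[c t] e] P (T & HT & H)].
  - exists 0. split; [lra|constructor].
  - exists (T + Rabs t). assert (Ht := Rabs_pos t). split; [lra|]. constructor; [simpl; lra|].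
    apply tfreq_mono with (2 := H). lra.
Qed.

Lemma gauss_test P eps : 0 < eps -> exists A0, 0 < A0 /\ forall A, A0 <= A ->
  Rabs (gmean A (tval P) - tmean half_char P) <= eps.
Proof.
  intros Heps. destruct (tfreq_exists P) as (T & HT & HP).
  assert (H : forall A, 0 <= A ->
    Rabs (gmean A (tval P) - tmean half_char P) <= tnorm P * ((T + 2) * exp (- (A * A)))).
  { intros A HA. induction HP as [|[[c t] e] P Ht HP IH]; simpl.
    - unfold gmean. rewrite (RInt_ext _ (fun _ => 0)) by (intros; apply Rmult_0_l). rewrite RInt_const_R, Rmult_0_r, Rminus_0_r, Rabs_R0. lra.
    - simpl in Ht. assert (cP : cont (tval P)) by (apply (cont_tval P (fun x => x)), cont_id).
      rewrite gmean_plus by conti. rewrite (gmean_scal A c (fun y => cos (t * y + e))) by conti.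
      replace (c * gmean A (fun y => cos (t * y + e)) + gmean A (tval P) - (c * (half_char t * cos e) + tmean half_char P))
        with (c * (gmean A (fun y => cos (t * y + e)) - half_char t * cos e) + (gmean A (tval P) - tmean half_char P)) by ring.
      eapply Rle_trans; [apply Rabs_triang|]. rewrite Rabs_mult, Rmult_plus_distr_r.
      apply Rplus_le_compat; [|exact IH]. apply Rmult_le_compat_l; [apply Rabs_pos|].
      eapply Rle_trans; [apply (gmean_cos A t e HA)|]. apply Rmult_le_compat_r; [left; apply exp_pos|lra]. }
  set (B := tnorm P * (T + 2)).
  assert (HB : 0 <= B) by (apply Rmult_le_pos; [apply tnorm_nonneg|lra]).
  exists (1 + B / eps). assert (0 <= B / eps) by (apply Rdiv_le_0_compat; lra). split; [lra|].
  intros A HA. eapply Rle_trans; [apply H; lra|].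
  rewrite <- Rmult_assoc. fold B.
  assert (He : exp (- (A * A)) <= / A).
  { rewrite exp_Ropp. apply Rinv_le_contravar; [lra|]. generalize (exp_ineq1_le (A * A)). nra. }
  apply Rle_trans with (B * / A); [apply Rmult_le_compat_l; lra|].
  apply Rmult_le_reg_r with A; [lra|]. rewrite Rmult_assoc, Rinv_l by lra.
  assert (B / eps * eps = B) by (field; lra). nra.
Qed.

(** * The central limit theorem *)

Definition trig_poly (f : R -> R) : Prop := exists P, forall y, tval P y = f y.

Lemma trig_const c : trig_poly (fun _ => c).
Proof. exists [(c, 0, 0)]. intros y. simpl. rewrite Rmult_0_l, Rplus_0_l, cos_0. ring. Qed.

Lemma trig_cos t e : trig_poly (fun y => cos (t * y + e)).
Proof. exists [(1, t, e)]. intros y. simpl. ring. Qed.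

Lemma tval_app P Q y : tval (P ++ Q) y = tval P y + tval Q y.
Proof. induction P as [|[[c t] e] P IH]; simpl; [ring|]. rewrite IH. ring. Qed.

Lemma trig_plus f g : trig_poly f -> trig_poly g -> trig_poly (fun y => f y + g y).
Proof. intros (P & HP) (Q & HQ). exists (P ++ Q). intros y. now rewrite tval_app, HP, HQ. Qed.

Lemma trig_mult f g : trig_poly f -> trig_poly g -> trig_poly (fun y => f y * g y).
Proof.
  intros (P & HP) (Q & HQ). revert g HQ. induction Q as [|[[c t] e] Q IH]; intros g HQ.
  - exists []. intros y. rewrite <- HQ. simpl. ring.
  - destruct (IH (tval Q) (fun y => eq_refl)) as (S & HS).
    exists (flat_map (fun p => let '(c', t', e') := p in [(c * c', t', e')]) (tmul_cos t e P) ++ S).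
    intros y. rewrite tval_app, HS, <- HQ. simpl. rewrite <- HP.
    assert (Hsc : forall L, tval (flat_map (fun p => let '(c', t', e') := p in [(c * c', t', e')]) L) y = c * tval L y).
    { induction L as [|[[c' t'] e'] L IHL]; simpl; [ring|]. rewrite IHL. ring. }
    rewrite Hsc, tmul_cos_val. ring.
Qed.

Lemma trig_pow f k : trig_poly f -> trig_poly (fun y => f y ^ k).
Proof. intros H. induction k; simpl; [apply trig_const|now apply trig_mult]. Qed.

Lemma trig_ext f g : (forall y, f y = g y) -> trig_poly f -> trig_poly g.
Proof. intros H (P & HP). exists P. intros y. now rewrite HP. Qed.

Lemma bernoulli_minus x k : 0 <= x <= 1 -> 1 - INR k * x <= (1 - x) ^ k <= 1.
Proof.
  intros Hx. induction k as [|k IH]; [simpl; lra|]. rewrite S_INR. simpl.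
  assert (0 <= (1 - x) ^ k) by (apply pow_le; lra). nra.
Qed.

(* For large [k], [(1 - s^k)^(2^k)] jumps from 1 to 0 at [s = 1/2]; here [s = (1 + sin ((y - t0) / (2 L))) / 2]. *)
Lemma trig_step L tau eta eps : 0 < eta -> - L <= tau -> tau + eta <= L -> 0 < eps ->
  exists U, trig_poly U /\ (forall y, 0 <= U y <= 1) /\
    (forall y, - L <= y <= tau -> 1 - eps <= U y) /\ (forall y, tau + eta <= y <= L -> U y <= eps).
Proof.
  intros Heta HL1 HL2 Heps.
  assert (HL : 0 < L) by lra. set (t0 := tau + eta / 2).
  set (z := sin (eta / (4 * L))).
  assert (Ha : 0 < eta / (4 * L) <= 1/2).
  { split; [apply Rdiv_lt_0_compat; lra|]. apply Rmult_le_reg_r with (4 * L); [lra|].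
    unfold Rdiv. rewrite Rmult_assoc, Rinv_l; lra. }
  assert (HPI := PI2_3_2).
  assert (Hz : 0 < z < 1).
  { split; [apply sin_gt_0; lra|]. destruct (sin_taylor (eta / (4 * L))) as [_ H]; [lra|]. fold z in H. lra. }
  destruct (pow_unbounded (1 + z) (/ eps)) as (k & _ & Hk); [lra|].
  set (arg := fun y => (y - t0) / (2 * L)).
  set (s := fun y => (1 + sin (arg y)) / 2).
  assert (Hs : forall y, 0 <= s y <= 1) by (intros y; unfold s; generalize (SIN_bound (arg y)); lra).
  exists (fun y => (1 - s y ^ k) ^ (2 ^ k)).
  (* The scaling keeps the argument within the interval where sine increases, so periodicity does no
     harm on [[-L, L]]. *)
  assert (Harg : forall y, - L <= y <= L -> -1 <= arg y <= 1).
  { intros y Hy. assert (H : arg y * (2 * L) = y - t0) by (unfold arg; field; lra). unfold t0 in H.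
    split; apply Rmult_le_reg_r with (2 * L); lra. }
  assert (Hsk : forall y, 0 <= s y ^ k <= 1).
  { intros y. split; [apply pow_le, Hs|]. rewrite <- (pow1 k). apply pow_incr, Hs. }
  assert (H2k : forall y, INR (2 ^ k) * s y ^ k = (1 + sin (arg y)) ^ k).
  { intros y. rewrite INR_pow2, <- Rpow_mult_distr. f_equal. unfold s. field. }
  assert (Hzk : 0 < (1 + z) ^ k) by (apply pow_lt; lra).
  assert (Hik : / (1 + z) ^ k <= eps).
  { rewrite <- (Rinv_inv eps). apply Rinv_le_contravar; [now apply Rinv_0_lt_compat|exact Hk]. }
  repeat split.
  - apply trig_pow. apply (trig_ext (fun y => 1 + (-1) * s y ^ k)); [intros; ring|].
    apply trig_plus; [apply trig_const|]. apply trig_mult; [apply trig_const|]. apply trig_pow.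
    apply (trig_ext (fun y => / 2 + / 2 * cos (/ (2 * L) * y + (- t0 / (2 * L) - PI / 2)))).
    + intros y. unfold s, arg. rewrite <- (cos_shift ((y - t0) / (2 * L))).
      rewrite <- (cos_neg (PI / 2 - _)).
      replace (- (PI / 2 - (y - t0) / (2 * L))) with (/ (2 * L) * y + (- t0 / (2 * L) - PI / 2)) by (field; lra).
      field.
    + apply trig_plus; [apply trig_const|]. apply trig_mult; [apply trig_const|apply trig_cos].
  - apply pow_le. generalize (Hsk y). lra.
  - apply bernoulli_minus, Hsk.
  - intros y Hy. destruct (bernoulli_minus (s y ^ k) (2 ^ k) (Hsk y)) as [H _].
    eapply Rle_trans; [|exact H]. rewrite H2k.
    assert (Hsin : sin (arg y) <= - z).
    { unfold z. rewrite <- sin_neg. destruct (Harg y) as [G1 G2]; [lra|].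
      apply sin_incr_1; try lra. assert (G : arg y * (2 * L) = y - t0) by (unfold arg; field; lra).
      assert (G' : - (eta / (4 * L)) * (2 * L) = - (eta / 2)) by (field; lra).
      apply Rmult_le_reg_r with (2 * L); [lra|]. rewrite G, G'. unfold t0. lra. }
    assert (H1 : (1 + sin (arg y)) ^ k <= / (1 + z) ^ k).
    { rewrite <- pow_inv. apply pow_incr. split; [generalize (SIN_bound (arg y)); lra|].
      apply Rle_trans with (1 - z); [lra|]. apply Rmult_le_reg_r with (1 + z); [lra|]. rewrite Rinv_l by lra. nra. }
    lra.
  - intros y Hy.
    assert (Hsin : z <= sin (arg y)).
    { unfold z. destruct (Harg y) as [G1 G2]; [lra|].
      apply sin_incr_1; try lra. assert (G : arg y * (2 * L) = y - t0) by (unfold arg; field; lra).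
      assert (G' : (eta / (4 * L)) * (2 * L) = eta / 2) by (field; lra).
      apply Rmult_le_reg_r with (2 * L); [lra|]. rewrite G, G'. unfold t0. lra. }
    set (x := s y ^ k) in *. specialize (Hsk y). fold x in Hsk. specialize (H2k y). fold x in H2k.
    set (K := (2 ^ k)%nat) in *.
    assert (H1 : (1 + z) ^ k <= INR K * x) by (rewrite H2k; apply pow_incr; lra).
    assert (HKx : 0 < INR K * x) by lra.
    assert (Hx0 : 0 < x) by (destruct (Req_dec x 0) as [E0|]; [rewrite E0 in HKx; lra|lra]).
    (* Since [(1 - x)^K (1 + x)^K <= 1], Bernoulli's inequality for [1 + x] bounds [(1 - x)^K] by
       [1 / (1 + K x)]. *)
    assert (H3 : 1 + INR K * x <= (1 + x) ^ K) by (now apply poly).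
    assert (H4 : (1 - x) ^ K * (1 + x) ^ K <= 1).
    { rewrite <- Rpow_mult_distr. apply Rle_trans with (1 ^ K); [apply pow_incr; split; nra|rewrite pow1; lra]. }
    assert (H5 : 0 <= (1 - x) ^ K) by (apply pow_le; lra).
    apply Rle_trans with (/ (1 + z) ^ k); [|exact Hik].
    apply Rmult_le_reg_r with ((1 + z) ^ k); [exact Hzk|]. rewrite Rinv_l by lra.
    apply Rle_trans with ((1 - x) ^ K * (1 + x) ^ K); [|exact H4]. apply Rmult_le_compat_l; lra.
Qed.

Section CLT.

Context (d : nat -> R -> R) (Hd : quasi_gaussian d).

Definition normalized (N : nat) (x : R) : R := dsum d N x / sqrt (INR N).

Lemma cont_normalized N : cont (normalized N).
Proof.
  assert (H := cont_sum d N (qg_cont d Hd)). unfold normalized. conti.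
Qed.

Lemma wsum_normalized t N x : wsum d (fun _ => t / sqrt (INR N)) N x = t * normalized N x.
Proof. unfold wsum. rewrite rsum_scal. unfold normalized, dsum. unfold Rdiv. ring. Qed.

Lemma wvar_normalized t N : (0 < N)%nat -> wvar (fun _ => t / sqrt (INR N)) N = t ^ 2.
Proof.
  intros HN. assert (H : 0 < INR N) by now apply lt_0_INR.
  unfold wvar. rewrite rsum_const.
  replace ((t / sqrt (INR N)) ^ 2) with (t ^ 2 / sqrt (INR N) ^ 2) by (field; apply Rgt_not_eq, sqrt_lt_R0, H).
  rewrite pow2_sqrt by lra. field. lra.
Qed.

Lemma normalized_sqr N : (0 < N)%nat -> E (fun x => normalized N x ^ 2) = 1/2.
Proof.
  intros HN. rewrite (E_ext _ (fun x => wsum d (fun _ => 1 / sqrt (INR N)) N x ^ 2))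
    by (intros; rewrite wsum_normalized; ring).
  rewrite (qg_sqr d Hd), wvar_normalized by exact HN. lra.
Qed.

(** [nu] is fixed by the precision, then [N] so large that the common weight [t / sqrt N] is at most
    [nu ^ -8] for every frequency of [P]. *)
Lemma normalized_test P eps : 0 < eps -> exists N0, (0 < N0)%nat /\ forall N, (N0 <= N)%nat ->
  Rabs (E (fun x => tval P (normalized N x)) - tmean half_char P) <= eps.
Proof.
  intros Heps. destruct (qg_char d Hd) as (C & HC & Hchar). destruct (tfreq_exists P) as (T & HT & HP).
  assert (HPn := tnorm_nonneg P).
  set (B := (1 + tnorm P) * (2 * (C * (1 + T ^ 2)))).
  assert (HB : 0 < B) by (unfold B; generalize (pow2_ge_0 T); intros; apply Rmult_lt_0_compat; nra).
  destruct (INR_unbounded (1 + B / eps)) as (nu & Hnu).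
  assert (HBe : 0 < B / eps) by (apply Rdiv_lt_0_compat; lra).
  assert (Hnu0 : (0 < nu)%nat) by (apply INR_lt; simpl; lra).
  assert (Hnu8 : 0 < INR nu ^ 8) by (apply pow_lt; lra).
  destruct (INR_unbounded (1 + (T * INR nu ^ 8) ^ 2)) as (N0 & HN0).
  assert (Hsq := pow2_ge_0 (T * INR nu ^ 8)).
  exists N0. split; [apply INR_lt; simpl; lra|]. intros N HN.
  assert (HNr : INR N0 <= INR N) by now apply le_INR.
  assert (HNp : (0 < N)%nat) by (apply INR_lt; simpl; lra).
  assert (HsN : T * INR nu ^ 8 <= sqrt (INR N)).
  { rewrite <- (sqrt_pow2 (T * INR nu ^ 8)) by (apply Rmult_le_pos; lra). apply sqrt_le_1_alt. lra. }
  assert (HsN0 : 0 < sqrt (INR N)) by (apply sqrt_lt_R0; lra).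
  set (kappa := 2 * (C * (1 + T ^ 2) / INR nu)).
  eapply Rle_trans; [apply (test_mean half_char (normalized N) T kappa P (cont_normalized N))|].
  - intros t e Ht.
    assert (Ht2 : t ^ 2 <= T ^ 2) by (rewrite <- (pow2_abs t); apply pow_incr; split; [apply Rabs_pos|exact Ht]).
    destruct (Hchar nu (fun _ => t / sqrt (INR N)) N Hnu0) as [H1 H2].
    { intros _. unfold Rdiv. rewrite Rabs_mult, (Rabs_pos_eq (/ _)) by (left; now apply Rinv_0_lt_compat).
      apply Rmult_le_reg_r with (sqrt (INR N)); [exact HsN0|]. rewrite Rmult_assoc, Rinv_l by lra.
      apply Rmult_le_reg_r with (INR nu ^ 8); [exact Hnu8|].
      replace (/ INR nu ^ 8 * sqrt (INR N) * INR nu ^ 8) with (sqrt (INR N)) by (field; lra).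
      assert (Rabs t * INR nu ^ 8 <= T * INR nu ^ 8) by (apply Rmult_le_compat_r; lra). lra. }
    rewrite wvar_normalized in H1, H2 by exact HNp. fold (half_char t) in H1.
    rewrite (E_ext _ (fun x => cos (t * normalized N x))) in H1 by (intros; now rewrite wsum_normalized).
    rewrite (E_ext _ (fun x => sin (t * normalized N x))) in H2 by (intros; now rewrite wsum_normalized).
    assert (Hr : C * (1 + t ^ 2) / INR nu <= C * (1 + T ^ 2) / INR nu).
    { unfold Rdiv. apply Rmult_le_compat_r; [left; apply Rinv_0_lt_compat; lra|]. apply Rmult_le_compat_l; lra. }
    assert (cN := cont_normalized N).
    apply (char_phase (fun x => t * normalized N x)); [conti|lra|lra].
  - exact HP.
  - apply Rle_trans with (B / INR nu).
    + unfold kappa, B. replace (2 * (C * (1 + T ^ 2) / INR nu)) with (2 * (C * (1 + T ^ 2)) / INR nu) by (field; lra).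
      unfold Rdiv. rewrite <- Rmult_assoc. apply Rmult_le_compat_r; [left; apply Rinv_0_lt_compat; lra|].
      apply Rmult_le_compat_r; [|lra]. generalize (pow2_ge_0 T). nra.
    + apply Rmult_le_reg_r with (INR nu); [lra|]. unfold Rdiv. rewrite Rmult_assoc, Rinv_l by lra.
      assert (B / eps * eps = B) by (field; lra). nra.
Qed.

Lemma normalized_gauss U eps : trig_poly U -> 0 < eps -> exists N0 A0, (0 < N0)%nat /\ 0 < A0 /\
  forall N A, (N0 <= N)%nat -> A0 <= A -> Rabs (E (fun x => U (normalized N x)) - gmean A U) <= eps.
Proof.
  intros (P & HP) Heps.
  destruct (normalized_test P (eps / 2)) as (N0 & HN0 & H1); [lra|].
  destruct (gauss_test P (eps / 2)) as (A0 & HA0 & H2); [lra|].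
  exists N0, A0. repeat split; auto. intros N A HN HA. specialize (H1 N HN). specialize (H2 A HA).
  rewrite (E_ext _ (fun x => U (normalized N x))) in H1 by (intros; apply HP).
  replace (gmean A (tval P)) with (gmean A U) in H2
    by (unfold gmean; apply RInt_ext; intros; now rewrite HP).
  apply Rabs_le_between in H1, H2. apply Rabs_le. lra.
Qed.

Lemma RInt_gd_split a b c : RInt gd a c = RInt gd a b + RInt gd b c :> R.
Proof. rewrite !RInt_gd. ring. Qed.

Lemma RInt_gd_le a b : a <= b -> 0 <= RInt gd a b <= b - a.
Proof.
  intros H. split.
  - apply RInt_ge_0; [exact H|apply cont_ex_RInt, cont_gd|]. intros; apply gd_bounds.
  - rewrite <- (Rmult_1_r (b - a)), <- RInt_const_R.
    apply RInt_le; [exact H|apply cont_ex_RInt, cont_gd|apply ex_RInt_const|]. intros; apply gd_bounds.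
Qed.

Lemma RInt_between f lo hi a b : cont f -> a <= b -> (forall u, a < u < b -> lo <= f u <= hi) ->
  lo * RInt gd a b <= RInt (fun u => f u * gd u) a b <= hi * RInt gd a b.
Proof.
  intros cf Hab H.
  assert (cfg : cont (fun u => f u * gd u)) by (apply cont_mult; [exact cf|apply cont_gd]).
  assert (Hs : forall c, c * RInt gd a b = RInt (fun u => c * gd u) a b).
  { intros c. symmetry. apply (RInt_scal gd). apply cont_ex_RInt, cont_gd. }
  rewrite !Hs. split; (apply RInt_le; [exact Hab| | |intros u Hu; specialize (H u Hu); generalize (gd_bounds u); nra]);
    try (apply cont_ex_RInt, cfg); apply cont_ex_RInt; apply cont_mult; try apply cont_const; apply cont_gd.
Qed.

Lemma trig_poly_cont U : trig_poly U -> cont U.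
Proof.
  intros (P & HP). apply (cont_ext (tval P)); [exact HP|]. apply (cont_tval P (fun x => x)), cont_id.
Qed.

(** On [[-L, L]] the trigonometric polynomials [U] and [W] lie, up to [e], above and below the
    indicator of the half-line, with their steps just right and left of [t]. Outside they merely
    stay in [[0, 1]], and the majorant [X^2 / L^2] with the exact second moment pays for that
    region. *)
Theorem clt (t eps : R) : 0 < eps -> exists N0, (0 < N0)%nat /\ forall N, (N0 <= N)%nat ->
  let ind := fun x => if Rle_dec (normalized N x) t then 1 else 0 in
  ex_RInt ind 0 1 -> Rabs (RInt ind 0 1 - (/ 2 + RInt gd 0 t)) < eps.
Proof.
  (* Each side loses at most [4 e] in the Gaussian mean, [e] in comparing means, [e] in the step and
     [e / 2] in the tail: less than [8 e] altogether. *)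
  intros Heps. set (e := Rmin (eps / 8) (1/2)).
  assert (He : 0 < e) by (unfold e; apply Rmin_glb_lt; lra).
  assert (He8 : 8 * e <= eps) by (unfold e; generalize (Rmin_l (eps / 8) (1/2)); lra).
  set (L := 2 + Rabs t + 2 / e).
  assert (H2e : 0 < 2 / e) by (apply Rdiv_lt_0_compat; lra).
  assert (Ht := Rabs_pos t). assert (Htt : - Rabs t <= t <= Rabs t).
  { split; [generalize (Rle_abs (- t)); rewrite Rabs_Ropp; lra|apply Rle_abs]. }
  assert (He1 : e <= 1/2) by apply Rmin_r.
  assert (HLe : / (L * L) <= e).
  { assert (H2 : 2 / e * e = 2) by (field; lra).
    rewrite <- (Rinv_inv e). apply Rinv_le_contravar; [now apply Rinv_0_lt_compat|].
    assert (/ e = 2 / e / 2) by (field; lra). unfold L. nra. }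
  assert (HLexp : exp (- (L * L)) <= e).
  { rewrite exp_Ropp. eapply Rle_trans; [|exact HLe]. apply Rinv_le_contravar; [unfold L; nra|].
    generalize (exp_ineq1_le (L * L)). lra. }
  assert (HL0 : 0 <= L) by (unfold L; lra).
  destruct (trig_step L t e e) as (U & HU & HU01 & HUlo & HUhi); [lra|unfold L; lra|unfold L; lra|lra|].
  destruct (trig_step L (t - e) e e) as (W & HW & HW01 & HWlo & HWhi); [lra|unfold L; lra|unfold L; lra|lra|].
  replace (t - e + e) with t in HWhi by ring.
  destruct (normalized_gauss U e HU He) as (N1 & A1 & HN1 & HA1 & H1).
  destruct (normalized_gauss W e HW He) as (N2 & A2 & HN2 & HA2 & H2).
  exists (N1 + N2)%nat. split; [lia|]. intros N HN ind Hind.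
  set (A := A1 + A2 + L). specialize (H1 N A ltac:(lia) ltac:(unfold A; lra)).
  specialize (H2 N A ltac:(lia) ltac:(unfold A; lra)).
  set (X := normalized N) in *. assert (cX : cont X) by apply cont_normalized.
  assert (HX2 : E (fun x => X x ^ 2) = 1/2) by (apply normalized_sqr; lia).
  assert (cU := trig_poly_cont U HU). assert (cW := trig_poly_cont W HW).
  assert (cUX : cont (fun x => U (X x))) by now apply cont_comp.
  assert (cWX : cont (fun x => W (X x))) by now apply cont_comp.
  assert (HLL : 0 < L * L) by (unfold L; nra).
  assert (Htail : forall x, L < Rabs (X x) -> 1 <= / (L * L) * X x ^ 2).
  { intros x Hx. apply Rmult_le_reg_l with (L * L); [exact HLL|].
    rewrite <- Rmult_assoc, Rinv_r by lra. rewrite <- pow2_abs. nra. }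
  assert (Htail0 : forall x, 0 <= / (L * L) * X x ^ 2).
  { intros x. apply Rmult_le_pos; [left; now apply Rinv_0_lt_compat|apply pow2_ge_0]. }
  assert (Hup : RInt ind 0 1 <= E (fun x => U (X x) + (e + / (L * L) * X x ^ 2))).
  { apply RInt_le; [lra|exact Hind|apply cont_ex_RInt; conti|]. intros x _. unfold ind. fold (X x).
    generalize (HU01 (X x)) (Htail0 x). intros. destruct Rle_dec as [Hle|Hle]; [|lra].
    destruct (Rle_dec (- L) (X x)).
    - generalize (HUlo (X x) ltac:(lra)). lra.
    - generalize (Htail x). rewrite Rabs_left by (unfold L in *; lra). intros Ht'. specialize (Ht' ltac:(lra)). lra. }
  assert (Hlow : E (fun x => W (X x) - (e + / (L * L) * X x ^ 2)) <= RInt ind 0 1).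
  { apply RInt_le; [lra|apply cont_ex_RInt; conti|exact Hind|]. intros x _. unfold ind. fold (X x).
    generalize (HW01 (X x)) (Htail0 x). intros. destruct Rle_dec as [Hle|Hle]; [lra|].
    destruct (Rle_dec (X x) L).
    - generalize (HWhi (X x) ltac:(lra)). lra.
    - generalize (Htail x). rewrite Rabs_pos_eq by lra. intros Ht'. specialize (Ht' ltac:(lra)). lra. }
  rewrite !E_plus in Hup by conti. rewrite E_const, E_scal, HX2 in Hup by conti.
  rewrite E_minus, E_plus in Hlow by conti. rewrite E_const, E_scal, HX2 in Hlow by conti.
  destruct (half_mass L HL0) as [HmR HmL]. destruct (half_mass A ltac:(unfold A; lra)) as [HmRA HmLA].
  assert (HgU : gmean A U <= / 2 + RInt gd 0 t + 4 * e).
  { unfold gmean.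
    assert (cUg : forall a b, ex_RInt (fun u => U u * gd u) a b)
      by (intros; apply cont_ex_RInt, cont_mult; [exact cU|apply cont_gd]).
    assert (Hsp : RInt (fun u => U u * gd u) (- A) A = RInt (fun u => U u * gd u) (- A) (t + e)
       + (RInt (fun u => U u * gd u) (t + e) L + RInt (fun u => U u * gd u) L A)).
    { rewrite <- (RInt_Chasles (fun u => U u * gd u) (- A) (t + e) A) by apply cUg.
      rewrite <- (RInt_Chasles (fun u => U u * gd u) (t + e) L A) by apply cUg. reflexivity. }
    rewrite Hsp.
    assert (G1 := RInt_between U 0 1 (- A) (t + e) cU ltac:(unfold A, L; lra) ltac:(intros; apply HU01)).
    assert (G2 := RInt_between U 0 e (t + e) L cU ltac:(unfold L; lra)
      ltac:(intros u Hu; split; [apply HU01|apply HUhi; lra])).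
    assert (G3 := RInt_between U 0 1 L A cU ltac:(unfold A; lra) ltac:(intros; apply HU01)).
    assert (S1 := RInt_gd_split (- A) 0 (t + e)). assert (S2 := RInt_gd_split 0 t (t + e)).
    assert (S3 := RInt_gd_split 0 L A).
    assert (B1 := RInt_gd_le t (t + e) ltac:(lra)).
    assert (B2 : RInt gd (t + e) L <= 1).
    { assert (S4 := RInt_gd_split (- A) (t + e) L). assert (S5 := RInt_gd_split (- A) 0 L).
      assert (B3 := RInt_gd_le (- A) (t + e) ltac:(unfold A, L; lra)). lra. }
    assert (e * RInt gd (t + e) L <= e) by nra. lra. }
  assert (HgW : / 2 + RInt gd 0 t - 4 * e <= gmean A W).
  { unfold gmean.
    assert (cWg : forall a b, ex_RInt (fun u => W u * gd u) a b)
      by (intros; apply cont_ex_RInt, cont_mult; [exact cW|apply cont_gd]).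
    assert (Hsp : RInt (fun u => W u * gd u) (- A) A = RInt (fun u => W u * gd u) (- A) (- L)
       + (RInt (fun u => W u * gd u) (- L) (t - e) + RInt (fun u => W u * gd u) (t - e) A)).
    { rewrite <- (RInt_Chasles (fun u => W u * gd u) (- A) (- L) A) by apply cWg.
      rewrite <- (RInt_Chasles (fun u => W u * gd u) (- L) (t - e) A) by apply cWg. reflexivity. }
    rewrite Hsp.
    assert (G1 := RInt_between W 0 1 (- A) (- L) cW ltac:(unfold A; lra) ltac:(intros; apply HW01)).
    assert (G2 := RInt_between W (1 - e) 1 (- L) (t - e) cW ltac:(unfold L; lra)
      ltac:(intros u Hu; split; [apply HWlo; lra|apply HW01])).
    assert (G3 := RInt_between W 0 1 (t - e) A cW ltac:(unfold A, L; lra) ltac:(intros; apply HW01)).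
    assert (S1 := RInt_gd_split (- L) 0 (t - e)). assert (S2 := RInt_gd_split 0 (t - e) t).
    assert (B1 := RInt_gd_le (t - e) t ltac:(lra)).
    assert (B2 : RInt gd (- L) (t - e) <= 1).
    { assert (S4 := RInt_gd_split (- L) (t - e) L). assert (S5 := RInt_gd_split (- L) 0 L).
      assert (B3 := RInt_gd_le (t - e) L ltac:(unfold L; lra)). lra. }
    assert (e * RInt gd (- L) (t - e) <= e) by nra. lra. }
  apply Rabs_le_between in H1, H2.
  apply Rabs_def1; lra.
Qed.

End CLT.

(** * The events of the central limit theorem are finite unions of intervals *)

Fixpoint peval (p : list R) (y : R) : R :=
  match p with [] => 0 | c :: q => c + y * peval q y end.

Definition finite_zeros (f : R -> R) : Prop :=
  (forall y, f y = 0) \/ exists l, forall y, f y = 0 -> In y l.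

(** Synthetic division; the shorter quotient drives the induction that makes the roots finite in
    number. *)
Lemma peval_factor p r : exists q, length q = pred (length p) /\
  forall y, peval p y = (y - r) * peval q y + peval p r.
Proof.
  induction p as [|c p (q & Hq & H)].
  - exists []. split; [reflexivity|]. intros; simpl; ring.
  - destruct p as [|c' p].
    + exists []. split; [reflexivity|]. intros; simpl; ring.
    + exists (peval (c' :: p) r :: q). split; [simpl in *; lia|].
      intros y. change (peval (c :: c' :: p) y) with (c + y * peval (c' :: p) y).
      change (peval (c :: c' :: p) r) with (c + r * peval (c' :: p) r).
      change (peval (peval (c' :: p) r :: q) y) with (peval (c' :: p) r + y * peval q y).
      assert (Hy := H y). rewrite Hy. ring.
Qed.

Lemma peval_zeros k : forall p, (length p <= k)%nat -> finite_zeros (peval p).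
Proof.
  induction k as [|k IH]; intros p Hp.
  - left. destruct p; [reflexivity|simpl in Hp; lia].
  - destruct (excluded_middle_informative (exists r, peval p r = 0)) as [(r & Hr)|Hn].
    + destruct (peval_factor p r) as (q & Hq & H). rewrite Hr in H.
      destruct (IH q ltac:(lia)) as [H0|(l & Hl)].
      * left. intros y. rewrite H, H0. ring.
      * right. exists (r :: l). intros y Hy. rewrite H, Rplus_0_r in Hy.
        apply Rmult_integral in Hy. destruct Hy as [Hy|Hy]; [left; lra|right; auto].
    + right. exists []. intros y Hy. exfalso. apply Hn. now exists y.
Qed.

Lemma peval_plus p : forall q, exists r, forall y, peval r y = peval p y + peval q y.
Proof.
  induction p as [|c p IH]; intros q.
  - exists q. intros; simpl; ring.
  - destruct q as [|c' q].
    + exists (c :: p). intros; simpl; ring.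
    + destruct (IH q) as (r & H). exists (c + c' :: r). intros y. simpl. rewrite H. ring.
Qed.

Lemma peval_scal a p : exists r, forall y, peval r y = a * peval p y.
Proof.
  induction p as [|c p (r & H)]; [exists []; intros; simpl; ring|].
  exists (a * c :: r). intros y. simpl. rewrite H. ring.
Qed.

(** Two consecutive degrees are carried along for the three-term recurrence of the Chebyshev
    polynomials. *)
Lemma chebyshev k : exists p, forall th, cos (INR k * th) = peval p (cos th).
Proof.
  cut ((exists p, forall th, cos (INR k * th) = peval p (cos th)) /\
       (exists p, forall th, cos (INR (S k) * th) = peval p (cos th))); [tauto|].
  induction k as [|k [(p & Hp) (p' & Hp')]].
  - split; [exists [1]|exists [0; 1]]; intros th; simpl; rewrite ?Rmult_0_l, ?cos_0, ?Rmult_1_l; ring.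
  - split; [now exists p'|].
    destruct (peval_scal (-1) p) as (r & Hr). destruct (peval_scal 2 p') as (r' & Hr').
    destruct (peval_plus (0 :: r') r) as (u & Hu). exists u. intros th. rewrite Hu.
    change (peval (0 :: r') (cos th)) with (0 + cos th * peval r' (cos th)).
    rewrite Hr, Hr', <- Hp, <- Hp'. rewrite !S_INR.
    replace ((INR k + 1 + 1) * th) with ((INR k + 1) * th + th) by ring.
    replace (INR k * th) with ((INR k + 1) * th - th) by ring.
    rewrite cos_plus, cos_minus. ring.
Qed.

(** A level set of the partial sum in [[0, 1]] is therefore finite or everything, which makes the
    indicator Riemann integrable. *)
Lemma psum_poly n s N : exists p, forall x, psum n s N x = peval p (cos (2 * PI * x)).
Proof.
  induction N as [|N (p & Hp)].
  - exists []. reflexivity.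
  - destruct (chebyshev (n (s N))) as (q & Hq). destruct (peval_plus p q) as (r & Hr).
    exists r. intros x. simpl. rewrite Hr, Hp, <- Hq. do 2 f_equal. ring.
Qed.

Lemma cos_2PI_zeros r : exists l, forall x, 0 <= x <= 1 -> cos (2 * PI * x) = r -> In x l.
Proof.
  assert (HP := PI_RGT_0). exists [acos r / (2 * PI); 1 - acos r / (2 * PI)].
  intros x Hx Hr. destruct (Rle_dec x (1/2)) as [H|H].
  - left. rewrite <- Hr, acos_cos by nra. field. lra.
  - right. left. replace (cos (2 * PI * x)) with (cos (2 * PI * (1 - x))) in Hr.
    + rewrite <- Hr, acos_cos by nra. field. lra.
    + replace (2 * PI * (1 - x)) with (- (2 * PI * x) + 2 * INR 1 * PI) by (simpl; ring).
      rewrite cos_period. apply cos_neg.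
Qed.

Lemma psum_level_zeros n s N c :
  (forall x, psum n s N x = c) \/ exists l, forall x, 0 <= x <= 1 -> psum n s N x = c -> In x l.
Proof.
  destruct (psum_poly n s N) as (p & Hp). destruct (peval_plus p [- c]) as (q & Hq).
  assert (Hpq : forall x, psum n s N x = c <-> peval q (cos (2 * PI * x)) = 0).
  { intros x. rewrite Hq, Hp. simpl. split; lra. }
  destruct (peval_zeros (length q) q (le_n _)) as [H|(l & Hl)].
  - left. intros x. apply Hpq, H.
  - right. clear Hq. assert (Hall : forall l, exists l', forall x, 0 <= x <= 1 -> In (cos (2 * PI * x)) l -> In x l').
    { induction l0 as [|r l0 (l' & H')]; [exists []; simpl; tauto|].
      destruct (cos_2PI_zeros r) as (l2 & H2). exists (l2 ++ l'). intros x Hx [Hr|Hr]; apply in_or_app; auto. }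
    destruct (Hall l) as (l' & Hl'). exists l'. intros x Hx H. apply Hl'; [exact Hx|]. apply Hl, Hpq, H.
Qed.

(** Induction on the number of candidate zeros: split at one inside the interval. Without any, the
    intermediate value theorem keeps the sign of [h] constant on the open interval. *)
Lemma ex_RInt_level h k : cont h -> forall l a b, (length l <= k)%nat -> a <= b ->
  (forall x, a < x < b -> h x = 0 -> In x l) ->
  ex_RInt (fun x => if Rle_dec (h x) 0 then 1 else 0) a b.
Proof.
  intros ch. induction k as [|k IH]; intros l a b Hl Hab Hz.
  - destruct l; [|simpl in Hl; lia].
    destruct (Req_dec a b) as [->|Hne]; [apply ex_RInt_point|].
    assert (Hsgn : forall x y, a < x -> x < y -> y < b -> (h x <= 0 <-> h y <= 0)).
    { intros x y Hx Hxy Hy.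
      assert (Hno : forall z, a < z < b -> h z <> 0) by (intros z Hab' Hz0; apply (Hz z Hab' Hz0)).
      assert (Hcx : forall z, x <= z <= y -> continuity_pt h z) by (intros; apply continuity_pt_filterlim, ch).
      split; intros H; apply Rnot_lt_le; intros H'.
      - destruct (IVT_interv h x y Hcx Hxy) as (z & Hz1 & Hz2); [|exact H'|apply (Hno z); lra].
        destruct H as [H|H]; [exact H|]. exfalso. apply (Hno x); lra.
      - destruct (IVT_interv (fun x => - h x) x y) as (z & Hz1 & Hz2); [|exact Hxy|lra| |apply (Hno z); lra].
        + intros z Hz1. apply continuity_pt_opp, Hcx, Hz1.
        + destruct H as [H|H]; [lra|]. exfalso. apply (Hno y); lra. }
    set (m := (a + b) / 2). assert (Hm : a < m < b) by (unfold m; lra).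
    apply (ex_RInt_ext (fun _ => if Rle_dec (h m) 0 then 1 else 0)); [|apply ex_RInt_const].
    intros x Hx. rewrite Rmin_left, Rmax_right in Hx by lra.
    assert (Hxm : h m <= 0 <-> h x <= 0).
    { destruct (Rtotal_order x m) as [H|[->|H]]; [|tauto|].
      - symmetry. apply Hsgn; lra.
      - apply Hsgn; lra. }
    destruct (Rle_dec (h m) 0), (Rle_dec (h x) 0); tauto.
  - destruct (excluded_middle_informative (exists z, a < z < b /\ In z l)) as [(z & Hzab & Hzl)|Hn].
    + destruct (in_split z l Hzl) as (l1 & l2 & Hl12).
      assert (Hlen : (length (l1 ++ l2) <= k)%nat).
      { rewrite Hl12 in Hl. rewrite length_app in *. simpl in Hl. lia. }
      assert (Hin : forall x, x <> z -> In x l -> In x (l1 ++ l2)).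
      { intros x Hx Hxl. rewrite Hl12 in Hxl. apply in_app_or in Hxl. apply in_or_app.
        destruct Hxl as [H|[H|H]]; [now left|congruence|now right]. }
      apply (ex_RInt_Chasles _ a z b); apply (IH (l1 ++ l2)); try exact Hlen; try lra;
        intros x Hx Hx0; apply Hin; try lra; apply Hz; lra.
    + apply (IH []); [simpl; lia|exact Hab|]. intros x Hx Hx0. exfalso. apply Hn. exists x. split; [exact Hx|]. now apply Hz.
Qed.

Lemma ex_RInt_ind_le n s N t : ex_RInt (ind_le n s N t) 0 1.
Proof.
  assert (cpsum : cont (psum n s N)).
  { apply (cont_ext (dsum (fun i => wave n (s i)) N)); [intros; symmetry; apply psum_sum|].
    apply cont_sum. intros; apply cont_wave. }
  set (h := fun x => psum n s N x / sqrt (INR N) - t).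
  assert (ch : cont h) by (unfold h; conti).
  apply (ex_RInt_ext (fun x => if Rle_dec (h x) 0 then 1 else 0)).
  { intros x _. unfold ind_le, h. destruct Rle_dec, Rle_dec; lra. }
  (* The zero case is [N = 0]: the quotient by zero is 0, and the indicator is constant. *)
  destruct (Req_dec (sqrt (INR N)) 0) as [H0|H0].
  - apply (ex_RInt_ext (fun _ => if Rle_dec (- t) 0 then 1 else 0)); [|apply ex_RInt_const].
    intros x _. unfold h. rewrite H0. unfold Rdiv. rewrite Rinv_0, Rmult_0_r, Rminus_0_l. reflexivity.
  - assert (Hh : forall x, h x = 0 <-> psum n s N x = t * sqrt (INR N)).
    { intros x. unfold h. split; intros H.
      - replace (psum n s N x) with ((psum n s N x / sqrt (INR N) - t) * sqrt (INR N) + t * sqrt (INR N)) by (field; exact H0).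
        rewrite H. ring.
      - rewrite H. field. exact H0. }
    destruct (psum_level_zeros n s N (t * sqrt (INR N))) as [H|(l & Hl)].
    + apply (ex_RInt_ext (fun _ => 1)); [|apply ex_RInt_const].
      intros x _. rewrite (proj2 (Hh x) (H x)). destruct Rle_dec; lra.
    + apply (ex_RInt_level h (length l) ch l); [lia|lra|].
      intros x Hx Hx0. apply Hl; [lra|]. now apply Hh.
Qed.

Theorem theorem1 (n s : nat -> nat) :
  hadamard_gap n -> is_permutation s ->
  (* convergence in distribution to N(0,1/2): the lambda-measure of
     {x in [0,1] : S_N(x)/sqrt N <= t} tends to Phi(t) for every t *)
  (forall (t : R) (prG : Riemann_integrable gauss_half_density 0 t) (eps : R),
     eps > 0 ->
     exists N0 : nat, forall N : nat, (N >= N0)%nat ->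
       exists pr : Riemann_integrable (ind_le n s N t) 0 1,
         Rabs (RiemannInt pr - (/ 2 + RiemannInt prG)) < eps)
  /\
  (* law of the iterated logarithm, lambda-a.e. on [0,1] *)
  lebesgue_null (fun x => 0 <= x <= 1 /\
     ~ limsup_eq (fun N => psum n s N x / sqrt (INR N * ln (ln (INR N)))) 1).
Proof.
  intros Hn Hs. split; [|now apply lil].
  intros t prG eps Heps.
  destruct (clt _ (lacunary_quasi_gaussian n s Hn Hs) t eps Heps) as (N0 & _ & H).
  exists N0. intros N HN. exists (ex_RInt_Reals_0 _ _ _ (ex_RInt_ind_le n s N t)).
  rewrite <- !RInt_Reals.
  assert (Hext : forall x, ind_le n s N t x =
    if Rle_dec (normalized (fun i => wave n (s i)) N x) t then 1 else 0).
  { intros x. unfold ind_le, normalized. rewrite psum_sum. reflexivity. }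
  rewrite (RInt_ext (ind_le n s N t) _) by (intros; apply Hext).
  apply (H N HN). apply (ex_RInt_ext (ind_le n s N t)); [intros; apply Hext|apply ex_RInt_ind_le].
Qed.
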